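(* Let $x,\alpha,\beta\in\mathbb{C}$ and define $$P:=\frac{\Gamma\left(\frac12(x-\alpha+1)\right)\Gamma\left(\frac12(x+\alpha+\beta+1)\right)\Gamma\left(\frac12(x-\beta+1)\right)}{\Gamma\left(\frac12(x+\alpha+1)\right)\Gamma\left(\frac12(x-\alpha-\beta+1)\right)\Gamma\left(\frac12(x+\beta+1)\right)}.$$ Assume that $\Re(x)>0$, or assume that either $\alpha$, $\beta$, or $\alpha+\beta$ is an even integer. Then $$\frac{1-P}{1+P}=\cfrac{\alpha\beta(\alpha+\beta)/4}{b_0(x)+\mathbf{K}_{m=1}^{\infty}\left(\frac{a_m}{b_m(x)}\right)}=\cfrac{\alpha\beta(\alpha+\beta)/4}{x^2+\lambda_0+\mathbf{K}_{m=1}^{\infty}\left(\frac{\kappa_m}{x^2+\lambda_m}\right)},$$ where $b_0(x)=x^2-1-\alpha\beta(\alpha+\beta)/4$, and for every integer $m\ge1$ $$a_{2m}=\tfrac14(2m+\alpha)(2m-\alpha-\beta)(2m+\beta),\qquad a_{2m-1}=\tfrac14(2m-\alpha)(2m+\alpha+\beta)(2m-\beta),$$ $$b_{2m}(x)=(x^2-1)(2m+1),\qquad b_{2m-1}(x)=1,$$ and $$\kappa_m=-\frac{\left((2m)^2-\alpha^2\right)\left((2m)^2-(\alpha+\beta)^2\right)\left((2m)^2-\beta^2\right)}{16(2m-1)(2m+1)}\quad(m\ge1),$$ $$\lambda_m=\tfrac12\left(4m^2+4m+2-\alpha^2-\alpha\beta-\beta^2\right)\quad(m\ge0).$$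
   Context: For complex sequences $(a_n)_{n\ge1}$, $(b_n)_{n\ge0}$, the continued fraction $b_0+\mathbf{K}_{n=1}^{\infty}\left(\frac{a_n}{b_n}\right)=b_0+\cfrac{a_1}{b_1+\cfrac{a_2}{b_2+\cdots}}$ is defined as the limit as $n\to\infty$ of its $n$th approximant $b_0+\mathbf{K}_{k=1}^{n}\left(\frac{a_k}{b_k}\right)=b_0+\cfrac{a_1}{b_1+\cfrac{a_2}{\ddots+\cfrac{a_n}{b_n}}}$. The notation $\cfrac{a_0}{b_0+\mathbf{K}_{m=1}^{\infty}\left(\frac{a_m}{b_m}\right)}$ means $a_0$ divided by $b_0+\mathbf{K}_{m=1}^{\infty}\left(\frac{a_m}{b_m}\right)$. $\Gamma$ is the Gamma function.
   Formalization: When Re(x)>0 the first equality is stated for x≠1: at x=1 all even approximants equal b_0(1) and it fails unless α, β or α+β is an even integer. In the even-integer case with αβ(α+β)=0, where K may diverge, both quotients are read as 0. Values lie in C∪{∞}. *)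

(* Defs.v *)
From HB Require Import structures.
From mathcomp Require Import all_boot all_order all_algebra.
From mathcomp Require Import complex.
From mathcomp Require Import all_classical all_reals all_analysis.

Set Implicit Arguments.
Unset Strict Implicit.
Unset Printing Implicit Defensive.

Import Order.TTheory GRing.Theory Num.Theory.
Import numFieldNormedType.Exports.

Local Open Scope classical_set_scope.
Local Open Scope ring_scope.
Local Open Scope complex_scope.

(* The usual topology of the complex plane: the one that every numFieldType
   inherits from its norm. *)
HB.instance Definition _ (R : realType) := NormedModule.copy R[i] R[i]^o.

(* The Riemann sphere: [Some z] is the finite point z, [None] is infinity. *)
Notation sphere R := (one_point_compactification R[i]).

Section Sphere.
Variable R : realType.
Local Notation C := R[i].
Local Notation Chat := (sphere R).

Definition addh (c : C) (w : Chat) : Chat :=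
  if w is Some v then Some (c + v) else None.

(* Only applied to factors different from 0, so that a product involving
   infinity is infinite. *)
Definition mulh (w1 w2 : Chat) : Chat :=
  match w1, w2 with Some u, Some v => Some (u * v) | _, _ => None end.

(* Division on the sphere, with 0 / w = 0 for every w, 0 included: a continued
   fraction terminates at a vanishing partial numerator.  The remaining
   indeterminate form, infinity / infinity, is given no meaningful value here
   and is treated apart in [gammaP] below. *)
Definition divh (w1 w2 : Chat) : Chat :=
  match w1, w2 with
  | Some u, Some v =>
      if u == 0 then Some 0 else if v == 0 then None else Some (u / v)
  | Some _, None => Some 0
  | None, _ => None
  end.

(* (1 - p) / (1 + p), which is -1 at infinity and infinity at -1. *)
Definition one_sub_div_one_add (p : Chat) : Chat :=
  if p is Some z then divh (Some (1 - z)) (Some (1 + z)) else Some (-1).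

End Sphere.

Section Gamma.
Variable R : realType.
Local Notation C := R[i].
Local Notation Chat := (sphere R).

Definition cexp (z : C) : C :=
  (expR (complex.Re z))%:C * (cos (complex.Im z) +i* sin (complex.Im z)).

(* The entire function 1 / Gamma, by the Euler-Gauss limit
   z (z + 1) ... (z + n) / (n! n^z). *)
Definition rGamma (z : C) : C :=
  lim ((\prod_(k < n.+1) (z + k%:R)) / (n`!%:R * cexp (z * (ln n%:R)%:C))
        @[n --> \oo]).

(* Sphere-valued: infinity at the poles 0, -1, -2, etc. *)
Definition Gamma (z : C) : Chat := divh (Some 1) (Some (rGamma z)).

Section GammaQuotient.
Variables alpha beta : C.

Definition Pnum (x : C) : Chat :=
  mulh (mulh (Gamma ((x - alpha + 1) / 2))
             (Gamma ((x + alpha + beta + 1) / 2)))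
       (Gamma ((x - beta + 1) / 2)).

Definition Pden (x : C) : Chat :=
  mulh (mulh (Gamma ((x + alpha + 1) / 2))
             (Gamma ((x - alpha - beta + 1) / 2)))
       (Gamma ((x + beta + 1) / 2)).

(* The quotient is a meromorphic function of x.  Where it reads
   infinity / infinity, its value is the limit at x. *)
Definition gammaP (x : C) : Chat :=
  match Pnum x, Pden x with
  | None, None => lim (divh (Pnum y) (Pden y) @[y --> x^'])
  | p, q => divh p q
  end.

End GammaQuotient.
End Gamma.

Section ContinuedFraction.
Variable R : realType.
Local Notation C := R[i].
Local Notation Chat := (sphere R).
Implicit Types a b : nat -> C.

(* a_k / (b_k + a_(k+1) / (b_(k+1) + ... )), with n partial quotients. *)
Fixpoint cfrac_tail a b (k n : nat) : Chat :=
  if n is n'.+1 then divh (Some (a k)) (addh (b k) (cfrac_tail a b k.+1 n'))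
  else Some 0.

Definition approximant a b (n : nat) : Chat :=
  addh (b 0%N) (cfrac_tail a b 1 n).

(* The continued fraction b_0 + K_(n >= 1) (a_n / b_n) converges on the sphere
   and v is a0 divided by its value. *)
Definition is_cfrac_quot (a0 : C) a b (v : Chat) : Prop :=
  exists2 w : Chat,
    (approximant a b n @[n --> \oo] --> w) & v = divh (Some a0) w.

(* The same when a0 is allowed to be a terminating numerator: for a0 = 0 the
   quotient is 0 and nothing is required of the denominator. *)
Definition is_cfrac_quot_term (a0 : C) a b (v : Chat) : Prop :=
  (a0 = 0 /\ v = Some 0) \/ is_cfrac_quot a0 a b v.

End ContinuedFraction.

Section Coefficients.
Variable R : realType.
Local Notation C := R[i].
Variables alpha beta : C.

Definition even_integer (z : C) : Prop := exists k : int, z = (2 * k)%:~R.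

Definition numerator0 : C := alpha * beta * (alpha + beta) / 4.

(* a_n for n >= 1, where n = 2m or n = 2m - 1 and [uphalf n] is m in both
   cases. *)
Definition acoef (n : nat) : C :=
  let m : C := (uphalf n)%:R in
  if odd n then
    (2 * m - alpha) * (2 * m + alpha + beta) * (2 * m - beta) / 4
  else
    (2 * m + alpha) * (2 * m - alpha - beta) * (2 * m + beta) / 4.

(* At x = 1 every b_(2m) with m >= 1 vanishes.  Unless some a_n is 0, all
   approximants of even index are then equal to b_0, whereas those of odd index
   tend to another value: the fraction with coefficients [acoef] and
   [bcoef 1] diverges. *)
Definition bcoef (x : C) (n : nat) : C :=
  if n == 0%N then x ^+ 2 - 1 - numerator0
  else if odd n then 1
  else (x ^+ 2 - 1) * (2 * (n./2)%:R + 1).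

Definition kappa (m : nat) : C :=
  - (((2 * m%:R) ^+ 2 - alpha ^+ 2) * ((2 * m%:R) ^+ 2 - (alpha + beta) ^+ 2)
     * ((2 * m%:R) ^+ 2 - beta ^+ 2))
  / (16 * (2 * m%:R - 1) * (2 * m%:R + 1)).

Definition lambda (m : nat) : C :=
  (4 * m%:R ^+ 2 + 4 * m%:R + 2 - alpha ^+ 2 - alpha * beta - beta ^+ 2) / 2.

End Coefficients.

(* Main.v *)
Require Import Defs.
From mathcomp Require Import all_boot all_order all_algebra.
From mathcomp Require Import complex.
From mathcomp Require Import all_classical all_reals all_analysis.
From mathcomp Require Import ring lra.

(** Put c = alpha beta (alpha + beta) / 4, z = (x - 1) / 2,
    U (t) = (t + alpha / 2) (t + beta / 2) (t - (alpha + beta) / 2) and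
    V (t) = - U (- t).  Both continued fractions come from the recurrence

      U (n + 1) y (n + 1) =
        (2 (2 n + 1) z (z + 1) + U (n + 1) + V (n)) y (n) - V (n) y (n - 1).

    Up to a rescaling, the numerators and denominators of the second fraction
    solve it ([recurs_solves_at]), and the even part of the first fraction is
    equivalent to the second one ([first_even]).

    The Gamma functions come from a contiguous relation ([shift_up]): it sends
    solutions for x to solutions for x + 2, multiplies y (0) + y (-1) by
    U (z + 1) and multiplies y (0) - y (-1) by V (z + 1).  Iterated and
    normalised as in Gauss's limit for 1 / Gamma, these factors converge to
    Gu = 1 / (denominator of P) and Gv = 1 / (numerator of P), so that
    P = Gu / Gv.  If y (0) becomes negligible before y (-1) while x moves to
    the right, the limit reads

      (y (0) + y (-1)) Gu + (y (0) - y (-1)) Gv = 0,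

    that is (1 - P) / (1 + P) = y (0) / y (-1) ([shift_limit]).

    For Re x > 0, and U (n) V (n) <> 0 for every n >= 1, that solution is the
    minimal one.  Solutions behave like n^(-1 + x) or n^(-1 - x); a cone
    argument on the system formed by y and its Euler difference
    n (y (n) - y (n - 1)) shows that there is exactly one line of decaying
    solutions ([dichotomy], [minimal_exists], [minimal_unique]).  By
    Pincherle's argument both fractions tend to c y (-1) / y (0)
    ([regular_fractions]).  The shift preserves decay ([shift_up_decaying]),
    and far to the right a decaying solution satisfies
    D |y (0)| <= 2 |V (0)| |y (-1)| with D as large as desired: this holds for
    solutions with a zero, by downward induction from it
    ([dominated_below_zero]), and the minimal solution is a limit of these
    ([minimal_dominated]).

    If c <> 0 and U (n) V (n) = 0 for some n >= 1, which happens exactly when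
    alpha, beta or alpha + beta is an even integer, both fractions stop.  A
    finitely supported solution replaces the minimal one, for every x
    ([stopped_identity]), and where Gu and Gv vanish together the value of P
    follows by continuity ([gammaP_lim]).  If c = 0, then P = 1. *)

Set Implicit Arguments.
Unset Strict Implicit.
Unset Printing Implicit Defensive.

Import Order.TTheory GRing.Theory Num.Theory.
Import numFieldNormedType.Exports.

Local Open Scope ring_scope.

(** * Complex modulus and limits on the Riemann sphere *)

Section Modulus.
Local Open Scope complex_scope.
Local Open Scope classical_set_scope.
Variable R : realType.
Local Notation C := R[i].
Implicit Types z w : C.

(** The norm of C takes its values in C; estimates are made on its real part. *)
Definition cabs z : R := complex.Re `|z|.

Lemma normE z : `|z| = (cabs z)%:C.
Proof. by rewrite /cabs RRe_real ?normr_real. Qed.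

Lemma cabsE z : cabs z = Num.sqrt (complex.Re z ^+ 2 + complex.Im z ^+ 2).
Proof. by rewrite /cabs normc_def. Qed.

Lemma cabs_ge0 z : 0 <= cabs z.
Proof. by rewrite cabsE sqrtr_ge0. Qed.

Lemma cabsM z w : cabs (z * w) = cabs z * cabs w.
Proof. by apply: (@complexI R); rewrite rmorphM /= -!normE normrM. Qed.

Lemma cabsV z : cabs z^-1 = (cabs z)^-1.
Proof. by apply: (@complexI R); rewrite fmorphV /= -!normE normfV. Qed.

Lemma cabsN z : cabs (- z) = cabs z.
Proof. by rewrite /cabs normrN. Qed.

Lemma cabs0 : cabs 0 = 0.
Proof. by rewrite /cabs normr0. Qed.

Lemma cabs1 : cabs 1 = 1.
Proof. by rewrite /cabs normr1. Qed.

Lemma cabs_eq0 z : (cabs z == 0) = (z == 0).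
Proof. by rewrite -(inj_eq (@complexI R)) -normE normr_eq0. Qed.

Lemma cabs_gt0 z : (0 < cabs z) = (z != 0).
Proof. by rewrite lt_neqAle cabs_ge0 andbT eq_sym cabs_eq0. Qed.

Lemma cabsD z w : cabs (z + w) <= cabs z + cabs w.
Proof. by rewrite -lecR rmorphD /= -!normE ler_normD. Qed.

Lemma cabsB z w : cabs (z - w) <= cabs z + cabs w.
Proof. by rewrite -(cabsN w) cabsD. Qed.

Lemma cabs_distC z w : cabs (z - w) = cabs (w - z).
Proof. by rewrite -cabsN opprB. Qed.

Lemma cabs_subge z w : cabs z - cabs w <= cabs (z + w).
Proof. by rewrite lerBlDr -{1}(addrK w z) cabsB. Qed.

Lemma cabs_real (r : R) : cabs r%:C = `|r|.
Proof. by rewrite cabsE /= expr0n addr0 sqrtr_sqr. Qed.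

Lemma cabs_nat n : cabs (n%:R : C) = n%:R.
Proof. by rewrite -(rmorph_nat (real_complex R)) cabs_real normr_nat. Qed.

Lemma cabsX z n : cabs (z ^+ n) = cabs z ^+ n.
Proof. by elim: n => [|n IH]; rewrite ?expr0 ?cabs1 // !exprS cabsM IH. Qed.

Lemma normRe_le z : `|complex.Re z| <= cabs z.
Proof. by rewrite cabsE -sqrtr_sqr ler_wsqrtr // lerDl sqr_ge0. Qed.

Lemma Re_le z : complex.Re z <= cabs z.
Proof. exact: le_trans (ler_norm _) (normRe_le z). Qed.

Lemma normIm_le z : `|complex.Im z| <= cabs z.
Proof. by rewrite cabsE -sqrtr_sqr ler_wsqrtr // lerDr sqr_ge0. Qed.

Lemma cabs_le z : cabs z <= `|complex.Re z| + `|complex.Im z|.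
Proof.
rewrite cabsE -[leRHS]ger0_norm ?addr_ge0 // -sqrtr_sqr ler_wsqrtr //.
rewrite sqrrD !real_normK ?num_real //.
by rewrite -addrA lerD2l lerDr mulrn_wge0 // mulr_ge0.
Qed.

Lemma ReCD z w : complex.Re (z + w) = complex.Re z + complex.Re w.
Proof. by case: z w => [a b] [c d]. Qed.

Lemma ImCD z w : complex.Im (z + w) = complex.Im z + complex.Im w.
Proof. by case: z w => [a b] [c d]. Qed.

Lemma ReCN z : complex.Re (- z) = - complex.Re z.
Proof. by case: z. Qed.

Lemma ImCN z : complex.Im (- z) = - complex.Im z.
Proof. by case: z. Qed.

Lemma ReCM z w : complex.Re (z * w) =
  complex.Re z * complex.Re w - complex.Im z * complex.Im w.
Proof. by case: z w => [a b] [c d]. Qed.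

Lemma ImCM z w : complex.Im (z * w) =
  complex.Re z * complex.Im w + complex.Im z * complex.Re w.
Proof. by case: z w => [a b] [c d]. Qed.

Lemma natC n : (n%:R : C) = (n%:R : R)%:C.
Proof. by rewrite rmorph_nat. Qed.

Lemma invC (r : R) : (r%:C)^-1 = (r^-1)%:C :> C.
Proof. by rewrite fmorphV. Qed.

Lemma ReC_nat n : complex.Re (n%:R : C) = n%:R.
Proof. by rewrite natC. Qed.

Lemma ImC_nat n : complex.Im (n%:R : C) = 0.
Proof. by rewrite natC. Qed.

(** The topology of C comes from its complex-valued norm; real estimates reach it
    through this equivalence. *)
Lemma cvg_cabsP T (F : set_system T) {FF : Filter F} (f : T -> C) (l : C) :
  (f x @[x --> F] --> l) <-> (cabs (f x - l) @[x --> F] --> (0 : R)).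
Proof.
split=> [/cvgrPdist_lt h|/cvgrPdist_lt h]; apply/cvgrPdist_lt => e e0.
  have e0' : 0 < (e%:C : C) by rewrite ltcR.
  near=> t; rewrite sub0r normrN ger0_norm ?cabs_ge0 // cabs_distC -ltcR -normE.
  by near: t; exact: h.
have eE : e = (complex.Re e)%:C by rewrite RRe_real // gtr0_real.
have e0' : 0 < complex.Re e by rewrite -ltcR -eE.
near=> t; rewrite normE eE ltcR cabs_distC.
have -> : cabs (f t - l) = `|0 - cabs (f t - l)|.
  by rewrite sub0r normrN ger0_norm ?cabs_ge0.
by near: t; exact: h.
Unshelve. all: by end_near. Qed.

Lemma cvg_cabs_le T (F : set_system T) {FF : Filter F} (f : T -> C) (l : C)
    (g : T -> R) :
  (\forall x \near F, cabs (f x - l) <= g x) -> g x @[x --> F] --> (0 : R) ->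
  f x @[x --> F] --> l.
Proof.
move=> h g0; apply/cvg_cabsP; apply: (@squeeze_cvgr _ _ _ _ (cst 0) g) => //.
  by near=> t; rewrite cabs_ge0 /=; near: t.
exact: cvg_cst.
Unshelve. all: by end_near. Qed.

Lemma cvg_cabs T (F : set_system T) {FF : Filter F} (f : T -> C) (l : C) :
  f x @[x --> F] --> l -> cabs (f x) @[x --> F] --> cabs l.
Proof.
move=> /cvg_cabsP /cvgrPdist_lt h; apply/cvgrPdist_lt => e e0.
near=> t; apply: (@le_lt_trans _ _ `|0 - cabs (f t - l)|); last first.
  by near: t; exact: h.
rewrite sub0r normrN (ger0_norm (cabs_ge0 _)) ler_norml; apply/andP; split.
  rewrite lerNl opprB lerBlDr -{1}(subrK l (f t)); exact: cabsD.
by rewrite lerBlDr cabs_distC -{1}(subrK (f t) l); exact: cabsD.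
Unshelve. all: by end_near. Qed.

Lemma cabs_continuous : continuous (cabs : C -> R).
Proof. by move=> z; apply: (@cvg_cabs C (nbhs z) _ id z). Qed.

Lemma cvg_Complex T (F : set_system T) {FF : Filter F} (f g : T -> R) a b :
  f x @[x --> F] --> a -> g x @[x --> F] --> b ->
  (f x +i* g x : C) @[x --> F] --> (a +i* b : C).
Proof.
move=> /cvgrPdist_lt fa /cvgrPdist_lt gb; apply/cvg_cabsP/cvgrPdist_lt => e e0.
have e2 : 0 < e / 2 by lra.
near=> t; rewrite sub0r normrN ger0_norm ?cabs_ge0 //.
apply: (le_lt_trans (cabs_le _)) => /=.
have : `|a - f t| < e / 2 by near: t; exact: fa.
have : `|b - g t| < e / 2 by near: t; exact: gb.
by rewrite (distrC a) (distrC b); lra.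
Unshelve. all: by end_near. Qed.

Lemma compact_cabs_bounded (K : set C) : compact K ->
  exists M : R, forall z, K z -> cabs z <= M.
Proof.
move=> cK.
have /compact_bounded [M [_ /(_ (M + 1))]] : compact (cabs @` K).
  apply: continuous_compact => //; apply: continuous_subspaceT.
  exact: cabs_continuous.
rewrite ltrDl ltr01 => /(_ isT) hM; exists (M + 1) => z Kz.
apply: le_trans (ler_norm _) _; apply: hM; exact: imageP.
Qed.

(** Local compactness of C is what separates infinity from the finite points of
    the sphere. *)
Lemma compact_nbhs (z : C) : exists K : set C, [/\ compact K, closed K & nbhs z K].
Proof.
pose I1 := `[complex.Re z - 1, complex.Re z + 1]%classic.
pose I2 := `[complex.Im z - 1, complex.Im z + 1]%classic.
pose h (p : R * R) : C := p.1 +i* p.2.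
have ch : continuous h.
  by move=> p; apply: cvg_Complex; [exact: cvg_fst|exact: cvg_snd].
have cK : compact (h @` (I1 `*` I2)).
  apply: continuous_compact; first exact: continuous_subspaceT.
  by apply: compact_setX; exact: segment_compact.
exists (h @` (I1 `*` I2)); split => //.
  by apply: compact_closed => //; exact: norm_hausdorff.
have n1 : nbhs z (fun w : C => `|z - w| < 1) by exact: (nbhs_ball_norm z 1%:pos).
apply: (filterS _ n1) => w; rewrite normE ltcR => zw.
exists (complex.Re w, complex.Im w); last by case: w zw.
have := le_lt_trans (normRe_le _) zw; have := le_lt_trans (normIm_le _) zw.
rewrite ReCD ReCN ImCD ImCN !ltr_norml => /andP[? ?] /andP[? ?].
by split; rewrite /I1 /I2 /= in_itv /=; apply/andP; split; lra.
Qed.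

(** The point [a : b] of the projective line, read on the Riemann sphere. *)
Definition pt (a b : C) : sphere R := if b == 0 then None else Some (a / b).

Lemma ptZ k a b : k != 0 -> pt (k * a) (k * b) = pt a b.
Proof.
move=> k0; rewrite /pt mulf_eq0 (negbTE k0) /=; case: eqP => // _.
by congr Some; rewrite -mulf_div divff // mul1r.
Qed.

Lemma pt_eq a b c d : (c, d) != 0 -> (a, b) != 0 -> a * d = b * c ->
  pt a b = pt c d.
Proof.
rewrite /pt !xpair_eqE !negb_and => cd ab e; case: eqP => [b0|/eqP b0].
  have a0 : a != 0 by move: ab; rewrite b0 eqxx orbF.
  move: e; rewrite b0 mul0r => /eqP; rewrite mulf_eq0 (negbTE a0) /= => /eqP ->.
  by rewrite eqxx.
case: eqP => [d0|/eqP d0].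
  have c0 : c != 0 by move: cd; rewrite d0 eqxx orbF.
  by move: e; rewrite d0 mulr0 => /esym/eqP; rewrite mulf_eq0 (negbTE b0) (negbTE c0).
by congr Some; apply/eqP; rewrite eqr_div // e mulrC.
Qed.

(** Compact sets are bounded, so whatever leaves every disc tends to infinity. *)
Lemma sphere_cvg_None T (F : set_system T) {FF : Filter F} (f : T -> sphere R) :
  (forall M : R, \forall x \near F, if f x is Some z then M < cabs z else true) ->
  f x @[x --> F] --> (None : sphere R).
Proof.
move=> h A [K [cK _] KA]; have [M hM] := compact_cabs_bounded cK.
apply: filterS (h M) => x hx; apply: KA; move: hx => /=.
case: (f x) => [z Mz|_]; last by right.
by left; exists z => // Kz; have := hM _ Kz; rewrite leNgt Mz.
Qed.

(** Homogeneous coordinates make quotients continuous on the sphere, poles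
    included. *)
Lemma cvg_pt T (F : set_system T) {FF : Filter F} (f g : T -> C) (a b : C) :
  (a, b) != 0 -> f x @[x --> F] --> a -> g x @[x --> F] --> b ->
  pt (f x) (g x) @[x --> F] --> pt a b.
Proof.
rewrite xpair_eqE negb_and => ab fa gb; rewrite {2}/pt.
case: eqP => [b0|/eqP b0].
  rewrite b0 in gb.
  have a0 : 0 < cabs a by move: ab; rewrite b0 eqxx orbF cabs_gt0.
  apply: sphere_cvg_None => M.
  have a2 : 0 < cabs a / 2 by rewrite divr_gt0.
  have fa1 : cabs (f x) @[x --> F] --> cabs a by exact: cvg_cabs.
  move/cvgrPdist_lt: fa1 => fa1; have fa' := fa1 _ a2.
  have M0 : 0 < `|M| + 1 by rewrite ltr_pwDr.
  have e0 : 0 < cabs a / 2 / (`|M| + 1) by rewrite !divr_gt0.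
  have gb1 : cabs (g x) @[x --> F] --> cabs 0 by exact: cvg_cabs.
  move/cvgrPdist_lt: gb1 => gb1; have gb' := gb1 _ e0.
  near=> x; rewrite /pt; case: eqP => // /eqP gx.
  have h1 : `|cabs a - cabs (f x)| < cabs a / 2 by near: x.
  have h2 : `|cabs 0 - cabs (g x)| < cabs a / 2 / (`|M| + 1) by near: x.
  move: h2; rewrite cabs0 sub0r normrN (ger0_norm (cabs_ge0 _)) cabsM cabsV.
  rewrite ltr_pdivlMr // => h2; rewrite ltr_pdivlMr ?cabs_gt0 //.
  move: h1; rewrite ltr_norml => /andP[_ h1].
  have c0 := cabs_ge0 (g x); have := ler_wpM2r c0 (ler_norm M).
  move: h2 h1 c0; rewrite mulrDr mulr1 (mulrC _ `|M|); clear.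
  by move: `|M| => s; lra.
have h : f x / g x @[x --> F] --> a / b by exact: (cvgM fa (cvgV b0 gb)).
have g0 : \forall x \near F, g x != 0.
  move/cvgrPdist_lt: (gb) => gb1; have := gb1 `|b|; rewrite normr_gt0 => /(_ b0) gb'.
  near=> x; apply/eqP => gx0.
  have : `|b - g x| < `|b| by near: x.
  by rewrite gx0 subr0 ltxx.
move=> A nA; apply: filterS2 g0 (h _ nA) => x gx /=.
by rewrite /pt (negbTE gx).
Unshelve. all: by end_near. Qed.

Lemma sphere_hausdorff : hausdorff_space (sphere R).
Proof.
have NS (z : C) : ~ cluster (nbhs (None : sphere R)) (Some z : sphere R).
  have [K [cK clK nK]] := compact_nbhs z.
  move=> /(_ (Some @` (~` K) `|` [set None]) (Some @` K)).
  case=> [||y [hy [w Kw wy]]].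
  - by exists K.
  - exact: one_point_compactification_some_nbhs.
  - case: hy => [[v nKv vy]|yN]; last by rewrite -wy in yN.
    by apply: nKv; move: vy; rewrite -wy => -[->].
move=> [z|] [w|] // h.
- congr Some; apply: (@norm_hausdorff _ (C : pseudoMetricNormedZmodType C)).
  move=> A B zA wB.
  have [||y] := h (Some @` A) (Some @` B).
  + exact: one_point_compactification_some_nbhs.
  + exact: one_point_compactification_some_nbhs.
  + by move=> [[a Aa <-] [b Bb [ba]]]; exists a; split => //; rewrite -ba.
- by case: (NS z) => A B nA nB; have [y []] := h B A nB nA; exists y.
- by case: (NS w).
Qed.

End Modulus.

(** * Summable increments and expansions in 1 / n *)

Section SequenceEstimates.
Local Open Scope classical_set_scope.
Variable R : realType.
Local Notation C := R[i].

Lemma nat_large (M : R) : exists N : nat, forall n, (N < n)%N -> M <= n%:R.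
Proof.
exists (Num.bound M) => n hn; apply: le_trans (ler_norm M) _.
apply: le_trans (ltW (archi_boundP (normr_ge0 M))) _.
rewrite /Num.bound normr_id in hn *; by rewrite ler_nat ltnW.
Qed.

Lemma cvg_invn (M : R) : M / n%:R @[n --> \oo] --> (0 : R).
Proof.
rewrite -(mulr0 M); apply: cvgMr; apply/cvgrPdist_lt => e e0.
have [N hN] := nat_large (e^-1 + 1).
exists N.+1 => // n /= Nn; rewrite sub0r normrN ger0_norm ?invr_ge0 //.
have n0 : (0 : R) < n%:R by rewrite ltr0n (leq_ltn_trans _ Nn).
rewrite -[ltRHS]invrK ltf_pV2 ?posrE ?invr_gt0 //.
by apply: lt_le_trans (hN n Nn); rewrite ltrDl.
Qed.

(** As 1 / n^2 <= 2 / n - 2 / (n + 1), the sequence g n - 2 K / n is eventually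
    nondecreasing, and g n + 2 K / n is eventually nonincreasing. *)
Lemma real_sum_invsqr_cvg (g : nat -> R) K N :
  (forall n, (N < n)%N -> `|g n.+1 - g n| <= K / n%:R ^+ 2) ->
  cvgn g.
Proof.
move=> hg.
have K0 : 0 <= K.
  have := le_trans (normr_ge0 _) (hg N.+1 (ltnSn N)).
  by rewrite pmulr_lge0 // invr_gt0 exprn_gt0.
pose m n : R := (n + N.+1)%:R.
have m0 n : 1 <= m n by rewrite /m ler1n addnS.
have mS n : m n.+1 = m n + 1 by rewrite /m addSn -natr1.
have key n : `|g (n + N.+1).+1 - g (n + N.+1)%N| <= 2 * K / m n - 2 * K / m n.+1.
  apply: le_trans (hg _ _) _; first by rewrite addnS ltnS leq_addl.
  rewrite -/(m n) mS; move: (m0 n); move: (m n) => t t1.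
  have -> : 2 * K / t - 2 * K / (t + 1) = K / t ^+ 2 * (2 * t / (t + 1)).
    by field; apply/andP; split; apply/eqP; lra.
  rewrite ler_peMr ?divr_ge0 ?sqr_ge0 // ler_pdivlMr; lra.
pose a n := g (n + N.+1)%N - 2 * K / m n.
have [l ha] : exists l : R, a n @[n --> \oo] --> l.
  exists (limn a); apply: nondecreasing_is_cvgn.
    apply/nondecreasing_seqP => n; rewrite /a addSn.
    have := key n; rewrite ler_norml => /andP[]; lra.
  exists (g N.+1 + 2 * K / m 0%N) => _ [n _ <-].
  suff : g (n + N.+1)%N + 2 * K / m n <= g N.+1 + 2 * K / m 0%N.
    have : 0 <= 2 * K / m n by rewrite divr_ge0 ?mulr_ge0 //; have := m0 n; lra.
    rewrite /a; lra.
  elim: n => [|n IH]; first by rewrite add0n.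
  apply: le_trans IH; rewrite addSn.
  have := key n; rewrite ler_norml => /andP[]; lra.
have : (fun n => g (n + N.+1)%N) @ \oo --> l.
  have -> : (fun n => g (n + N.+1)%N) = (fun n => a n + 2 * K / m n).
    by apply/funext => n; rewrite /a subrK.
  rewrite -[l]addr0; apply: cvgD => //.
  have := cvg_invn (2 * K); rewrite -(cvg_shiftn N.+1); exact.
rewrite (cvg_shiftn N.+1) => h; apply/cvg_ex; by exists l.
Qed.

Lemma sum_invsqr_cvg (g : nat -> C) K N :
  (forall n, (N < n)%N -> cabs (g n.+1 - g n) <= K / n%:R ^+ 2) ->
  exists l : C, g n @[n --> \oo] --> l.
Proof.
move=> hg.
have /cvg_ex [a ha] : cvgn (fun n => complex.Re (g n)).
  apply: (@real_sum_invsqr_cvg _ K N) => n /hg; apply: le_trans.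
  by rewrite -ReCN -ReCD normRe_le.
have /cvg_ex [b hb] : cvgn (fun n => complex.Im (g n)).
  apply: (@real_sum_invsqr_cvg _ K N) => n /hg; apply: le_trans.
  by rewrite -ImCN -ImCD normIm_le.
exists (Complex a b).
have -> : g = fun n => Complex (complex.Re (g n)) (complex.Im (g n)).
  by apply/funext => n; case: (g n).
exact: cvg_Complex.
Qed.

(** First order expansions in 1 / n; the remainder is O(1 / n^2) so that it can
    be summed. *)
Definition asym (f : nat -> C) (a b : C) := exists K : R, exists N : nat,
  forall n, (N < n)%N -> cabs (f n - a - b / n%:R) <= K / n%:R ^+ 2.

Lemma asymP (f : nat -> C) a b : asym f a b -> exists2 K : R, 0 <= K &
  exists N : nat, forall n, (N < n)%N ->
    cabs (f n - a - b / n%:R) <= K / n%:R ^+ 2.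
Proof.
move=> [K [N h]]; exists `|K| => //; exists N => n /h /le_trans; apply.
by rewrite ler_wpM2r ?ler_norm // invr_ge0 sqr_ge0.
Qed.

Lemma asym_ext f g a b : f =1 g -> asym f a b -> asym g a b.
Proof. by move=> /funext ->. Qed.

Lemma asym_eq_near f g a b : (exists N : nat, forall n, (N < n)%N -> f n = g n) ->
  asym f a b -> asym g a b.
Proof.
move=> [M fg] [K [N h]]; exists K, (maxn M N) => n; rewrite gtn_max => /andP[? ?].
by rewrite -fg // h.
Qed.

Lemma asym_cst a : asym (fun=> a) a 0.
Proof.
by exists 0, 0%N => n _; rewrite mul0r subrr subr0 cabs0 mul0r.
Qed.

Lemma asym_inv : asym (fun n => n%:R^-1) 0 1.
Proof.
by exists 0, 0%N => n _; rewrite mul1r subr0 subrr cabs0 mul0r.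
Qed.

Lemma asymD f g a b a' b' : asym f a b -> asym g a' b' ->
  asym (fun n => f n + g n) (a + a') (b + b').
Proof.
move=> [K [N h]] [K' [N' h']]; exists (K + K'), (maxn N N') => n.
rewrite gtn_max => /andP[/h {}h /h' {}h'].
rewrite [leRHS]mulrDl; apply: (le_trans _ (lerD h h')).
have -> : f n + g n - (a + a') - (b + b') / n%:R =
  (f n - a - b / n%:R) + (g n - a' - b' / n%:R) by ring.
exact: cabsD.
Qed.

Lemma asymM f g a b a' b' : asym f a b -> asym g a' b' ->
  asym (fun n => f n * g n) (a * a') (a * b' + b * a').
Proof.
move=> /asymP [K K0 [N h]] /asymP [K' K0' [N' h']].
exists (K * (cabs a' + cabs b' + K') + (cabs a + cabs b) * K' + cabs b * cabs b'),
  (maxn N N') => n.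
rewrite gtn_max => /andP[Nn /h' {}h']; move/h: (Nn) => {}h.
set t : R := n%:R^-1.
have n1 : (1 : R) <= n%:R by rewrite ler1n (leq_ltn_trans _ Nn).
have t1 : t <= 1 by rewrite invf_le1 // (lt_le_trans ltr01).
have t0 : 0 <= t by rewrite invr_ge0 (le_trans ler01).
have tt : t ^+ 2 <= 1 by rewrite expr_le1.
have tE : cabs (n%:R^-1 : C) = t by rewrite cabsV cabs_nat.
rewrite -exprVn -/t in h h' *.
set r := f n - a - b / n%:R in h; set r' := g n - a' - b' / n%:R in h'.
have -> : f n * g n - a * a' - (a * b' + b * a') / n%:R =
  r * (a' + b' / n%:R + r') + (a + b / n%:R) * r' + b * b' / n%:R ^+ 2.
  rewrite /r /r' -exprVn; ring.
have e1 : cabs (a' + b' / n%:R + r') <= cabs a' + cabs b' + K'.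
  apply: le_trans (cabsD _ _) (lerD (le_trans (cabsD _ _) (lerD _ _)) _) => //.
    by rewrite cabsM tE ler_piMr ?cabs_ge0.
  by apply: le_trans h' _; rewrite ler_piMr.
have e2 : cabs (a + b / n%:R) <= cabs a + cabs b.
  apply: le_trans (cabsD _ _) (lerD _ _) => //.
  by rewrite cabsM tE ler_piMr ?cabs_ge0.
have e3 : cabs (r * (a' + b' / n%:R + r')) <=
    K * t ^+ 2 * (cabs a' + cabs b' + K').
  by rewrite cabsM ler_pM ?cabs_ge0.
have e4 : cabs ((a + b / n%:R) * r') <= (cabs a + cabs b) * (K' * t ^+ 2).
  by rewrite cabsM ler_pM ?cabs_ge0.
have e5 : cabs (b * b' / n%:R ^+ 2) = cabs b * cabs b' * t ^+ 2.
  by rewrite !cabsM cabsV cabsX cabs_nat exprVn.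
apply: le_trans (cabsD _ _) _; rewrite e5.
apply: le_trans (lerD (cabsD _ _) (lexx _)) _.
apply: le_trans (lerD (lerD e3 e4) (lexx _)) _.
by rewrite le_eqVlt; apply/orP; left; apply/eqP; ring.
Qed.

Lemma asymZ k f a b : asym f a b -> asym (fun n => k * f n) (k * a) (k * b).
Proof.
move=> /(asymM (asym_cst k)); by rewrite mul0r addr0.
Qed.

Lemma asym_bound f b : asym f 1 b -> exists N : nat, forall n, (N < n)%N ->
  2^-1 <= cabs (f n).
Proof.
move=> /asymP [K K0 [N h]]; have [M hM] := nat_large (2 * (cabs b + K)).
exists (maxn N M) => n; rewrite gtn_max => /andP[Nn /hM {}hM].
have {}h := h n Nn.
have n1 : (1 : R) <= n%:R by rewrite ler1n (leq_ltn_trans _ Nn).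
have n0 : (0 : R) < n%:R by apply: lt_le_trans n1.
have : cabs (1 : C) <= cabs (f n) + (cabs (b / n%:R) + cabs (f n - 1 - b / n%:R)).
  have {1}-> : 1 = f n - (b / n%:R + (f n - 1 - b / n%:R)) by ring.
  by apply: le_trans (cabsB _ _) _; rewrite lerD2l cabsD.
rewrite cabs1 cabsM cabsV cabs_nat => h1.
have h2 : K / n%:R ^+ 2 <= K / n%:R.
  by rewrite ler_wpM2l // lef_pV2 ?posrE ?exprn_gt0 // ler_eXnr.
have : (cabs b + K) / n%:R <= 2^-1.
  by rewrite ler_pdivrMr // ler_pdivlMl.
rewrite mulrDl; lra.
Qed.

Lemma asymV f a b : asym f a b -> a = 1 -> asym (fun n => (f n)^-1) 1 (- b).
Proof.
move=> fb a1; rewrite a1 in fb; have [N hN] := asym_bound fb.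
have : asym (fun n => f n * (1 + (- b) * n%:R^-1)) 1 0.
  have := asymM fb (asymD (asym_cst 1) (asymZ (- b) asym_inv)).
  by rewrite !mulr0 !addr0 !add0r !mulr1 mul1r addNr.
move=> /asymP [K K0 [M h]]; exists (2 * K), (maxn M N) => n.
rewrite gtn_max => /andP[/h {}h /hN {}hN].
have f0 : f n != 0.
  by rewrite -cabs_gt0; apply: lt_le_trans hN; rewrite invr_gt0.
have -> : (f n)^-1 - 1 - - b / n%:R =
    - (f n)^-1 * (f n * (1 + - b * n%:R^-1) - 1 - 0 / n%:R).
  by move: (n%:R^-1) => t; field.
rewrite cabsM cabsN cabsV -[leRHS]mulrA; apply: ler_pM; rewrite ?cabs_ge0 ?invr_ge0 ?cabs_ge0 //.
by rewrite -[leRHS]invrK lef_pV2 // posrE ?invr_gt0 // cabs_gt0.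
Qed.

Lemma asym_of f a b a' b' : asym f a b -> a = a' -> b = b' -> asym f a' b'.
Proof. by move=> h <- <-. Qed.

End SequenceEstimates.

(** * Gauss's limit for the reciprocal Gamma function *)

Section GammaFunction.
Local Open Scope classical_set_scope.
Local Open Scope complex_scope.
Variable R : realType.
Local Notation C := R[i].

Lemma mean_value0 (f df : R -> R) (b : R) :
  (forall x : R, is_derive x (1 : R) f (df x)) ->
  exists2 c, `|c| <= `|b| & f b - f 0 = df c * b.
Proof.
move=> hf.
have cf x y : {within `[x, y], continuous f}.
  apply: derivable_within_continuous => t _; by case: (hf t).
case: (lerP 0 b) => b0.
  have [c cI e] := @MVT_segment R f df 0 b b0 (fun x _ => hf x) (cf 0 b).
  exists c; last by rewrite e subr0.
  by move: cI; rewrite in_itv /= => /andP[c0 cb]; rewrite !ger0_norm.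
have [c cI e] := @MVT_segment R f df b 0 (ltW b0) (fun x _ => hf x) (cf b 0).
exists c; last by rewrite -opprB e sub0r mulrN opprK.
by move: cI; rewrite in_itv /= => /andP[c0 cb]; rewrite !ler0_norm ?lerN2 // ltW.
Qed.

Lemma norm_sin_le (b : R) : `|sin b| <= `|b|.
Proof.
have [c _] := mean_value0 b (@is_derive_sin R).
by rewrite sin0 subr0 => ->; rewrite normrM ler_piMl // cos_max.
Qed.

Lemma norm_cosB1_le (b : R) : `|cos b - 1| <= b ^+ 2.
Proof.
have [c cb] := mean_value0 b (@is_derive_cos R).
rewrite cos0 => ->; rewrite normrM normrN -real_normK ?num_real // expr2.
by rewrite ler_wpM2r // (le_trans (norm_sin_le c)).
Qed.

Lemma norm_sinB_le (b : R) : `|b| <= 1 -> `|sin b - b| <= b ^+ 2.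
Proof.
move=> b1; have h (x : R) : is_derive x (1 : R) (fun t : R => sin t - t) (cos x - 1).
  by apply: is_deriveB.
have [c cb] := mean_value0 b h.
rewrite sin0 !subr0 => ->; rewrite normrM -(@real_normK _ b) ?num_real // expr2.
rewrite ler_wpM2r //; apply: le_trans (norm_cosB1_le c) _.
rewrite -real_normK ?num_real // expr2; apply: le_trans (ler_wpM2l _ cb) _ => //.
by apply: le_trans (ler_wpM2r _ cb) _ => //; rewrite ler_piMr.
Qed.

Lemma expR_le_inv (a : R) : a < 1 -> expR a <= (1 - a)^-1.
Proof.
move=> a1; rewrite -[expR a]invrK lef_pV2 ?posrE ?invr_gt0 ?expR_gt0 ?subr_gt0 //.
by rewrite -expRN expR_ge1Dx.
Qed.

Lemma expR_near1 (a : R) : `|a| <= 2^-1 ->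
  [/\ expR a <= 2, `|expR a - 1 - a| <= 2 * a ^+ 2 & `|expR a - 1| <= 2 * `|a|].
Proof.
move=> ha; have := ha; rewrite ler_norml => /andP[a1 a2].
have b1 : 2^-1 <= 1 - a by lra.
have lo := expR_ge1Dx a.
have up : expR a <= 1 + a + 2 * a ^+ 2.
  apply: le_trans (expR_le_inv _) _; first lra.
  rewrite -[leLHS]mul1r ler_pdivrMr; last lra.
  have : 0 <= a ^+ 2 by exact: sqr_ge0.
  have -> : (1 + a + 2 * a ^+ 2) * (1 - a) = 1 + a ^+ 2 * (2 * (1 - a) - 1) by ring.
  by move=> a0; rewrite lerDl mulr_ge0 //; lra.
have aa : a ^+ 2 <= 2^-1 * `|a|.
  by rewrite -real_normK ?num_real // expr2 ler_wpM2r.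
split.
- by apply: le_trans (expR_le_inv _) _; [lra|rewrite -[leRHS]invrK lef_pV2 ?posrE; lra].
- by rewrite ger0_norm; lra.
- rewrite ler_norml; apply/andP; split.
    have := ler_norm (- a); rewrite normrN; have := normr_ge0 a; lra.
  have := ler_norm a; lra.
Qed.

Lemma cexpD (z w : C) : cexp (z + w) = cexp z * cexp w.
Proof.
case: z w => [a b] [c d]; rewrite /cexp /= expRD cosD sinD; simpc.
by apply/eqP; rewrite eq_complex /=; apply/andP; split; apply/eqP; ring.
Qed.

Lemma cexp0 : cexp (0 : C) = 1.
Proof. by rewrite /cexp /= expR0 cos0 sin0 mul1r. Qed.

Lemma cexp_neq0 (z : C) : cexp z != 0.
Proof.
apply/eqP => e; have := cexpD z (- z); rewrite subrr cexp0 e mul0r => /eqP.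
by rewrite oner_eq0.
Qed.

Lemma cexp_near1 (q : C) : cabs q <= 2^-1 ->
  cabs (cexp q - 1 - q) <= 5 * cabs q ^+ 2.
Proof.
move=> hq; have := le_trans (normRe_le q) hq; have := le_trans (normIm_le q) hq.
have -> : cabs q ^+ 2 = complex.Re q ^+ 2 + complex.Im q ^+ 2.
  by rewrite cabsE sqr_sqrtr // addr_ge0 ?sqr_ge0.
case: q {hq} => a b /= hb ha.
have [e2 e1 e0] := expR_near1 ha.
have c1 := norm_cosB1_le b.
have s1 : `|sin b - b| <= b ^+ 2 by apply: norm_sinB_le; lra.
have E0 := expR_gt0 a.
have -> : cexp (a +i* b) - 1 - (a +i* b) =
   (expR a * (cos b - 1) + (expR a - 1 - a)) +i*
   (expR a * (sin b - b) + (expR a - 1) * b).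
  rewrite /cexp /=; simpc.
  by apply/eqP; rewrite eq_complex /=; apply/andP; split; apply/eqP; ring.
apply: le_trans (cabs_le _) _ => /=.
have h1 : `|expR a * (cos b - 1)| <= 2 * b ^+ 2.
  by rewrite normrM ler_pM // ger0_norm // ltW.
have h2 : `|expR a * (sin b - b)| <= 2 * b ^+ 2.
  by rewrite normrM ler_pM // ger0_norm // ltW.
have h3 : `|(expR a - 1) * b| <= 2 * `|a| * `|b| by rewrite normrM ler_wpM2r.
have h4 : 2 * `|a| * `|b| <= a ^+ 2 + b ^+ 2.
  rewrite -(real_normK (num_real a)) -(real_normK (num_real b)).
  have := sqr_ge0 (`|a| - `|b|); rewrite sqrrB; lra.
have := ler_normD (expR a * (cos b - 1)) (expR a - 1 - a).
have := ler_normD (expR a * (sin b - b)) ((expR a - 1) * b).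
have := sqr_ge0 a; lra.
Qed.

(** The factor expR (2 K / n) shrinks by more than a step of g can gain, which
    bounds g; its increments are then summable. *)
Lemma infinite_product_cvg (g e : nat -> C) (K : R) N :
  (forall n, (N < n)%N -> g n.+1 = (1 + e n) * g n) ->
  (forall n, (N < n)%N -> cabs (e n) <= K / n%:R ^+ 2) ->
  exists l : C, g n @[n --> \oo] --> l.
Proof.
move=> hg he.
have K0 : 0 <= K.
  have := le_trans (cabs_ge0 _) (he N.+1 (ltnSn N)).
  by rewrite pmulr_lge0 // invr_gt0 exprn_gt0.
pose B := expR (2 * K / N.+1%:R) * cabs (g N.+1).
have bnd n : (N < n)%N -> expR (2 * K / n%:R) * cabs (g n) <= B.
  elim: n => // n IH; rewrite ltnS leq_eqVlt => /predU1P[<- //|Nn].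
  apply: le_trans (IH Nn); rewrite hg // cabsM mulrA ler_wpM2r ?cabs_ge0 //.
  have n1 : (1 : R) <= n%:R by rewrite ler1n (leq_ltn_trans _ Nn).
  have : cabs (1 + e n) <= expR (K / n%:R ^+ 2).
    apply: le_trans (expR_ge1Dx _); apply: le_trans (cabsD _ _) _.
    by rewrite cabs1 lerD2l he.
  move=> /(ler_wpM2l (ltW (expR_gt0 (2 * K / n.+1%:R)))) /le_trans; apply.
  rewrite -expRD ler_expR -(natr1 n); move: n1; move: (n%:R : R) => t t1.
  rewrite -subr_ge0.
  have -> : 2 * K / t - (2 * K / (t + 1) + K / t ^+ 2) =
      K * ((t - 1) / (t ^+ 2 * (t + 1))).
    by field; apply/andP; split; apply/eqP; lra.
  by rewrite mulr_ge0 // divr_ge0 ?mulr_ge0 ?sqr_ge0; lra.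
apply: (@sum_invsqr_cvg _ g (K * B) N) => n Nn.
rewrite hg // mulrDl mul1r addrAC subrr add0r cabsM mulrAC ler_pM ?cabs_ge0 ?he //.
apply: le_trans (bnd n Nn); rewrite ler_peMl ?cabs_ge0 //.
by rewrite -[leLHS]expR0 ler_expR divr_ge0 // mulr_ge0.
Qed.

(** The inverses form a product of the same kind, hence converge as well. *)
Lemma infinite_product_neq0 (g e : nat -> C) (K : R) N (l : C) :
  (forall n, (N < n)%N -> g n.+1 = (1 + e n) * g n) ->
  (forall n, (N < n)%N -> cabs (e n) <= K / n%:R ^+ 2) ->
  (forall n, (N < n)%N -> g n != 0) ->
  g n @[n --> \oo] --> l -> l != 0.
Proof.
move=> hg he g0 gl.
have [M hM] := nat_large (2 * K).
pose e' n := (1 + e n)^-1 - 1.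
have [||l' hl'] := @infinite_product_cvg (fun n => (g n)^-1) e' (2 * K) (maxn N M).
- move=> n; rewrite gtn_max => /andP[Nn _].
  by rewrite hg // invfM /e' addrCA subrr addr0.
- move=> n; rewrite gtn_max => /andP[Nn /hM Mn].
  have n1 : (1 : R) <= n%:R by rewrite ler1n (leq_ltn_trans _ Nn).
  have hn := he n Nn.
  have f0 : 1 + e n != 0.
    by have := g0 n.+1 (ltnW Nn); rewrite hg // mulf_eq0 negb_or => /andP[].
  have small : cabs (e n) <= 2^-1.
    apply: le_trans hn _; rewrite ler_pdivrMr ?exprn_gt0 ?(lt_le_trans ltr01) //.
    rewrite ler_pdivlMl //; apply: le_trans Mn _; exact: ler_eXnr.
  have big : 2^-1 <= cabs (1 + e n).
    have := cabs_subge 1 (e n); rewrite cabs1; lra.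
  have -> : e' n = - (e n / (1 + e n)) by rewrite /e'; field.
  rewrite cabsN cabsM cabsV ler_pdivrMr ?cabs_gt0 //.
  have k0 := le_trans (cabs_ge0 _) hn; apply: le_trans hn _.
  have -> : 2 * K / n%:R ^+ 2 * cabs (1 + e n) =
    K / n%:R ^+ 2 * (2 * cabs (1 + e n)) by ring.
  rewrite ler_peMr //; lra.
apply/eqP => l0; rewrite l0 in gl.
have : (g n * (g n)^-1) @[n --> \oo] --> (0 * l' : C) by exact: (cvgM gl hl').
rewrite mul0r => h0.
have h1 : (g n * (g n)^-1) @[n --> \oo] --> (1 : C).
  apply: (cvg_cabs_le (g := fun=> 0)); last exact: cvg_cst.
  by exists N.+1 => // n /= Nn; rewrite divff ?g0 // subrr cabs0.
have e01 : (0 : C) = 1.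
  exact: (@cvg_unique _ (@norm_hausdorff _ (C : pseudoMetricNormedZmodType C)) _ _ _ _ h0 h1).
by move/esym/eqP: e01; rewrite oner_eq0.
Qed.

Lemma lnS_bounds n : (0 < n)%N ->
  n.+1%:R^-1 <= ln (n.+1%:R : R) - ln n%:R <= n%:R^-1.
Proof.
move=> n0; have n1 : (0 : R) < n%:R by rewrite ltr0n.
have m1 : (0 : R) < n.+1%:R by rewrite ltr0n.
rewrite -ln_div ?posrE //; apply/andP; split.
  rewrite -[leRHS]opprK -lnV ?posrE ?divr_gt0 // invf_div lerNr.
  have -> : (n%:R / n.+1%:R : R) = 1 + - n.+1%:R^-1.
    by rewrite -natr1; field; rewrite natr1 gt_eqF.
  by apply: le_ln1Dx; rewrite ltrN2 invf_lt1 // ltr1n.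
have -> : (n.+1%:R / n%:R : R) = 1 + n%:R^-1 by rewrite -natr1; field; rewrite gt_eqF.
by apply: le_ln1Dx; apply: lt_trans (ltrN10 _) _; rewrite invr_gt0.
Qed.

Lemma asym_invS : asym (fun n => (n.+1%:R : C)^-1) 0 1.
Proof.
have := asymM (asym_inv R) (asymV (asymD (asym_cst 1) (asym_inv R)) (addr0 1)).
rewrite !mul0r !mul1r add0r; apply: asym_eq_near; exists 0%N => n n0.
have h1 : (n%:R : C) != 0 by rewrite pnatr_eq0 -lt0n.
have h2 : (n%:R + 1 : C) != 0 by rewrite natr1 pnatr_eq0.
by rewrite -natr1; field; rewrite ?h1 ?h2.
Qed.

Lemma asym_lnS : asym (fun n => ((ln n%:R - ln n.+1%:R : R)%:C : C)) 0 (-1).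
Proof.
exists 1, 0%N => n n0; have /andP[lo up] := lnS_bounds n0.
have n1 : (0 : R) < n%:R by rewrite ltr0n.
rewrite subr0 mulN1r opprK natC invC -rmorphD cabs_real mul1r ger0_norm; last lra.
apply: (@le_trans _ _ (n%:R^-1 - n.+1%:R^-1)).
  by rewrite addrC lerD2l lerNr opprB.
rewrite -natr1.
have -> : (n%:R^-1 - (n%:R + 1)^-1 : R) = (n%:R * (n%:R + 1))^-1.
  have h1 : (n%:R : R) != 0 by rewrite gt_eqF.
  have h2 : (n%:R + 1 : R) != 0 by rewrite natr1 pnatr_eq0.
  by field; rewrite ?h1 ?h2.
by rewrite lef_pV2 ?posrE ?mulr_gt0 ?exprn_gt0 // ?natr1 // expr2 ler_pM2l // ler_nat.
Qed.

Lemma asym_cexp (f : nat -> C) b : asym f 0 b ->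
  asym (fun n => cexp (f n)) 1 b.
Proof.
move=> fb; have /asymP [K K0 [N h]] := fb.
have [M hM] := nat_large (2 * (cabs b + K)).
exists (5 * (cabs b + K) ^+ 2 + K), (maxn N M) => n.
rewrite gtn_max => /andP[Nn /hM {}hM]; have {h}hn := h n Nn.
have n1 : (1 : R) <= n%:R by rewrite ler1n (leq_ltn_trans _ Nn).
have n0 : (0 : R) < n%:R by apply: lt_le_trans n1.
have fn : cabs (f n) <= (cabs b + K) / n%:R.
  have {1}-> : f n = b / n%:R + (f n - 0 - b / n%:R) by ring.
  apply: le_trans (cabsD _ _) _; rewrite mulrDl; apply: lerD.
    by rewrite cabsM cabsV cabs_nat.
  apply: le_trans hn _; rewrite ler_wpM2l // lef_pV2 ?posrE ?exprn_gt0 //.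
  by rewrite ler_eXnr.
have f2 : cabs (f n) <= 2^-1.
  by apply: le_trans fn _; rewrite ler_pdivrMr // ler_pdivlMl.
have -> : cexp (f n) - 1 - b / n%:R =
   (cexp (f n) - 1 - f n) + (f n - 0 - b / n%:R) by ring.
apply: le_trans (cabsD _ _) _; rewrite mulrDl; apply: lerD => //.
apply: le_trans (cexp_near1 f2) _; rewrite -mulrA ler_wpM2l // -expr_div_n.
by rewrite ler_pXn2r ?nnegrE ?cabs_ge0 // divr_ge0 ?addr_ge0 ?cabs_ge0.
Qed.

Definition rGamma_seq (z : C) (n : nat) : C :=
  (\prod_(k < n.+1) (z + k%:R)) / (n`!%:R * cexp (z * (ln n%:R)%:C)).

Lemma rGamma_seqS z n : rGamma_seq z n.+1 =
  (1 + ((1 + z * n.+1%:R^-1) * cexp (z * (ln n%:R - ln n.+1%:R : R)%:C) - 1)) *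
  rGamma_seq z n.
Proof.
rewrite addrC subrK /rGamma_seq big_ord_recr /= factS natrM.
have -> : z * (ln n%:R - ln n.+1%:R : R)%:C =
  z * (ln n%:R)%:C - z * (ln n.+1%:R)%:C by rewrite rmorphB mulrBr.
have -> : cexp (z * (ln n%:R)%:C - z * (ln n.+1%:R)%:C) =
    cexp (z * (ln n%:R)%:C) / cexp (z * (ln n.+1%:R)%:C).
  apply: (mulIf (cexp_neq0 (z * (ln n.+1%:R)%:C))).
  by rewrite -cexpD subrK divfK ?cexp_neq0.
have h1 : (n`!%:R : C) != 0 by rewrite pnatr_eq0 -lt0n fact_gt0.
have h2 : (n.+1%:R : C) != 0 by rewrite pnatr_eq0.
move: h1 h2 (cexp_neq0 (z * (ln n%:R)%:C)) (cexp_neq0 (z * (ln n.+1%:R)%:C)).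
move: (n`!%:R : C) (n.+1%:R : C) (cexp _) (cexp _) => f m c d f0 m0 c0 d0.
by field; rewrite ?f0 ?m0 ?c0 ?d0.
Qed.

(** The factor 1 + z / (n + 1) and the quotient of the powers n^z cancel to first
    order. *)
Lemma rGamma_seq_factor z : exists K : R, exists N : nat, forall n, (N < n)%N ->
  cabs ((1 + z * n.+1%:R^-1) * cexp (z * (ln n%:R - ln n.+1%:R : R)%:C) - 1)
    <= K / n%:R ^+ 2.
Proof.
have h : asym (fun n => (1 + z * n.+1%:R^-1) *
    cexp (z * (ln n%:R - ln n.+1%:R : R)%:C)) 1 0.
  apply: asym_of (asymM (asymD (asym_cst 1) (asymZ z asym_invS))
    (asym_cexp (asym_of (asymZ z asym_lnS) (mulr0 z) (erefl _)))) _ _; ring.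
have [K [N hN]] := h; exists K, N => n /hN.
by rewrite mul0r subr0.
Qed.

Lemma cvg_rGamma z : rGamma_seq z n @[n --> \oo] --> rGamma z.
Proof.
have [K [N hN]] := rGamma_seq_factor z.
have [l hl] := infinite_product_cvg (fun n _ => rGamma_seqS z n) hN.
have -> : rGamma z = l by exact: (norm_cvg_lim (V := C) hl).
exact: hl.
Qed.

(** A convergent product of factors 1 + O(1 / n^2) vanishes only with one of its
    factors. *)
Lemma rGamma_eq0 (z : C) : rGamma z = 0 -> exists k : nat, z = - k%:R.
Proof.
move=> z0; have [//|nk] := pselect (exists k : nat, z = - k%:R).
have [K [N hN]] := rGamma_seq_factor z.
suff : rGamma z != 0 by rewrite z0 eqxx.
apply: (infinite_product_neq0 (fun n _ => rGamma_seqS z n) hN _ (@cvg_rGamma z)).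
move=> n _; apply: mulf_neq0.
  apply/prodf_neq0 => k _; apply/eqP => e; apply: nk; exists k.
  by apply/eqP; rewrite -addr_eq0 e.
rewrite invr_eq0; apply: mulf_neq0 (cexp_neq0 _).
by rewrite pnatr_eq0 -lt0n fact_gt0.
Qed.

End GammaFunction.

(** * The three-term recurrence and its contiguous shift *)

Section Recurrence.
Local Open Scope complex_scope.
Variable R : realType.
Local Notation C := R[i].
Variables alpha beta : C.
Implicit Types (z t : C) (f : nat -> C) (n : nat).

(** The partial numerators of both fractions are built from the values of these
    two cubic polynomials, of opposite roots, at the integers. *)
Definition upoly t : C :=
  (t + alpha / 2) * (t + beta / 2) * (t - (alpha + beta) / 2).
Definition vpoly t : C :=
  (t - alpha / 2) * (t - beta / 2) * (t + (alpha + beta) / 2).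
(** The second elementary symmetric function of the roots of [vpoly]. *)
Definition esym2 : C := (alpha * beta - (alpha + beta) ^+ 2) / 4.

Definition midcoef z n : C :=
  2 * (2 * n%:R + 1) * (z * (z + 1)) + upoly n.+1%:R + vpoly n%:R.

(** The index is moved up by one: [f 0] and [f 1] stand for the terms of index -1
    and 0. *)
Definition solves z f := forall n,
  upoly n.+1%:R * f n.+2 = midcoef z n * f n.+1 - vpoly n%:R * f n.

(** The contiguous relation from z to z + 1, that is from x = 2 z + 1 to x + 2.
    An operator of first order in n that sends solutions to solutions and acts
    diagonally on [f 1 + f 0] and [f 1 - f 0]. *)
Definition shift_up z f n : C :=
  upoly n%:R * f n.+1 +
  (z + 1 - n%:R) * (n%:R ^+ 2 + (z + 1) ^+ 2 + esym2 - n%:R * (z + 1)) * f n.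

(** The recurrence brings the terms of index n + 2 and n + 1 back to those of
    index n + 1 and n, so that consecutive values of the shift are read on the same
    pair. *)
Lemma shift_upS z f n : solves z f ->
  shift_up z f n.+1 =
  (z + 1 + n%:R) * (n%:R ^+ 2 + (z + 1) ^+ 2 + esym2 + n%:R * (z + 1)) * f n.+1 -
  vpoly n%:R * f n.
Proof.
move=> hf; rewrite /shift_up hf /midcoef /upoly /vpoly /esym2 -!natr1; by field.
Qed.

Lemma shift_up_solves z f : solves z f -> solves (z + 1) (shift_up z f).
Proof.
move=> hf n; rewrite !shift_upS // [shift_up z f n]/shift_up.
set k := (_ + n.+1%:R) * _.
have -> : upoly n.+1%:R * (k * f n.+2 - vpoly n.+1%:R * f n.+1) =
  k * (upoly n.+1%:R * f n.+2) - upoly n.+1%:R * vpoly n.+1%:R * f n.+1 by ring.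
rewrite hf /k /midcoef /upoly /vpoly /esym2 -!natr1; by field.
Qed.

Lemma shift_up_sum z f : solves z f ->
  shift_up z f 1 + shift_up z f 0 = upoly (z + 1) * (f 1%N + f 0%N).
Proof.
move=> hf; rewrite shift_upS // /shift_up /upoly /vpoly /esym2 /=; by field.
Qed.

Lemma shift_up_diff z f : solves z f ->
  shift_up z f 1 - shift_up z f 0 = vpoly (z + 1) * (f 1%N - f 0%N).
Proof.
move=> hf; rewrite shift_upS // /shift_up /upoly /vpoly /esym2 /=; by field.
Qed.

Fixpoint shift_iter z f j : nat -> C :=
  if j is j'.+1 then shift_up (z + j'%:R) (shift_iter z f j') else f.

Lemma shift_iter_solves z f j : solves z f ->
  solves (z + j%:R) (shift_iter z f j).
Proof.
move=> hf; elim: j => [|j IH]; first by rewrite addr0.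
by rewrite -natr1 addrA; exact: shift_up_solves.
Qed.

Lemma shift_iter_sum z f j : solves z f ->
  shift_iter z f j 1 + shift_iter z f j 0 =
  (\prod_(k < j) upoly (z + 1 + k%:R)) * (f 1%N + f 0%N).
Proof.
move=> hf; elim: j => [|j IH]; first by rewrite big_ord0 mul1r.
rewrite shift_up_sum; last exact: shift_iter_solves.
by rewrite IH big_ord_recr /= mulrA; congr (_ * _); rewrite mulrC addrAC.
Qed.

Lemma shift_iter_diff z f j : solves z f ->
  shift_iter z f j 1 - shift_iter z f j 0 =
  (\prod_(k < j) vpoly (z + 1 + k%:R)) * (f 1%N - f 0%N).
Proof.
move=> hf; elim: j => [|j IH]; first by rewrite big_ord0 mul1r.
rewrite shift_up_diff; last exact: shift_iter_solves.
by rewrite IH big_ord_recr /= mulrA; congr (_ * _); rewrite mulrC addrAC.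
Qed.

(** Up to the factor n + 1 / 2, the middle coefficient is a partial denominator of
    the second fraction at x = 2 z + 1. *)
Lemma midcoefE z n : midcoef z n =
  (n%:R + 2^-1) * ((2 * z + 1) ^+ 2 + lambda alpha beta n).
Proof.
by rewrite /midcoef /upoly /vpoly /lambda -natr1; field.
Qed.

Definition sqsize : R := cabs alpha ^+ 2 + cabs beta ^+ 2.

Lemma sqsize_ge0 : 0 <= sqsize.
Proof. by rewrite addr_ge0 ?sqr_ge0. Qed.

Lemma uv_bound n :
  cabs (upoly n%:R) * cabs (vpoly n%:R) <= (n%:R ^+ 2 + sqsize) ^+ 3.
Proof.
have -> : cabs (upoly n%:R) * cabs (vpoly n%:R) =
   cabs (n%:R ^+ 2 - (alpha / 2) ^+ 2) * cabs (n%:R ^+ 2 - (beta / 2) ^+ 2) *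
   cabs (n%:R ^+ 2 - ((alpha + beta) / 2) ^+ 2).
  by rewrite -!cabsM /upoly /vpoly; congr cabs; ring.
have h a : cabs a ^+ 2 <= 4 * sqsize ->
    cabs (n%:R ^+ 2 - (a / 2) ^+ 2) <= n%:R ^+ 2 + sqsize.
  move=> ha; apply: le_trans (cabsB _ _) _; rewrite !cabsX cabs_nat lerD2l.
  rewrite cabsM cabsV cabs_nat exprMn exprVn ler_pdivrMr; last by rewrite exprn_gt0.
  by apply: le_trans ha _; rewrite mulrC -natrX.
have a2 : 0 <= cabs alpha ^+ 2 by exact: sqr_ge0.
have b2 : 0 <= cabs beta ^+ 2 by exact: sqr_ge0.
rewrite [leRHS]exprS [X in _ <= _ * X]expr2 [leRHS]mulrA.
rewrite !ler_pM ?mulr_ge0 ?cabs_ge0 //; apply: h; rewrite /sqsize; try lra.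
apply: (@le_trans _ _ ((cabs alpha + cabs beta) ^+ 2)).
  by rewrite ler_pXn2r ?nnegrE ?addr_ge0 ?cabs_ge0 // cabsD.
have := sqr_ge0 (cabs alpha - cabs beta); rewrite sqrrB sqrrD; lra.
Qed.

(** A level of D from which [uv_bound_level] holds; only its size matters. *)
Definition large_level : R := sqsize ^+ 3 + 3 * sqsize ^+ 2 + 3 * sqsize + 10.

Lemma uv_bound_level n (D : R) : large_level <= D ->
  cabs (upoly n.+1%:R) * cabs (vpoly n.+1%:R) <=
  (n%:R + 2^-1) * (n%:R + 3 / 2) * (n.+1%:R ^+ 2 + D) ^+ 2.
Proof.
move=> hD; apply: le_trans (uv_bound _) _.
have -> : ((n%:R + 2^-1) * (n%:R + 3 / 2) : R) = n.+1%:R ^+ 2 - 4^-1.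
  by rewrite -natr1; field.
have s1 : 1 <= (n.+1%:R ^+ 2 : R) by rewrite -natrX ler1n expn_gt0.
move: s1 hD; rewrite /large_level; move: (n.+1%:R ^+ 2 : R) sqsize sqsize_ge0.
move=> s A A0 s1 hD.
have A2 : 0 <= A ^+ 2 by exact: sqr_ge0.
have A3 : 0 <= A ^+ 3 by exact: exprn_ge0.
rewrite -subr_ge0.
have -> : (s - 4^-1) * (s + D) ^+ 2 - (s + A) ^+ 3 =
  s * (s * (2 * D - 4^-1 - 3 * A)) +
  (s - 1) * (D ^+ 2 / 4 + A ^+ 3) + s * (3 / 4 * D ^+ 2 - D / 2 - 3 * A ^+ 2 - A ^+ 3)
  by field.
have D2 : 10 * D <= D ^+ 2 by rewrite expr2 ler_wpM2r; lra.
by rewrite !addr_ge0 // ?mulr_ge0 //; lra.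
Qed.

(** Far to the right the middle coefficient outweighs the outer ones.  Downward
    induction from a zero then bounds each term by the one below it, with a gain
    that grows with D. *)
Lemma dominated_below_zero z f (D : R) K : solves z f -> large_level <= D ->
  2 * D + cabs (alpha ^+ 2 + alpha * beta + beta ^+ 2) <=
    complex.Re ((2 * z + 1) ^+ 2) ->
  f K.+1 = 0 ->
  forall n, (n <= K)%N ->
  (n%:R + 2^-1) * (n%:R ^+ 2 + D) * cabs (f n.+1) <= cabs (vpoly n%:R) * cabs (f n).
Proof.
move=> hf hD hz fK n nK; rewrite -(subKn nK); move: (K - n)%N (leq_subr n K) => {nK} j.
have D0 : 0 < D.
  apply: lt_le_trans hD; rewrite /large_level ltr_wpDl // !addr_ge0 ?exprn_ge0 //
    ?mulr_ge0 ?sqr_ge0 ?sqsize_ge0 //.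
elim: j => [_|j IH jK].
  by rewrite subn0 fK cabs0 mulr0 mulr_ge0 ?cabs_ge0.
move/(_ (ltnW jK)): IH; rewrite subnS.
have : (0 < K - j)%N by rewrite subn_gt0.
case: (K - j)%N => // {jK}m _ /= IH; rewrite -cabsM.
have -> : vpoly m%:R * f m = midcoef z m * f m.+1 - upoly m.+1%:R * f m.+2.
  by rewrite hf; ring.
apply: le_trans (cabs_subge _ _); rewrite cabsN (cabsM (midcoef _ _)) (cabsM (upoly _)) lerBrDr.
have m0 : 0 <= (m%:R : R) by [].
have mS : (m.+1%:R : R) = m%:R + 1 by rewrite natr1.
have up : cabs (upoly m.+1%:R) * cabs (f m.+2) <=
    (m%:R + 2^-1) * (m.+1%:R ^+ 2 + D) * cabs (f m.+1).
  have p0 : 0 < (m.+1%:R + 2^-1) * (m.+1%:R ^+ 2 + D).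
    by rewrite mulr_gt0 // ?addr_gt0 // ?exprn_gt0 ?invr_gt0.
  rewrite -(ler_pM2l p0).
  have := ler_wpM2l (cabs_ge0 (upoly m.+1%:R)) IH.
  have := ler_wpM2r (cabs_ge0 (f m.+1)) (uv_bound_level m hD).
  rewrite mS.
  have -> : (m%:R + 3 / 2 : R) = m%:R + 1 + 2^-1 by field.
  move: (cabs (upoly _)) (cabs (vpoly _)) (cabs (f m.+1)) (cabs (f m.+2)).
  move: ((m%:R + 1) ^+ 2 + D) (m%:R : R) => w r u v p q; lra.
have mid : (m%:R + 2^-1) * (m%:R ^+ 2 + m.+1%:R ^+ 2 + 2 * D) <= cabs (midcoef z m).
  rewrite midcoefE cabsM.
  have -> : cabs (m%:R + 2^-1 : C) = m%:R + 2^-1.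
    by rewrite natC -[2]/(2%:R) natC invC -rmorphD cabs_real ger0_norm // addr_ge0.
  rewrite ler_wpM2l ?addr_ge0 //; apply: le_trans (Re_le _).
  have -> : lambda alpha beta m = (m%:R ^+ 2 + m.+1%:R ^+ 2 : R)%:C +
     - ((2^-1 : R)%:C * (alpha ^+ 2 + alpha * beta + beta ^+ 2)).
    rewrite /lambda rmorphD !rmorphXn !rmorph_nat /= -invC rmorph_nat -natr1; by field.
  move: (alpha ^+ 2 + alpha * beta + beta ^+ 2) ((2 * z + 1) ^+ 2) hz => w s hz.
  rewrite !ReCD ReCN ReCM /= mul0r subr0.
  have := Re_le w; have := cabs_ge0 w; lra.
have := ler_wpM2r (cabs_ge0 (f m.+1)) mid.
move: up; move: (cabs (f m.+1)) (cabs_ge0 (f m.+1)) => c c0 up.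
apply: le_trans; apply: le_trans (lerD (lexx _) up) _.
by rewrite le_eqVlt; apply/orP; left; apply/eqP; ring.
Qed.

End Recurrence.

(** * Comparison of sequences with real powers *)

Section Powers.
Local Open Scope classical_set_scope.
Variable R : realType.
Local Notation C := R[i].

(** Real powers of integers, in a form where exponents add even at n = 0. *)
Definition npow (s : R) (n : nat) : R := expR (s * ln n%:R).

Lemma npow_gt0 s n : 0 < npow s n.
Proof. exact: expR_gt0. Qed.

Lemma npow_ge0 s n : 0 <= npow s n.
Proof. exact/ltW/npow_gt0. Qed.

Lemma npowD s t n : npow (s + t) n = npow s n * npow t n.
Proof. by rewrite /npow mulrDl expRD. Qed.

Lemma npow_nat k n : (0 < n)%N -> npow k%:R n = n%:R ^+ k.
Proof. by move=> n0; rewrite /npow expRM_natl lnK // posrE ltr0n. Qed.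

Lemma npow_cvg0 s : s < 0 -> npow s n @[n --> \oo] --> (0 : R).
Proof.
move=> s0; apply/cvgrPdist_lt => e e0.
have [N hN] := nat_large (expR (ln e / s) + 1).
exists N.+1 => // n /= Nn; rewrite sub0r normrN ger0_norm ?npow_ge0 //.
rewrite /npow -[ltRHS]lnK ?posrE // ltr_expR mulrC -ltr_ndivrMr //.
rewrite -ltr_expR lnK; last by rewrite posrE ltr0n (leq_ltn_trans _ Nn).
by apply: lt_le_trans (hN n Nn); rewrite ltrDl.
Qed.

Lemma npow_ratio s n : npow s n.+1 = npow s n * expR (s * (ln n.+1%:R - ln n%:R)).
Proof. by rewrite /npow -expRD -mulrDr subrKC. Qed.

(** As ln (n + 1) - ln n <= 1 / n, the product of n^s and w n is nonincreasing. *)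
Lemma decay_npow (w : nat -> R) s N : 0 <= s -> (forall n, 0 <= w n) ->
  (forall n, (N < n)%N -> w n.+1 <= (1 - s / n%:R) * w n) ->
  exists2 K, 0 <= K & forall n, (N < n)%N -> w n <= K * npow (- s) n.
Proof.
move=> s0 w0 hw; exists (npow s N.+1 * w N.+1).
  by rewrite mulr_ge0 ?w0 // ltW ?npow_gt0.
have mono n : (N < n)%N -> npow s n * w n <= npow s N.+1 * w N.+1.
  elim: n => // n IH; rewrite ltnS leq_eqVlt => /predU1P[<- //|Nn].
  apply: le_trans (IH Nn); rewrite npow_ratio -mulrA ler_wpM2l ?npow_ge0 //.
  apply: le_trans (ler_wpM2l (ltW (expR_gt0 _)) (hw n Nn)) _.
  rewrite mulrA ler_piMl // -[leRHS](@expR0 R).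
  apply: le_trans (ler_wpM2l (ltW (expR_gt0 _)) (expR_ge1Dx (- (s / n%:R)))) _.
  rewrite -expRD ler_expR subr_le0 ler_wpM2l //.
  by have /andP[] := @lnS_bounds R n (leq_ltn_trans (leq0n N) Nn).
move=> n Nn; rewrite -(ler_pM2l (npow_gt0 s n)) mulrCA -npowD addrN.
by rewrite /npow mul0r expR0 mulr1 mono.
Qed.

(** The margin between s and s' absorbs the second order terms when (1 + 1 / n)^s
    is compared with 1 + s' / n. *)
Lemma growth_npow s s' : s < s' -> exists N1 : nat, forall N (w : nat -> R),
  (N1 <= N)%N -> 0 < w N.+1 ->
  (forall n, (N < n)%N -> (1 + s' / n%:R) * w n <= w n.+1) ->
  exists2 K, 0 < K & forall n, (N < n)%N -> K * npow s n <= w n.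
Proof.
move=> ss'.
have [N1 hN1] := nat_large ((`|s| + 2 * s ^+ 2) / (s' - s) + 2 * `|s| + 1).
have step n : (N1 < n)%N ->
    expR (s * (ln n.+1%:R - ln n%:R)) <= 1 + s' / n%:R.
  move=> /[dup] /(leq_ltn_trans (leq0n _)) n0 /hN1 big.
  have nR : (0 : R) < n%:R by rewrite ltr0n.
  have /andP[lo up] := @lnS_bounds R n n0.
  have d : (n%:R^-1 - n.+1%:R^-1 : R) <= n%:R ^- 2.
    have h1 : (n%:R : R) != 0 by rewrite gt_eqF.
    have h2 : (n%:R + 1 : R) != 0 by rewrite natr1 pnatr_eq0.
    rewrite -(natr1 n).
    have -> : (n%:R^-1 - (n%:R + 1)^-1 : R) = (n%:R * (n%:R + 1))^-1.
      by field; rewrite ?h1 ?h2.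
    rewrite lef_pV2 ?posrE ?mulr_gt0 ?exprn_gt0 ?addr_gt0 // expr2 ler_pM2l //.
    by rewrite lerDl.
  have i0 : (0 : R) <= n.+1%:R^-1 by rewrite invr_ge0.
  move: lo up d i0; move: (n.+1%:R^-1 : R) (ln n.+1%:R - ln n%:R : R) => j L.
  set t : R := n%:R^-1.
  rewrite -exprVn -/t => lo up d i0.
  have t0 : 0 < t by rewrite invr_gt0.
  have tn : t * n%:R = 1 by rewrite mulVf // gt_eqF.
  have B0 : 0 <= (`|s| + 2 * s ^+ 2) / (s' - s).
    by rewrite divr_ge0 ?subr_ge0 ?(ltW ss') // addr_ge0 // mulr_ge0 // sqr_ge0.
  have tbig : t * ((`|s| + 2 * s ^+ 2) / (s' - s) + 2 * `|s| + 1) <= 1.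
    by rewrite -[leRHS]tn ler_pM2l.
  have s0 := normr_ge0 s.
  have L0 : 0 <= L by apply: le_trans lo.
  have q1 : `|s * L| <= `|s| * t by rewrite normrM ler_wpM2l // ger0_norm.
  have half : `|s| * t <= 2^-1.
    have := mulr_ge0 (ltW t0) B0; have : 0 <= t * 1 by rewrite mulr1 ltW.
    move: tbig; rewrite !mulrDr mulrCA; lra.
  have [_ e1 _] := expR_near1 (le_trans q1 half).
  have q2 : s * L <= s * t + `|s| * t ^+ 2.
    rewrite -lerBlDl -mulrBr; apply: le_trans (ler_norm _) _.
    rewrite normrM ler_wpM2l // distrC ger0_norm ?subr_ge0 //; lra.
  have q3 : (s * L) ^+ 2 <= s ^+ 2 * t ^+ 2.
    rewrite -real_normK ?num_real // -[s ^+ 2]real_normK ?num_real // -exprMn.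
    by rewrite ler_pXn2r ?nnegrE // mulr_ge0 // ltW.
  have fin : (`|s| + 2 * s ^+ 2) * t ^+ 2 <= (s' - s) * t.
    rewrite [t ^+ 2]expr2 mulrA ler_wpM2r ?(ltW t0) // mulrC -[leRHS]mul1r.
    rewrite -ler_pdivrMr ?subr_gt0 // -mulrA; apply: le_trans tbig.
    by rewrite ler_wpM2l ?(ltW t0) // -addrA lerDl addr_ge0 // mulr_ge0.
  have := ler_norm (expR (s * L) - 1 - s * L); lra.
exists N1 => N w NN w0 hw; exists (w N.+1 / npow s N.+1).
  by rewrite divr_gt0 ?npow_gt0.
elim=> // n IH; rewrite ltnS leq_eqVlt => /predU1P[<- |Nn].
  by rewrite divfK // gt_eqF ?npow_gt0.
apply: le_trans (hw n Nn); rewrite (npow_ratio s n) mulrA mulrC.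
apply: ler_pM (step n (leq_ltn_trans NN Nn)) (IH Nn); first exact: expR_ge0.
by rewrite mulr_ge0 ?npow_ge0 // divr_ge0 ?npow_ge0 // ltW.
Qed.

End Powers.

(** * Asymptotically diagonal linear systems *)

Section Levinson.
Local Open Scope classical_set_scope.
Variable R : realType.
Local Notation C := R[i].
Variables (a b c d : nat -> C) (x : C) (e : R).
Hypothesis asym_a : asym a 1 (x - 1).
Hypothesis asym_b : asym b 0 0.
Hypothesis asym_c : asym c 0 0.
Hypothesis asym_d : asym d 1 (- (1 + x)).
Hypothesis e_gt0 : 0 < e.
Local Notation xi := (complex.Re x).
Hypothesis e_lt : 3 * e < 2 * xi.
Implicit Types (u v : nat -> C) (n N : nat).

(** The matrix tends to the identity and is diagonal at order 1 / n, with entries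
    x - 1 and - (1 + x): solutions behave like n^(x - 1) or like n^(- (1 + x)). *)
Definition linsys u v := forall n, (0 < n)%N ->
  u n.+1 = a n * u n + b n * v n /\ v n.+1 = c n * u n + d n * v n.

(** The loss e in the exponents replaces exact asymptotics. *)
Definition decays u v := exists K : R, exists N, forall n, (N < n)%N ->
  cabs (u n) <= K * npow (- (1 + xi - e)) n /\
  cabs (v n) <= K * npow (- (1 + xi - e)) n.

Definition dominant (eta : R) u v := exists N, forall n, (N < n)%N ->
  [/\ u n != 0, cabs (v n) <= eta * cabs (u n) &
      (1 + (xi - 1 - e) / n%:R) * cabs (u n) <= cabs (u n.+1)].

Lemma linsysB u v u' v' l : linsys u v -> linsys u' v' ->
  linsys (fun n => u' n - l * u n) (fun n => v' n - l * v n).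
Proof.
by move=> h h' n n0; have [-> ->] := h n n0; have [-> ->] := h' n n0; split; ring.
Qed.

Lemma levinson_coefs : exists K : R, 0 <= K /\ exists N, forall n, (N < n)%N ->
  [/\ 1 + (xi - 1) / n%:R - K / n%:R ^+ 2 <= cabs (a n),
      cabs (d n) <= 1 - (1 + xi) / n%:R + K / n%:R ^+ 2,
      cabs (b n) <= K / n%:R ^+ 2 & cabs (c n) <= K / n%:R ^+ 2].
Proof.
have [Ka Ka0 [Na ha]] := asymP asym_a; have [Kb Kb0 [Nb hb]] := asymP asym_b.
have [Kc Kc0 [Nc hc]] := asymP asym_c; have [Kd Kd0 [Nd hd]] := asymP asym_d.
have q0 : 0 <= cabs (1 + x) ^+ 2 by rewrite sqr_ge0.
exists (Ka + Kb + Kc + Kd + cabs (1 + x) ^+ 2); split; first by rewrite !addr_ge0.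
have [M hM] := nat_large (2 * cabs (1 + x)).
exists (maxn M (maxn (maxn Na Nb) (maxn Nc Nd))) => n; rewrite !gtn_max.
move=> /andP[Mn /andP[/andP[/ha {}ha /hb {}hb] /andP[/hc {}hc /hd {}hd]]].
have {hM}big := hM n Mn.
have n0 : (0 : R) < n%:R by rewrite ltr0n (leq_ltn_trans _ Mn).
set t2 : R := n%:R ^- 2 in ha hb hc hd *.
have t20 : 0 <= t2 by rewrite invr_ge0 sqr_ge0.
have wid k k' : 0 <= k' -> k <= k' -> k * t2 <= k' * t2.
  by move=> _ kk; rewrite ler_wpM2r.
split.
- have h1 : 1 + (xi - 1) / n%:R <= cabs (1 + (x - 1) / n%:R).
    apply: le_trans (Re_le _); rewrite natC invC ReCD ReCM ReCD ReCN /= mulr0 subr0.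
    by [].
  have := cabs_subge (1 + (x - 1) / n%:R) (a n - 1 - (x - 1) / n%:R).
  have -> : 1 + (x - 1) / n%:R + (a n - 1 - (x - 1) / n%:R) = a n by ring.
  have : Ka * t2 <= (Ka + Kb + Kc + Kd + cabs (1 + x) ^+ 2) * t2.
    by rewrite ler_wpM2r // -!addrA lerDl !addr_ge0.
  lra.
- have h1 : cabs (1 - (1 + x) / n%:R) <=
      1 - (1 + xi) / n%:R + cabs (1 + x) ^+ 2 * t2.
    have ReE : complex.Re (1 + x) = 1 + xi by rewrite ReCD.
    have q := le_trans (normRe_le (1 + x)) (lexx _); rewrite ReE in q.
    have r1 : (1 + xi) / n%:R <= 2^-1.
      rewrite ler_pdivrMr // ler_pdivlMl //; have := ler_norm (1 + xi); lra.
    have qt : 0 <= cabs (1 + x) ^+ 2 * t2 by rewrite mulr_ge0.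
    rewrite -(ler_pXn2r (n := 2)) ?nnegrE ?cabs_ge0 //; last lra.
    have -> : cabs (1 - (1 + x) / n%:R) ^+ 2 =
       1 - 2 * ((1 + xi) / n%:R) + cabs (1 + x) ^+ 2 * t2.
      rewrite !cabsE !sqr_sqrtr ?addr_ge0 ?sqr_ge0 // natC invC.
      rewrite !(ReCD, ReCN, ImCD, ImCN, ReCM, ImCM) /= /t2; field.
      by rewrite gt_eqF.
    move: r1 qt; move: ((1 + xi) / n%:R) (cabs (1 + x) ^+ 2 * t2) => r q2 r1 q20.
    rewrite -subr_ge0.
    have -> : (1 - r + q2) ^+ 2 - (1 - 2 * r + q2) =
      r ^+ 2 + q2 ^+ 2 + q2 * (1 - 2 * r) by ring.
    by rewrite !addr_ge0 ?sqr_ge0 // mulr_ge0 //; lra.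
  have := cabsD (1 - (1 + x) / n%:R) (d n - 1 - - (1 + x) / n%:R).
  have -> : 1 - (1 + x) / n%:R + (d n - 1 - - (1 + x) / n%:R) = d n by ring.
  have : Kd * t2 + cabs (1 + x) ^+ 2 * t2 <=
      (Ka + Kb + Kc + Kd + cabs (1 + x) ^+ 2) * t2.
    rewrite -mulrDl ler_wpM2r //; lra.
  lra.
- move: hb; rewrite mul0r !subr0 => /le_trans; apply; rewrite ler_wpM2r //; lra.
- move: hc; rewrite mul0r !subr0 => /le_trans; apply; rewrite ler_wpM2r //; lra.
Qed.

Lemma xi_gt0 : 0 < xi. Proof. by move: e_gt0 e_lt; lra. Qed.

Lemma mulr_invsqr_le (K k t : R) : 0 < t -> K <= k * t -> K / t ^+ 2 <= k / t.
Proof.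
move=> t0 h; rewrite expr2 invfM mulrA ler_wpM2r ?invr_ge0 ?(ltW t0) //.
by rewrite ler_pdivrMr.
Qed.

(** The gap 2 Re x between the two exponents makes the cone |v| <= eta |u|
    attractive: inside it u grows at its own rate, outside it v decays at its own. *)
Lemma cone_steps (eta : R) : 0 < eta -> eta <= 1 -> exists N, forall n, (N < n)%N ->
  forall U V : C,
  (cabs V <= eta * cabs U ->
    cabs (c n * U + d n * V) <= eta * cabs (a n * U + b n * V) /\
    (1 + (xi - 1 - e) / n%:R) * cabs U <= cabs (a n * U + b n * V)) /\
  (eta * cabs U <= cabs V ->
    cabs (c n * U + d n * V) <= (1 - (1 + xi - e) / n%:R) * cabs V).
Proof.
move=> eta0 eta1; have [K [K0 [N hN]]] := levinson_coefs; have xi0 := xi_gt0.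
have [M1 hM1] := nat_large (2 * K / e).
have [M2 hM2] := nat_large (4 * K / (2 * (eta * xi))).
have [M3 hM3] := nat_large ((K + K / eta) / e).
exists (maxn N (maxn M1 (maxn M2 M3))) => n; rewrite !gtn_max.
move=> /andP[Nn /and3P[/hM1 {}hM1 /hM2 {}hM2 /hM3 {}hM3]] U V.
have n0 : (0 : R) < n%:R by rewrite ltr0n (leq_ltn_trans _ Nn).
have {hN Nn}[ha hd hb hc] := hN n Nn.
have r1 : 2 * K / n%:R ^+ 2 <= e / n%:R.
  by apply: mulr_invsqr_le => //; rewrite [leRHS]mulrC -ler_pdivrMr.
have r2 : 4 * K / n%:R ^+ 2 <= 2 * (eta * xi) / n%:R.
  by apply: mulr_invsqr_le => //; rewrite [leRHS]mulrC -ler_pdivrMr // !mulr_gt0.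
have r3 : (K + K / eta) / n%:R ^+ 2 <= e / n%:R.
  by apply: mulr_invsqr_le => //; rewrite [leRHS]mulrC -ler_pdivrMr.
have t0 : 0 <= (n%:R^-1 : R) by rewrite invr_ge0 ltW.
have q0 : 0 <= K / n%:R ^+ 2 by rewrite divr_ge0 // sqr_ge0.
move: (cabs_ge0 U) (cabs_ge0 V) => U0 V0.
have cU : cabs (c n * U) <= K / n%:R ^+ 2 * cabs U by rewrite cabsM ler_wpM2r.
have dV : cabs (d n * V) <= (1 - (1 + xi) / n%:R + K / n%:R ^+ 2) * cabs V.
  by rewrite cabsM ler_wpM2r.
split=> VU.
- have bV : cabs (b n * V) <= K / n%:R ^+ 2 * cabs U.
    rewrite cabsM ler_pM ?cabs_ge0 //; apply: le_trans VU _.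
    by rewrite ler_piMl.
  have aU : (1 + (xi - 1) / n%:R - 2 * K / n%:R ^+ 2) * cabs U <=
      cabs (a n * U + b n * V).
    apply: le_trans (cabs_subge _ _).
    have := ler_wpM2r U0 ha; rewrite -cabsM; move: bV.
    have -> : 2 * K / n%:R ^+ 2 = 2 * (K / n%:R ^+ 2) by ring.
    move: (cabs _) (cabs _) (cabs _) (K / _) ((xi - 1) / _) => p q r k l; lra.
  split; last first.
    apply: le_trans aU; rewrite ler_wpM2r //.
    have -> : (xi - 1 - e) / n%:R = (xi - 1) / n%:R - e / n%:R by ring.
    lra.
  apply: le_trans (ler_wpM2l (ltW eta0) aU).
  apply: le_trans (cabsD _ _) _.
  have d0 : 0 <= 1 - (1 + xi) / n%:R + K / n%:R ^+ 2.
    exact: le_trans (cabs_ge0 _) hd.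
  have := ler_wpM2l d0 VU.
  have : 4 * K / n%:R ^+ 2 * cabs U <= 2 * (eta * xi) / n%:R * cabs U.
    by rewrite ler_wpM2r.
  have : eta * (K / n%:R ^+ 2) * cabs U <= K / n%:R ^+ 2 * cabs U.
    by rewrite ler_wpM2r // ler_piMl.
  move: cU dV.
  have -> : 4 * K / n%:R ^+ 2 = 4 * (K / n%:R ^+ 2) by ring.
  have -> : 2 * K / n%:R ^+ 2 = 2 * (K / n%:R ^+ 2) by ring.
  have -> : (1 + xi) / n%:R = n%:R^-1 + xi / n%:R by ring.
  have -> : (xi - 1) / n%:R = xi / n%:R - n%:R^-1 by ring.
  have -> : 2 * (eta * xi) / n%:R = 2 * eta * (xi / n%:R) by ring.
  move: (cabs (c n * U)) (cabs (d n * V)) (cabs U) (cabs V) => p q r s.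
  move: (K / _) (xi / _) => k l; move: (n%:R^-1 : R) => t; lra.
- apply: le_trans (cabsD _ _) _.
  have h1 : K / n%:R ^+ 2 * cabs U <= K / n%:R ^+ 2 * (cabs V / eta).
    by rewrite ler_wpM2l // ler_pdivlMr // mulrC.
  have h2 := ler_wpM2r V0 r3.
  move: cU dV h1 h2.
  have -> : (K + K / eta) / n%:R ^+ 2 * cabs V =
    K / n%:R ^+ 2 * cabs V + K / n%:R ^+ 2 * (cabs V / eta) by ring.
  have -> : (1 + xi - e) / n%:R = (1 + xi) / n%:R - e / n%:R by ring.
  move: (cabs (c n * U)) (cabs (d n * V)) (cabs U) (cabs V / eta) (cabs V) => p q r s w.
  move: (K / _) (e / _) ((1 + xi) / _) => k l t; lra.
Qed.

(** A solution that enters the cone never leaves it, and dominates unless it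
    vanishes from some index on; one that stays outside decays. *)
Lemma dichotomy (eta : R) u v : 0 < eta -> eta <= 1 -> linsys u v ->
  decays u v \/ dominant eta u v.
Proof.
move=> eta0 eta1 huv; have [N hN] := cone_steps eta0 eta1; have xi0 := xi_gt0.
have [[m [Nm hm]]|out] := pselect (exists m, (N < m)%N /\ cabs (v m) <= eta * cabs (u m)).
  have cone n : (m <= n)%N -> cabs (v n) <= eta * cabs (u n).
    elim: n => [|n IH]; first by rewrite leqn0 => /eqP <-.
    rewrite leq_eqVlt => /predU1P[<- //|mn].
    have Nn : (N < n)%N := leq_trans Nm mn.
    have [-> ->] := huv n (leq_ltn_trans (leq0n _) Nn).
    by have [/(_ (IH mn)) []] := hN n Nn (u n) (v n).
  have grow n : (m <= n)%N -> (1 + (xi - 1 - e) / n%:R) * cabs (u n) <= cabs (u n.+1).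
    move=> mn; have Nn : (N < n)%N := leq_trans Nm mn.
    have [-> _] := huv n (leq_ltn_trans (leq0n _) Nn).
    by have [/(_ (cone n mn)) []] := hN n Nn (u n) (v n).
  have [[p mp up]|un0] := pselect (exists2 p, (m <= p)%N & u p = 0).
    left; exists 0, p => n pn; rewrite mul0r.
    suff: u n = 0 /\ v n = 0 by case=> -> ->; rewrite cabs0.
    elim: n pn => // n IH; rewrite ltnS leq_eqVlt => pn.
    have [un vn] : u n = 0 /\ v n = 0.
      move: pn => /predU1P[<-|/IH //]; split => //; apply/eqP.
      rewrite -cabs_eq0 eq_le cabs_ge0 andbT.
      by apply: le_trans (cone p mp) _; rewrite up cabs0 mulr0.
    have n0 : (0 < n)%N.
      have : (p <= n)%N by case/predU1P: pn => [->|/ltnW].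
      by move=> pn'; exact: leq_trans (leq_ltn_trans (leq0n N) Nm) (leq_trans mp pn').
    by have [-> ->] := huv n n0; rewrite un vn !mulr0 addr0.
  right; exists m => n /ltnW mn; split; [|exact: cone|exact: grow].
  by apply/eqP => un; apply: un0; exists n.
left.
have vb n : (N < n)%N -> eta * cabs (u n) <= cabs (v n).
  by move=> Nn; rewrite leNgt; apply/negP => h; apply: out; exists n; split => //; exact: ltW.
have [|||K K0 hK] := @decay_npow _ (fun n => cabs (v n)) (1 + xi - e) N.
- by move: e_gt0 e_lt; lra.
- by move=> n; exact: cabs_ge0.
- move=> n Nn; have [_ ->] := huv n (leq_ltn_trans (leq0n _) Nn).
  by have [_ /(_ (vb n Nn))] := hN n Nn (u n) (v n).
exists (K / eta), N => n Nn; split.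
  rewrite mulrAC ler_pdivlMr // mulrC; exact: le_trans (vb n Nn) (hK n Nn).
apply: le_trans (hK n Nn) _; rewrite ler_wpM2r ?npow_ge0 // ler_pdivlMr //.
by rewrite ler_piMr.
Qed.

Lemma dominant_lower (eta : R) u v : dominant eta u v ->
  exists K : R, 0 < K /\ exists N, forall n, (N < n)%N ->
    K * npow (xi - 1 - 2 * e) n <= cabs (u n).
Proof.
move=> [N hN]; have ss : xi - 1 - 2 * e < xi - 1 - e by move: e_gt0; lra.
have [N1 hN1] := growth_npow ss.
have [||K K0 hK] := hN1 (maxn N N1) (fun n => cabs (u n)) (leq_maxr _ _).
- by rewrite cabs_gt0; have [] := hN (maxn N N1).+1; first by rewrite ltnS leq_maxl.
- by move=> n; rewrite gtn_max => /andP[/hN []].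
by exists K; split => //; exists (maxn N N1).
Qed.

(** The exponents leave - (1 + xi - e) - (xi - 1 - 2 e) = - (2 xi - 3 e), which is
    negative. *)
Lemma decays_dominant (eta : R) u v u' v' : decays u v -> dominant eta u' v' ->
  exists2 g : nat -> R, g n @[n --> \oo] --> (0 : R) &
  \forall n \near \oo, cabs (u n) <= g n * cabs (u' n) /\
                         cabs (v n) <= g n * cabs (u' n).
Proof.
move=> [K [N hN]] /dominant_lower [k [k0 [M hM]]].
exists (fun n => `|K| / k * npow (- (2 * xi - 3 * e)) n).
  rewrite -(mulr0 (`|K| / k)); apply: cvgMr; apply: npow_cvg0.
  by move: e_lt; lra.
exists (maxn N M).+1 => // n /=; rewrite gtn_max => /andP[/hN [hu hv] /hM {}hM].
have h : K * npow (- (1 + xi - e)) n <=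
    `|K| / k * npow (- (2 * xi - 3 * e)) n * cabs (u' n).
  apply: le_trans (ler_wpM2r (npow_ge0 _ _) (ler_norm K)) _.
  have -> : - (1 + xi - e) = - (2 * xi - 3 * e) + (xi - 1 - 2 * e) by ring.
  rewrite npowD -[leRHS]mulrA mulrCA [leRHS]mulrCA.
  rewrite ler_wpM2l ?npow_ge0 // -[leRHS]mulrA ler_wpM2l // ler_pdivlMl //.
by split; [apply: le_trans hu h|apply: le_trans hv h].
Qed.

Lemma asym_det : asym (fun n => a n * d n - b n * c n) 1 (- 2).
Proof.
have -> : (fun n => a n * d n - b n * c n) =
  (fun n => a n * d n + (-1) * (b n * c n)) by apply/funext => n; ring.
apply: asym_of (asymD (asymM asym_a asym_d) (asymZ (-1) (asymM asym_b asym_c))) _ _.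
  by ring.
by ring.
Qed.

(** The determinant expands as 1 - 2 / n, the right hand side as
    1 + 2 (xi - 1 - e) / n, and xi - e is positive. *)
Lemma cabs_det_le : exists N, forall n, (N < n)%N ->
  0 <= 1 + (xi - 1 - e) / n%:R /\
  cabs (a n * d n - b n * c n) <= (1 + (xi - 1 - e) / n%:R) ^+ 2.
Proof.
have [K K0 [N hN]] := asymP asym_det; have xi0 := xi_gt0.
have dl : 0 < xi - e by move: e_gt0 e_lt; lra.
have [M hM] := nat_large (K / (2 * (xi - e)) + `|xi - 1 - e| + 2).
exists (maxn N M) => n; rewrite gtn_max => /andP[/[dup] Nn /hN {}hN /hM {}hM].
have n0 : (0 : R) < n%:R by rewrite ltr0n (leq_ltn_trans _ Nn).
have A0 : 0 <= K / (2 * (xi - e)) by rewrite divr_ge0 // mulr_ge0 // ltW.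
have B0 := normr_ge0 (xi - 1 - e).
have r1 : K / n%:R ^+ 2 <= 2 * (xi - e) / n%:R.
  apply: mulr_invsqr_le => //; rewrite [leRHS]mulrC -ler_pdivrMr ?mulr_gt0 //; lra.
have r2 : `|(xi - 1 - e) / n%:R| <= 1.
  by rewrite normrM normfV (ger0_norm (ltW n0)) ler_pdivrMr // mul1r; lra.
have t2 : 2 / (n%:R : R) <= 1 by rewrite ler_pdivrMr // mul1r; lra.
split; first by move: r2; rewrite ler_norml => /andP[]; lra.
have -> : a n * d n - b n * c n =
  (1 - (2 / n%:R)) + (a n * d n - b n * c n - 1 - - 2 / n%:R) by ring.
apply: le_trans (cabsD _ _) _.
have -> : cabs (1 - (2 / n%:R) : C) = 1 - 2 / n%:R.
  have -> : (1 - (2 / n%:R) : C) = real_complex R (1 - 2 / n%:R).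
    by rewrite rmorphB rmorphM fmorphV !rmorph_nat.
  by rewrite cabs_real ger0_norm //; lra.
apply: le_trans (lerD (lexx _) hN) _.
have := sqr_ge0 ((xi - 1 - e) / n%:R).
rewrite sqrrD expr1n mul1r.
have -> : (xi - 1 - e) / n%:R *+ 2 = 2 * (xi - e) / n%:R - 2 / n%:R by ring.
move: r1; move: (2 * (xi - e) / n%:R) (2 / n%:R : R) ((_ / _) ^+ 2) (K / _) => p q r k; lra.
Qed.

(** The Casoratian v' u - v u' is multiplied by the determinant at each step, so
    its quotient by |u|^2 stays bounded; the increments of u' / u are at most this
    quotient times O(1 / n^2). *)
Lemma ratio_cvg u v u' v' : linsys u v -> linsys u' v' -> dominant 1 u v ->
  exists l : C, (u' n / u n) @[n --> \oo] --> l.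
Proof.
move=> hu hu' [N0 hN0]; have [N1 hN1] := cabs_det_le.
have [K K0 [N2 hN2]] := asymP asym_b.
have [M hM] := nat_large (2 * `|xi - 1 - e|).
pose N := maxn (maxn N0 N1) (maxn N2 M).
have hN n : (N < n)%N -> [/\ (N0 < n)%N, (N1 < n)%N, (N2 < n)%N & (M < n)%N].
  by rewrite /N !gtn_max => /andP[/andP[-> ->] /andP[-> ->]].
pose W n := v' n * u n - v n * u' n.
pose G n := cabs (W n) / cabs (u n) ^+ 2.
have Gmon n : (N < n)%N -> G n <= G N.+1.
  elim: n => // n IH; rewrite ltnS leq_eqVlt => /predU1P[<- //|Nn].
  apply: le_trans (IH Nn); have [n0 n1 _ _] := hN n Nn.
  have nn : (0 < n)%N by apply: leq_ltn_trans Nn.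
  have [un _ gr] := hN0 n n0; have [un' _ _] := hN0 n.+1 (ltnW n0).
  have [g0 dle] := hN1 n n1.
  have WS : W n.+1 = (a n * d n - b n * c n) * W n.
    rewrite /W; have [-> ->] := hu n nn; have [-> ->] := hu' n nn; ring.
  rewrite /G ler_pdivrMr ?exprn_gt0 ?cabs_gt0 //.
  rewrite mulrAC ler_pdivlMr ?exprn_gt0 ?cabs_gt0 // WS cabsM.
  rewrite -mulrA mulrCA ler_wpM2l ?cabs_ge0 //.
  apply: (@le_trans _ _ (((1 + (xi - 1 - e) / n%:R) * cabs (u n)) ^+ 2)).
    by rewrite exprMn ler_wpM2r ?sqr_ge0.
  by rewrite ler_pXn2r ?nnegrE ?cabs_ge0 // mulr_ge0 ?cabs_ge0.
have G0 n : 0 <= G n by rewrite divr_ge0 ?cabs_ge0 ?sqr_ge0.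
apply: (@sum_invsqr_cvg _ (fun n => u' n / u n) (2 * K * G N.+1) N) => n Nn.
have [n0 n1 n2 n3] := hN n Nn.
have nn : (0 < n)%N by apply: leq_ltn_trans Nn.
have nR : (0 : R) < n%:R by rewrite ltr0n.
have [un _ gr] := hN0 n n0; have [un' _ _] := hN0 n.+1 (ltnW n0).
have -> : u' n.+1 / u n.+1 - u' n / u n = b n * W n / (u n * u n.+1).
  have [e1 _] := hu n nn; have [e1' _] := hu' n nn.
  rewrite e1' /W; move: un'; rewrite e1 => un'; field; by rewrite un un'.
have half : 2^-1 * cabs (u n) <= cabs (u n.+1).
  apply: le_trans gr; rewrite ler_wpM2r ?cabs_ge0 //.
  have : `|(xi - 1 - e) / n%:R| <= 2^-1.
    rewrite normrM normfV (ger0_norm (ltW nR)) ler_pdivrMr // ler_pdivlMl //.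
    exact: hM.
  rewrite ler_norml => /andP[]; lra.
have hb : cabs (b n) <= K / n%:R ^+ 2 by have := hN2 n n2; rewrite mul0r !subr0.
have u0 : 0 < cabs (u n) by rewrite cabs_gt0.
rewrite !cabsM cabsV cabsM.
apply: (@le_trans _ _ (cabs (b n) * (2 * G n))).
  rewrite -mulrA ler_wpM2l ?cabs_ge0 // /G mulrCA ler_wpM2l ?cabs_ge0 //.
  have -> : 2 / cabs (u n) ^+ 2 = (2^-1 * cabs (u n) ^+ 2)^-1.
    by rewrite [RHS]invfM invrK.
  rewrite lef_pV2 ?posrE ?mulr_gt0 ?invr_gt0 ?exprn_gt0 ?cabs_gt0 //.
  by rewrite expr2 mulrCA ler_pM2l.
apply: le_trans (ler_pM (cabs_ge0 _) _ hb (ler_wpM2l _ (Gmon n Nn))) _ => //.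
  by rewrite mulr_ge0.
by rewrite le_eqVlt; apply/orP; left; apply/eqP; ring.
Qed.

(** With l the limit of u' / u, the difference u' - l u cannot dominate: the
    quotient of u by it would converge, although its product with u' / u - l is 1. *)
Lemma decaying_combination u v u' v' : linsys u v -> linsys u' v' -> dominant 1 u v ->
  exists l : C, decays (fun n => u' n - l * u n) (fun n => v' n - l * v n).
Proof.
move=> hu hu' du; have [l hl] := ratio_cvg hu hu' du; exists l.
have hM := linsysB l hu hu'.
case: (dichotomy ltr01 (lexx 1) hM) => // dM.
have [l' hl'] := ratio_cvg hM hu dM.
have [[N hN] [N' hN']] := (du, dM).
have h0 : ((u' n / u n - l) * (u n / (u' n - l * u n))) @[n --> \oo] --> ((l - l) * l' : C).
  exact: (cvgM (cvgB hl (cvg_cst l)) hl').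
rewrite subrr mul0r in h0.
have h1 : ((u' n / u n - l) * (u n / (u' n - l * u n))) @[n --> \oo] --> (1 : C).
  apply: (cvg_cabs_le (g := fun=> 0)); last exact: cvg_cst.
  exists (maxn N N').+1 => // n /=; rewrite gtn_max => /andP[/hN [un _ _] /hN' [un' _ _]].
  have -> : (u' n / u n - l) * (u n / (u' n - l * u n)) = 1.
    by field; rewrite un un'.
  by rewrite subrr cabs0.
have e01 : (0 : C) = 1.
  exact: (@cvg_unique _ (@norm_hausdorff _ (C : pseudoMetricNormedZmodType C)) _ _ _ _ h0 h1).
by move/esym/eqP: e01; rewrite oner_eq0.
Qed.

(** At a late index the initial pair (1, 0) lies in the cone. *)
Lemma dominant_start : exists N, forall u v, linsys u v ->
  u N.+1 = 1 -> v N.+1 = 0 -> dominant 1 u v.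
Proof.
have [N hN] := cone_steps ltr01 (lexx 1); have xi0 := xi_gt0.
have [M hM] := nat_large (2 * `|xi - 1 - e|).
exists (maxn N M) => u v huv u1 v0; exists (maxn N M) => n; set P := maxn N M in u1 v0 *.
have step m : (P < m)%N -> u m != 0 -> cabs (v m) <= 1 * cabs (u m) ->
  [/\ u m.+1 != 0, cabs (v m.+1) <= 1 * cabs (u m.+1) &
      (1 + (xi - 1 - e) / m%:R) * cabs (u m) <= cabs (u m.+1)].
  rewrite gtn_max => /andP[Nm Mm] um vm; have mm := leq_ltn_trans (leq0n _) Nm.
  have mR : (0 : R) < m%:R by rewrite ltr0n.
  have [-> ->] := huv m mm.
  have [/(_ vm) [h1 h2] _] := hN m Nm (u m) (v m); split => //.
  rewrite -cabs_gt0; apply: lt_le_trans h2; rewrite mulr_gt0 ?cabs_gt0 //.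
  have : `|(xi - 1 - e) / m%:R| <= 2^-1.
    rewrite normrM normfV (ger0_norm (ltW mR)) ler_pdivrMr // ler_pdivlMl //.
    exact: hM.
  rewrite ler_norml => /andP[]; lra.
have inv m : (P < m)%N -> u m != 0 /\ cabs (v m) <= 1 * cabs (u m).
  elim: m => // m IH; rewrite ltnS leq_eqVlt => /predU1P[<-|Pm].
    by rewrite u1 v0 oner_neq0 cabs0 cabs1 mul1r ler01.
  by have [um vm] := IH Pm; have [] := step m Pm um vm.
by move=> Pn; have [un vn] := inv n Pn; have [] := step n Pn un vn.
Qed.

Lemma decaysZD k l u v u' v' : decays u v -> decays u' v' ->
  decays (fun n => k * u n + l * u' n) (fun n => k * v n + l * v' n).
Proof.
move=> [K [N h]] [K' [N' h']].
exists (cabs k * K + cabs l * K'), (maxn N N') => n; rewrite gtn_max.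
move=> /andP[/h [h1 h2] /h' [h1' h2']].
rewrite mulrDl -!mulrA; split; apply: le_trans (cabsD _ _) (lerD _ _);
  by rewrite cabsM ler_wpM2l ?cabs_ge0.
Qed.

Lemma decays_not_dominant (eta : R) u v : decays u v -> dominant eta u v -> False.
Proof.
move=> h1 h2; have [g g0 [N _ hg]] := decays_dominant h1 h2.
have [M hM] := h2; move/cvgrPdist_lt: g0 => /(_ 1 ltr01) [P _ hP].
pose n := maxn P (maxn N M.+1).
have /hP : (P <= n)%N by rewrite leq_max leqnn.
have /hg [] : (N <= n)%N by rewrite !leq_max leqnn orbT.
have /hM [un _ _] : (M < n)%N by rewrite !leq_max leqnn !orbT.
rewrite /= sub0r normrN => h _ gn.
have u0 : 0 < cabs (u n) by rewrite cabs_gt0.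
have g1 : g n < 1 by apply: le_lt_trans (ler_norm _) gn.
have := le_lt_trans h (_ : _ < 1 * cabs (u n)).
by rewrite (ltr_pM2r u0) => /(_ g1); rewrite mul1r ltxx.
Qed.

End Levinson.

(** * Diagonal form of the recurrence *)

Section Diagonalization.
Local Open Scope classical_set_scope.
Local Open Scope complex_scope.
Variable R : realType.
Local Notation C := R[i].
Variables alpha beta : C.
Local Notation U := (upoly alpha beta).
Local Notation V := (vpoly alpha beta).
Implicit Types (x z : C) (y f : nat -> C).

(** The recurrence without its first step, whose coefficient [vpoly 0] may vanish. *)
Definition tail_solves z y := forall n,
  U n.+2%:R * y n.+2 = midcoef alpha beta z n.+1 * y n.+1 - V n.+1%:R * y n.

Lemma solves_tail z f : solves alpha beta z f -> tail_solves z (fun n => f n.+1).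
Proof. by move=> hf n; rewrite hf. Qed.

Lemma tail_solvesZD z k l y y' : tail_solves z y -> tail_solves z y' ->
  tail_solves z (fun n => k * y n + l * y' n).
Proof.
move=> h h' n.
rewrite mulrDr mulrCA h [X in _ + X]mulrCA h'; ring.
Qed.

Definition uratio (n : nat) : C :=
  (1 + (1 + alpha / 2) * n%:R^-1) * (1 + (1 + beta / 2) * n%:R^-1) *
  (1 + (1 - (alpha + beta) / 2) * n%:R^-1).
Definition vratio (n : nat) : C :=
  (1 + - (alpha / 2) * n%:R^-1) * (1 + - (beta / 2) * n%:R^-1) *
  (1 + (alpha + beta) / 2 * n%:R^-1).

Lemma upolyE n : (0 < n)%N -> U n.+1%:R = n%:R ^+ 3 * uratio n.
Proof.
move=> n0; have h : (n%:R : C) != 0 by rewrite pnatr_eq0 -lt0n.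
by rewrite /upoly /uratio -natr1; field.
Qed.

Lemma vpolyE n : (0 < n)%N -> V n%:R = n%:R ^+ 3 * vratio n.
Proof.
move=> n0; have h : (n%:R : C) != 0 by rewrite pnatr_eq0 -lt0n.
by rewrite /vpoly /vratio; field.
Qed.

Lemma asym_linear k : asym (fun n : nat => 1 + k * n%:R^-1 : C) 1 k.
Proof.
apply: asym_of (asymD (asym_cst 1) (asymZ k (asym_inv R))) _ _; ring.
Qed.

Lemma asym_uratio : asym uratio 1 3.
Proof.
apply: asym_of (asymM (asymM (asym_linear _) (asym_linear _)) (asym_linear _)) _ _.
  ring.
by field.
Qed.

Lemma asym_vratio : asym vratio 1 0.
Proof.
apply: asym_of (asymM (asymM (asym_linear _) (asym_linear _)) (asym_linear _)) _ _.
  ring.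
by field.
Qed.

(** The discrete Euler operator t d/dt, which multiplies n^s by s to first order. *)
Definition euler_diff y (n : nat) : C := n%:R * (y n - y n.-1).
(** Each of the two parts cancels, to first order, one of the power laws
    n^(-1 - x) and n^(-1 + x) of the solutions. *)
Definition growing_part x y (n : nat) : C := euler_diff y n + (1 + x) * y n.
Definition decaying_part x y (n : nat) : C := euler_diff y n + (1 - x) * y n.

Definition diffcoef_y x (n : nat) : C :=
  (x ^+ 2 - 1) / 2 * ((1 + 1 * n%:R^-1) * (2 + n%:R^-1) * n%:R^-1 * (uratio n)^-1).
Definition diffcoef_h (n : nat) : C :=
  (1 + 1 * n%:R^-1) * vratio n * (uratio n)^-1.

Lemma asym_diffcoef_y x : asym (diffcoef_y x) 0 (x ^+ 2 - 1).
Proof.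
apply: asym_of (asymZ _ (asymM (asymM (asymM (asym_linear 1)
  (asymD (asym_cst 2) (asym_inv R))) (asym_inv R)) (asymV asym_uratio (erefl _)))) _ _.
  ring.
by field.
Qed.

Lemma asym_diffcoef_h : asym diffcoef_h 1 (-2).
Proof.
apply: asym_of (asymM (asymM (asym_linear 1) asym_vratio)
  (asymV asym_uratio (erefl _))) _ _; ring.
Qed.

Lemma euler_diffS x z y n : x = 2 * z + 1 -> (0 < n)%N -> U n.+1%:R != 0 ->
  tail_solves z y ->
  euler_diff y n.+1 = diffcoef_y x n * y n + diffcoef_h n * euler_diff y n.
Proof.
move=> -> n0 U0 hy; have h : (n%:R : C) != 0 by rewrite pnatr_eq0 -lt0n.
have P0 : uratio n != 0.
  by move: U0; rewrite upolyE // mulf_eq0 negb_or => /andP[].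
apply: (mulfI U0); rewrite /euler_diff /=.
have -> : U n.+1%:R * (n.+1%:R * (y n.+1 - y n)) =
  n.+1%:R * (U n.+1%:R * y n.+1 - U n.+1%:R * y n) by ring.
case: n n0 h U0 P0 => // n n0 h U0 P0; rewrite hy /= /midcoef.
rewrite vpolyE // upolyE // /diffcoef_y /diffcoef_h -(natr1 n.+1).
move: (n.+1%:R : C) (uratio _) (vratio _) h P0 => m p q h P0.
by field; rewrite h P0.
Qed.

Definition coef_uu x (n : nat) : C := (2 * x)^-1 *
  ((1 + (1 + x) * n.+1%:R^-1) * (diffcoef_y x n + (x - 1) * diffcoef_h n) + (1 + x)).
Definition coef_uv x (n : nat) : C := (2 * x)^-1 *
  ((1 + (1 + x) * n.+1%:R^-1) * ((-1) * diffcoef_y x n + (1 + x) * diffcoef_h n) + - (1 + x)).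
Definition coef_vu x (n : nat) : C := (2 * x)^-1 *
  ((1 + (1 - x) * n.+1%:R^-1) * (diffcoef_y x n + (x - 1) * diffcoef_h n) + (1 - x)).
Definition coef_vv x (n : nat) : C := (2 * x)^-1 *
  ((1 + (1 - x) * n.+1%:R^-1) * ((-1) * diffcoef_y x n + (1 + x) * diffcoef_h n) + - (1 - x)).

(** One expansion serves the four entries of the matrix. *)
Lemma asym_coef s k l w x : x != 0 ->
  asym (fun n => (2 * x)^-1 *
  ((1 + s * n.+1%:R^-1) * (k * diffcoef_y x n + l * diffcoef_h n) + w))
  ((2 * x)^-1 * (l + w)) ((2 * x)^-1 * (k * (x ^+ 2 - 1) - 2 * l + s * l)).
Proof.
move=> x0.
apply: asym_of (asymZ _ (asymD (asymM (asymD (asym_cst 1) (asymZ s (asym_invS R)))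
  (asymD (asymZ k (asym_diffcoef_y x)) (asymZ l asym_diffcoef_h))) (asym_cst w))) _ _.
  by congr (_ * _); ring.
by congr (_ * _); ring.
Qed.

Lemma asym_uu x : x != 0 -> asym (coef_uu x) 1 (x - 1).
Proof.
move=> x0; have := asym_coef (1 + x) 1 (x - 1) (1 + x) x0.
move/(@asym_ext _ _ (coef_uu x)) => h; apply: asym_of (h _) _ _.
- by move=> n; rewrite mul1r.
- by field.
- by field.
Qed.

Lemma asym_uv x : x != 0 -> asym (coef_uv x) 0 0.
Proof.
move=> x0; apply: asym_of (asym_coef (1 + x) (-1) (1 + x) (- (1 + x)) x0) _ _;
  by field.
Qed.

Lemma asym_vu x : x != 0 -> asym (coef_vu x) 0 0.
Proof.
move=> x0; have := asym_coef (1 - x) 1 (x - 1) (1 - x) x0.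
move/(@asym_ext _ _ (coef_vu x)) => h; apply: asym_of (h _) _ _.
- by move=> n; rewrite mul1r.
- by field.
- by field.
Qed.

Lemma asym_vv x : x != 0 -> asym (coef_vv x) 1 (- (1 + x)).
Proof.
move=> x0; apply: asym_of (asym_coef (1 - x) (-1) (1 + x) (- (1 - x)) x0) _ _;
  by field.
Qed.

Lemma parts_y x y n : x != 0 ->
  y n = (growing_part x y n - decaying_part x y n) / (2 * x).
Proof. by move=> x0; rewrite /growing_part /decaying_part; field. Qed.

Lemma parts_h x y n : x != 0 -> euler_diff y n =
  ((x - 1) * growing_part x y n + (1 + x) * decaying_part x y n) / (2 * x).
Proof. by move=> x0; rewrite /growing_part /decaying_part; field. Qed.

Hypothesis U_neq0 : forall n, (0 < n)%N -> U n%:R != 0.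

Lemma parts_linsys x z y : x = 2 * z + 1 -> x != 0 -> tail_solves z y ->
  linsys (coef_uu x) (coef_uv x) (coef_vu x) (coef_vv x)
    (growing_part x y) (decaying_part x y).
Proof.
move=> xz x0 hy n n0.
have hS := euler_diffS xz n0 (U_neq0 (ltn0Sn n)) hy.
have yS : y n.+1 = y n + n.+1%:R^-1 * euler_diff y n.+1.
  rewrite /euler_diff /= mulrA mulVf ?pnatr_eq0 // mul1r; ring.
have eu := parts_y y n x0; have eh := parts_h y n x0.
rewrite /growing_part /decaying_part -/(growing_part x y n) -/(decaying_part x y n).
rewrite yS hS eu eh /coef_uu /coef_uv /coef_vu /coef_vv.
move: (growing_part x y n) (decaying_part x y n) (n.+1%:R^-1 : C) => u v t.
by split; field.
Qed.

End Diagonalization.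

(** * Minimal solutions *)

Section MinimalSolutions.
Local Open Scope classical_set_scope.
Local Open Scope complex_scope.
Variable R : realType.
Local Notation C := R[i].
Variables alpha beta : C.
Local Notation U := (upoly alpha beta).
Local Notation V := (vpoly alpha beta).
Hypothesis U_neq0 : forall n, (0 < n)%N -> U n%:R != 0.
Hypothesis V_neq0 : forall n, (0 < n)%N -> V n%:R != 0.
Variable e : R.
Hypothesis e_gt0 : 0 < e.
Implicit Types (z : C) (y : nat -> C).
Local Notation tsolves := (tail_solves alpha beta).
Local Notation xi z := (complex.Re (2 * z + 1)).

(** Decay of both parts characterises the minimal solutions. *)
Definition decaying z y :=
  decays (2 * z + 1) e (growing_part (2 * z + 1) y) (decaying_part (2 * z + 1) y).
Definition dominating z eta y :=
  dominant (2 * z + 1) e eta (growing_part (2 * z + 1) y) (decaying_part (2 * z + 1) y).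

Lemma tail_solves_ext z y y' : tsolves z y -> tsolves z y' ->
  y 0%N = y' 0%N -> y 1%N = y' 1%N -> y =1 y'.
Proof.
move=> h h' e0 e1 n; suff [] : y n = y' n /\ y n.+1 = y' n.+1 by [].
elim: n => [//|n [en enS]]; split=> //.
by apply: (mulfI (U_neq0 (ltn0Sn n.+1))); rewrite h h' en enS.
Qed.

Lemma tail_solves_init z p q : exists y, [/\ tsolves z y, y 0%N = p & y 1%N = q].
Proof.
pose step (n : nat) (s : C * C) : C * C :=
  (s.2, (midcoef alpha beta z n.+1 * s.2 - V n.+1%:R * s.1) / U n.+2%:R).
pose g := fix g n := if n is n'.+1 then step n' (g n') else (p, q).
exists (fun n => (g n).1); split=> // n.
by rewrite /= mulrC divfK ?U_neq0.
Qed.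

(** As no coefficient vanishes, the recurrence also runs backwards. *)
Lemma tail_solves_at z N p q : exists y, [/\ tsolves z y, y N = p & y N.+1 = q].
Proof.
elim: N p q => [|N IH] p q; first exact: tail_solves_init.
have [y [hy yN yS]] := IH ((midcoef alpha beta z N.+1 * p - U N.+2%:R * q) / V N.+1%:R) p.
exists y; split=> //; apply: (mulfI (U_neq0 (ltn0Sn N.+1))).
by rewrite hy yN yS mulrC [X in _ - X]mulrC divfK ?V_neq0 // mulrC; ring.
Qed.

Lemma tail_solves_parts z N s t : 2 * z + 1 != 0 -> exists y,
  [/\ tsolves z y, growing_part (2 * z + 1) y N.+1 = s &
      decaying_part (2 * z + 1) y N.+1 = t].
Proof.
move: (2 * z + 1) => x x0.
pose p := (s - t) / (2 * x); pose h := ((x - 1) * s + (1 + x) * t) / (2 * x).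
have [y [hy yN yS]] := tail_solves_at z N (p - h / N.+1%:R) p.
have E : euler_diff y N.+1 = h.
  by rewrite /euler_diff /= yN yS opprB addrC subrK mulrC divfK // pnatr_eq0.
exists y; split=> //; rewrite /growing_part /decaying_part E yS /p /h; by field.
Qed.

Lemma growing_partZD x k l y y' n :
  growing_part x (fun n => k * y n + l * y' n) n =
  k * growing_part x y n + l * growing_part x y' n.
Proof. rewrite /growing_part /euler_diff; ring. Qed.

Lemma decaying_partZD x k l y y' n :
  decaying_part x (fun n => k * y n + l * y' n) n =
  k * decaying_part x y n + l * decaying_part x y' n.
Proof. rewrite /decaying_part /euler_diff; ring. Qed.

Lemma decayingZD z k l y y' : decaying z y -> decaying z y' ->
  decaying z (fun n => k * y n + l * y' n).
Proof.
move=> h h'; rewrite /decaying.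
have -> : growing_part (2 * z + 1) (fun n => k * y n + l * y' n) =
  (fun n => k * growing_part (2 * z + 1) y n + l * growing_part (2 * z + 1) y' n).
  by apply/funext => n; exact: growing_partZD.
have -> : decaying_part (2 * z + 1) (fun n => k * y n + l * y' n) =
  (fun n => k * decaying_part (2 * z + 1) y n + l * decaying_part (2 * z + 1) y' n).
  by apply/funext => n; exact: decaying_partZD.
exact: decaysZD.
Qed.

Section Fixed.
Variable z : C.
Local Notation x := (2 * z + 1).
Hypothesis e_lt : 3 * e < 2 * xi z.

Lemma x_neq0 : x != 0.
Proof.
apply/eqP => x0; move: e_lt; rewrite x0 /= mulr0.
by move: e_gt0; lra.
Qed.

Let sys y (hy : tsolves z y) := parts_linsys U_neq0 (erefl x) x_neq0 hy.

Lemma dichotomy_sol eta y : 0 < eta -> eta <= 1 -> tsolves z y ->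
  decaying z y \/ dominating z eta y.
Proof.
move=> eta0 eta1 hy.
exact: (dichotomy (asym_uu alpha beta x_neq0) (asym_uv alpha beta x_neq0) (asym_vu alpha beta x_neq0)
  (asym_vv alpha beta x_neq0) e_gt0 e_lt eta0 eta1 (sys hy)).
Qed.

Lemma not_decaying_dominating eta y : decaying z y -> dominating z eta y -> False.
Proof. exact: decays_not_dominant. Qed.

Lemma dominating_exists : exists N, forall y, tsolves z y ->
  growing_part x y N.+1 = 1 -> decaying_part x y N.+1 = 0 -> dominating z 1 y.
Proof.
have [N hN] := dominant_start (asym_uu alpha beta x_neq0) (asym_uv alpha beta x_neq0)
  (asym_vu alpha beta x_neq0) (asym_vv alpha beta x_neq0) e_gt0 e_lt.
by exists N => y /sys hy; exact: hN.
Qed.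

(** Of the solutions with parts (1, 0) and (0, 1) at a late index, the first
    dominates; a multiple of it subtracted from the second leaves a decaying
    solution, which is not 0 because of its decaying part at that index. *)
Lemma minimal_exists : exists y,
  [/\ tsolves z y, decaying z y & (y 0%N, y 1%N) != 0].
Proof.
have [N hN] := dominating_exists.
have [s [hs sU sV]] := tail_solves_parts N 1 0 x_neq0.
have [t [ht tU tV]] := tail_solves_parts N 0 1 x_neq0.
have [l hl] := decaying_combination (asym_uu alpha beta x_neq0)
  (asym_uv alpha beta x_neq0)
  (asym_vu alpha beta x_neq0) (asym_vv alpha beta x_neq0) e_gt0 e_lt (sys hs) (sys ht) (hN s hs sU sV).
pose y n := 1 * t n + (- l) * s n.
have hy : tsolves z y by exact: tail_solvesZD.
exists y; split=> //.
  rewrite /decaying.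
  have -> : growing_part x y = fun n => growing_part x t n - l * growing_part x s n.
    by apply/funext => n; rewrite growing_partZD mul1r mulNr.
  have -> // : decaying_part x y = fun n => decaying_part x t n - l * decaying_part x s n.
  by apply/funext => n; rewrite decaying_partZD mul1r mulNr.
apply/negP => /eqP [y0 y1].
have z0 : tsolves z (fun=> 0) by move=> n; rewrite !mulr0 subr0.
have y00 := tail_solves_ext hy z0 y0 y1.
have : decaying_part x y N.+1 = 1.
  by rewrite decaying_partZD tV sV mulr0 mulr1 addr0.
rewrite /decaying_part /euler_diff !y00 subrr !mulr0 addr0 => /esym/eqP.
by rewrite oner_eq0.
Qed.

Lemma nondecaying_exists : exists y, tsolves z y /\ ~ decaying z y.
Proof.
have [N hN] := dominating_exists.
have [s [hs sU sV]] := tail_solves_parts N 1 0 x_neq0.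
exists s; split=> // ds; exact: not_decaying_dominating ds (hN s hs sU sV).
Qed.

(** Two independent decaying solutions would span every solution, dominating ones
    included. *)
Lemma minimal_unique y y' : tsolves z y -> tsolves z y' ->
  decaying z y -> decaying z y' -> y 0%N * y' 1%N = y 1%N * y' 0%N.
Proof.
move=> hy hy' dy dy'; apply/eqP; rewrite -subr_eq0; apply/negPn/negP => D0.
have [s [hs ds]] := nondecaying_exists; apply: ds.
set D := _ - _ in D0.
pose k := (s 0%N * y' 1%N - s 1%N * y' 0%N) / D.
pose l := (y 0%N * s 1%N - y 1%N * s 0%N) / D.
have <- : (fun n => k * y n + l * y' n) = s; last exact: decayingZD.
apply/funext; apply: (tail_solves_ext (tail_solvesZD k l hy hy') hs).
  by rewrite /k /l /D; field.
by rewrite /k /l /D; field.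
Qed.

Definition negligible_seq (A B : nat -> C) :=
  (\forall n \near \oo, B n != 0) /\ (A n / B n @[n --> \oo] --> (0 : C)).

Lemma negligible_weight (A B : nat -> C) (g w : nat -> R) (k l : R) : 0 < k ->
  (\forall n \near \oo, 0 < w n) -> g n @[n --> \oo] --> (0 : R) ->
  (\forall n \near \oo, cabs (A n) <= l * (g n * w n)) ->
  (\forall n \near \oo, k * w n <= cabs (B n)) -> negligible_seq A B.
Proof.
move=> k0 w0 g0 hA hB.
have B0 : \forall n \near \oo, B n != 0.
  near=> n; rewrite -cabs_gt0; have : k * w n <= cabs (B n) by near: n.
  by apply: lt_le_trans; rewrite mulr_gt0 //; near: n.
split=> //; apply: (cvg_cabs_le (g := fun n => l / k * g n)); last first.
  by rewrite -(mulr0 (l / k)); exact: cvgMr.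
near=> n; have Bn : B n != 0 by near: n.
have An : cabs (A n) <= l * (g n * w n) by near: n.
have kB : k * w n <= cabs (B n) by near: n.
have wn : 0 < w n by near: n.
rewrite subr0 cabsM cabsV ler_pdivrMr ?cabs_gt0 //; apply: le_trans An _.
have lg : 0 <= l * g n.
  have : 0 <= l * g n * w n by rewrite -mulrA; apply: le_trans (cabs_ge0 (A n)) _; near: n.
  by rewrite pmulr_lge0.
have -> : l / k * g n * cabs (B n) = l * g n * (cabs (B n) / k) by ring.
by rewrite mulrA ler_wpM2l // ler_pdivlMr // mulrC.
Unshelve. all: by end_near. Qed.

Lemma cabs_parts_y y n : cabs (y n) =
  (cabs (2 * x))^-1 * cabs (growing_part x y n - decaying_part x y n).
Proof. by rewrite {1}(parts_y y n x_neq0) cabsM cabsV mulrC. Qed.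

Lemma cabs_parts_h y n : cabs (euler_diff y n) = (cabs (2 * x))^-1 *
  cabs ((x - 1) * growing_part x y n + (1 + x) * decaying_part x y n).
Proof. by rewrite {1}(parts_h y n x_neq0) cabsM cabsV mulrC. Qed.

Lemma decays_near eta y y' : decaying z y -> dominating z eta y' ->
  exists2 g : nat -> R, g n @[n --> \oo] --> (0 : R) &
  \forall n \near \oo,
    [/\ cabs (y n) <= (cabs (2 * x))^-1 * 2 * (g n * cabs (growing_part x y' n)),
        cabs (euler_diff y n) <= (cabs (2 * x))^-1 * (cabs (x - 1) + cabs (1 + x)) *
                         (g n * cabs (growing_part x y' n)) &
        0 < cabs (growing_part x y' n)].
Proof.
move=> dy dom; have [g g0 hg] := decays_dominant e_gt0 e_lt dy dom; exists g => //.
have [N hN] := dom.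
have dn : \forall n \near \oo, growing_part x y' n != 0.
  by exists N.+1 => // n /hN [].
near=> n; have [] : cabs (growing_part x y n) <= g n * cabs (growing_part x y' n) /\
  cabs (decaying_part x y n) <= g n * cabs (growing_part x y' n) by near: n.
set w := g n * _ => hu hv.
split.
- rewrite (cabs_parts_y y) -mulrA ler_wpM2l ?invr_ge0 ?cabs_ge0 //.
  by apply: le_trans (cabsB _ _) _; lra.
- rewrite (cabs_parts_h y) -mulrA ler_wpM2l ?invr_ge0 ?cabs_ge0 //.
  apply: le_trans (cabsD _ _) _; rewrite !cabsM [leRHS]mulrDl.
  by apply: lerD; rewrite ler_wpM2l ?cabs_ge0.
- by rewrite cabs_gt0; near: n.
Unshelve. all: by end_near. Qed.

(** In the cone of opening 1 / 2, the growing part controls y from below. *)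
Lemma dominating_lower y : dominating z 2^-1 y -> \forall n \near \oo,
  (cabs (2 * x))^-1 * 2^-1 * cabs (growing_part x y n) <= cabs (y n).
Proof.
move=> [N hN]; exists N.+1 => // n /hN [_ hv _].
rewrite (cabs_parts_y y) -mulrA.
rewrite ler_wpM2l ?invr_ge0 ?cabs_ge0 //.
have := cabs_subge (growing_part x y n) (- decaying_part x y n); rewrite cabsN; lra.
Qed.

Lemma dominating_half y : tsolves z y -> ~ decaying z y -> dominating z 2^-1 y.
Proof.
move=> hy ndy; case: (@dichotomy_sol 2^-1 y _ _ hy) => //.
by rewrite invf_le1 // ler1n.
Qed.

Lemma inv_double_gt0 : 0 < (cabs (2 * x))^-1.
Proof. by rewrite invr_gt0 cabs_gt0 mulf_neq0 ?x_neq0 ?pnatr_eq0. Qed.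

Lemma minimal_negligible y y' : tsolves z y' -> decaying z y -> ~ decaying z y' ->
  negligible_seq y y'.
Proof.
move=> hy' dy ndy'; have dom := dominating_half hy' ndy'.
have [g g0 hg] := decays_near dy dom.
apply: (negligible_weight (k := (cabs (2 * x))^-1 * 2^-1) _ _ g0 _ (dominating_lower dom)).
- by rewrite mulr_gt0 ?inv_double_gt0.
- by apply: filterS hg => n [].
- by apply: filterS hg => n [h _ _]; exact: h.
Qed.

(** Up to a factor, this makes the terms of odd index of the first fraction out of
    those of even index. *)
Definition odd_part y (n : nat) : C := U n%:R * y n - V n%:R * y n.-1.

(** [upoly] and [vpoly] differ by a constant, since alpha, beta and
    - (alpha + beta) add up to 0. *)
Lemma odd_partE y n : (0 < n)%N -> odd_part y n =
  n%:R ^+ 2 * vratio alpha beta n * euler_diff y n -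
  alpha * beta * (alpha + beta) / 4 * y n.
Proof.
move=> n0; have h : (n%:R : C) != 0 by rewrite pnatr_eq0 -lt0n.
by rewrite /odd_part /euler_diff /vratio /upoly /vpoly; field.
Qed.

Lemma vratio_near : \forall n \near \oo,
  2^-1 <= cabs (vratio alpha beta n) <= 2.
Proof.
have [N hN] := asym_bound (asym_vratio alpha beta).
have [K K0 [M hM]] := asymP (asym_vratio alpha beta).
have [P hP] := nat_large K.
exists (maxn N (maxn M P)).+1 => // n /=; rewrite !gtn_max.
move=> /and3P[/[dup] Nn /hN -> /hM {}hM /hP {}hP].
have n1 : (1 : R) <= n%:R by rewrite ler1n (leq_ltn_trans _ Nn).
have n0 : (0 : R) < n%:R by apply: lt_le_trans n1.
rewrite mul0r subr0 in hM.
rewrite -(subrK 1 (vratio _ _ _)); apply: le_trans (cabsD _ _) _; rewrite cabs1.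
rewrite -[leRHS]/(1 + 1 : R) lerD2r; apply: le_trans hM _.
rewrite ler_pdivrMr ?exprn_gt0 // mul1r; apply: le_trans hP _.
exact: ler_eXnr.
Qed.

(** The leading term of [odd_part] carries the factor x - 1 = 2 z; a cone narrow
    enough with respect to |x - 1| keeps it away from 0. *)
Lemma minimal_negligible_odd y y' : z != 0 -> tsolves z y' -> decaying z y ->
  ~ decaying z y' -> negligible_seq (odd_part y) (odd_part y').
Proof.
move=> z0 hy' dy ndy'; set q := alpha * beta * (alpha + beta) / 4.
have q0 := cabs_ge0 q; have X0 := inv_double_gt0; set X := (cabs (2 * x))^-1 in X0.
have x1 : 0 < cabs (x - 1).
  by rewrite cabs_gt0 addrK mulf_neq0 ?pnatr_eq0.
(* narrow enough for the term in x - 1 to outweigh the other one in the Euler difference *)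
pose eta := cabs (x - 1) / (2 * (cabs (x - 1) + cabs (1 + x))).
have s0 : 0 < cabs (x - 1) + cabs (1 + x) by rewrite ltr_pwDl ?cabs_ge0.
have eta0 : 0 < eta by rewrite divr_gt0 // mulr_gt0.
have eta1 : eta <= 1.
  by rewrite ler_pdivrMr ?mulr_gt0 // mul1r; have := cabs_ge0 (1 + x); lra.
have [//|dom] := dichotomy_sol eta0 eta1 hy'.
have [g g0 hg] := decays_near dy dom.
have [P hP] := nat_large (16 * cabs q / cabs (x - 1)).
have Plarge : \forall n \near \oo, 16 * cabs q <= cabs (x - 1) * n%:R ^+ 2.
  exists P.+1 => // n /= Pn; have n1 : (1 : R) <= n%:R by rewrite ler1n (leq_ltn_trans _ Pn).
  rewrite [leRHS]mulrC -ler_pdivrMr //; apply: le_trans (hP n Pn) _; exact: ler_eXnr.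
have npos : \forall n \near \oo, (0 < n)%N by exists 1%N.
have cone : \forall n \near \oo, cabs (decaying_part x y' n) <= eta * cabs (growing_part x y' n).
  by have [N hN] := dom; exists N.+1 => // n /hN [].
have vr := vratio_near.
apply: (negligible_weight (k := X * cabs (x - 1) / 8)
  (l := 2 * (X * (cabs (x - 1) + cabs (1 + x))) + X * 2 * cabs q)
  (w := fun n => n%:R ^+ 2 * cabs (growing_part x y' n)) _ _ g0).
- by rewrite divr_gt0 // mulr_gt0.
- near=> n; have [_ _ u0] : [/\ cabs (y n) <= X * 2 * (g n * cabs (growing_part x y' n)),
        cabs (euler_diff y n) <= X * (cabs (x - 1) + cabs (1 + x)) *
                         (g n * cabs (growing_part x y' n)) &
        0 < cabs (growing_part x y' n)] by near: n.
  by rewrite mulr_gt0 // exprn_gt0 // ltr0n; near: n.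
- near=> n; have [hy hh u0] : [/\ cabs (y n) <= X * 2 * (g n * cabs (growing_part x y' n)),
        cabs (euler_diff y n) <= X * (cabs (x - 1) + cabs (1 + x)) *
                         (g n * cabs (growing_part x y' n)) &
        0 < cabs (growing_part x y' n)] by near: n.
  have n0 : (0 < n)%N by near: n.
  have n2 : (1 : R) <= n%:R ^+ 2 by rewrite -natrX ler1n expn_gt0 n0.
  have /andP[_ v2] : 2^-1 <= cabs (vratio alpha beta n) <= 2 by near: n.
  rewrite odd_partE // -/q [g n * (_ * _)]mulrCA; move: hy hh; set W := g n * _ => hy hh.
  have W0 : 0 <= W.
    have : 0 <= X * 2 * W by apply: le_trans hy; exact: cabs_ge0.
    by rewrite pmulr_rge0 // mulr_gt0.
  apply: le_trans (cabsB _ _) _.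
  rewrite (cabsM q) (cabsM (_ * _)) (cabsM (_ ^+ 2)) cabsX cabs_nat.
  have e1 : n%:R ^+ 2 * cabs (vratio alpha beta n) * cabs (euler_diff y n) <=
      n%:R ^+ 2 * 2 * (X * (cabs (x - 1) + cabs (1 + x)) * W).
    by rewrite ler_pM ?mulr_ge0 ?cabs_ge0 ?(le_trans ler01 n2) // ler_wpM2l // (le_trans ler01).
  have e2 : cabs q * cabs (y n) <= n%:R ^+ 2 * (cabs q * (X * 2 * W)).
    apply: le_trans (ler_wpM2l q0 hy) _; rewrite ler_peMl //.
    by apply: mulr_ge0 => //; apply: mulr_ge0 => //; rewrite mulr_ge0 // ltW.
  apply: le_trans (lerD e1 e2) _.
  by rewrite le_eqVlt; apply/orP; left; apply/eqP; ring.
- near=> n.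
  have n0 : (0 < n)%N by near: n.
  have /andP[v2 _] : 2^-1 <= cabs (vratio alpha beta n) <= 2 by near: n.
  have n2 : (1 : R) <= n%:R ^+ 2 by rewrite -natrX ler1n expn_gt0 n0.
  have Pn : 16 * cabs q <= cabs (x - 1) * n%:R ^+ 2 by near: n.
  have cn : cabs (decaying_part x y' n) <= eta * cabs (growing_part x y' n) by near: n.
  have U0 := cabs_ge0 (growing_part x y' n).
  rewrite odd_partE // -/q.
  have hlow : X * cabs (x - 1) / 2 * cabs (growing_part x y' n) <= cabs (euler_diff y' n).
    rewrite (cabs_parts_h y') -/X -!mulrA.
    rewrite ler_wpM2l ?(ltW X0) //; apply: le_trans (cabs_subge _ _).
    rewrite !cabsM.
    have : cabs (1 + x) * cabs (decaying_part x y' n) <=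
        cabs (x - 1) / 2 * cabs (growing_part x y' n).
      apply: le_trans (ler_wpM2l (cabs_ge0 _) cn) _; rewrite mulrA ler_wpM2r //.
      rewrite /eta mulrA ler_pdivrMr ?mulr_gt0 //.
      have := cabs_ge0 (1 + x); move: x1; move: (cabs (x - 1)) (cabs (1 + x)) => r s r0 s1.
      have : 0 <= r * r by rewrite mulr_ge0 // ltW.
      have : 0 <= r * s by rewrite mulr_ge0 // ltW.
      lra.
    lra.
  have yup : cabs (y' n) <= X * 2 * cabs (growing_part x y' n).
    rewrite (cabs_parts_y y') -/X -mulrA.
    rewrite ler_wpM2l ?(ltW X0) //; apply: le_trans (cabsB _ _) _.
    have := ler_wpM2r U0 eta1; lra.
  apply: le_trans (cabs_subge _ _); rewrite cabsN (cabsM q) (cabsM (_ * _)).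
  have e1 : n%:R ^+ 2 * 2^-1 * (X * cabs (x - 1) / 2 * cabs (growing_part x y' n)) <=
      cabs (n%:R ^+ 2 * vratio alpha beta n) * cabs (euler_diff y' n).
    rewrite cabsM cabsX cabs_nat.
    apply: ler_pM => //.
    - by rewrite mulr_ge0 // divr_ge0 // mulr_ge0 // ltW.
    - by rewrite ler_wpM2l // (le_trans ler01).
  have e2 := ler_wpM2l q0 yup.
  have XU : 0 <= X * cabs (growing_part x y' n) by rewrite mulr_ge0 // ltW.
  have e3 := ler_wpM2r XU Pn.
  move: e1 e2 e3; move: (cabs (_ * _)) (cabs (euler_diff _ _)) (cabs (y' n)) (cabs q) => p r s t.
  move: (cabs (growing_part x y' n)) (cabs (x - 1)) (n%:R ^+ 2) => u k m; lra.
Unshelve. all: by end_near. Qed.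

End Fixed.

(** Moving right multiplies by at most n^2, too little to turn a decaying solution
    into a dominating one. *)
Lemma shift_up_decaying z f : 3 * e < 2 * xi z -> solves alpha beta z f ->
  decaying z (fun n => f n.+1) ->
  decaying (z + 1) (fun n => shift_up alpha beta z f n.+1).
Proof.
move=> e_lt hf df; have x0 := x_neq0 e_lt.
have xiS : xi (z + 1) = xi z + 2.
  have -> : 2 * (z + 1) + 1 = 2 * z + 1 + 2%:R :> C by ring.
  by rewrite ReCD ReC_nat.
have e_lt' : 3 * e < 2 * xi (z + 1) by rewrite xiS; move: e_lt; lra.
have hf' := solves_tail (shift_up_solves hf).
have [//|] := pselect (decaying (z + 1) (fun n => shift_up alpha beta z f n.+1)).
move=> /(dominating_half e_lt' hf') dom; exfalso.
have low := dominating_lower e_lt' dom.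
have [K [N hK]] := df.
have [k [k0 [M hM]]] := dominant_lower e_gt0 dom.
have X0 := inv_double_gt0 e_lt; have X0' := inv_double_gt0 e_lt'.
set X := (cabs (2 * (2 * z + 1)))^-1 in X0; set X' := (cabs (2 * (2 * (z + 1) + 1)))^-1 in X0' low.
set s : R := - (1 + xi z - e) in hK.
(* the shift in terms of y and of its Euler difference *)
pose w := z + 1.
pose Q (n : nat) : C := 2 * w * n%:R ^+ 2 + 2 * w ^+ 2 * n%:R +
  (w ^+ 3 + esym2 alpha beta * w + alpha * beta * (alpha + beta) / 8 * (-1)).
have shiftE n : (0 < n)%N -> shift_up alpha beta z f n.+1 =
    n%:R ^+ 2 * vratio alpha beta n * euler_diff (fun n => f n.+1) n + Q n * f n.+1.
  move=> n0; rewrite shift_upS // /euler_diff; case: n n0 => // n _ /=.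
  have h : (n.+1%:R : C) != 0 by rewrite pnatr_eq0.
  by rewrite /Q /w /vratio /vpoly /esym2; field.
pose q := cabs (2 * w) + cabs (2 * w ^+ 2) +
  cabs (w ^+ 3 + esym2 alpha beta * w + alpha * beta * (alpha + beta) / 8 * (-1)).
have Qle n : (0 < n)%N -> cabs (Q n) <= q * n%:R ^+ 2.
  move=> n0; have n1 : (1 : R) <= n%:R by rewrite ler1n.
  apply: le_trans (cabsD _ _) _; rewrite [leRHS]mulrDl; apply: lerD; last first.
    by rewrite ler_peMr ?cabs_ge0 // expr_ge1.
  apply: le_trans (cabsD _ _) _; rewrite [leRHS]mulrDl; apply: lerD.
    by rewrite (cabsM (2 * w)) cabsX cabs_nat.
  rewrite (cabsM (2 * w ^+ 2)) cabs_nat ler_wpM2l ?cabs_ge0 //.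
  by rewrite ler_eXnr.
pose L := 2 * (X * (cabs (2 * z + 1 - 1) + cabs (1 + (2 * z + 1))) * K) + q * (X * 2 * K).
have h0 : npow (3 * e - 2 * xi z) n @[n --> \oo] --> (0 : R).
  by apply: npow_cvg0; rewrite subr_lt0.
have h1 : L * npow (3 * e - 2 * xi z) n @[n --> \oo] --> (0 : R).
  by rewrite -(mulr0 L); exact: cvgMr.
have kX : 0 < X' * 2^-1 * k by rewrite !mulr_gt0.
move/cvgrPdist_lt: h1 => /(_ _ kX) h1.
have vr := vratio_near.
have bigM : \forall n \near \oo, (M < n)%N by exists M.+1.
have bigN : \forall n \near \oo, (N < n)%N by exists N.+1.
have [n [h1n ln v2 Mn Nn]] : exists n, [/\
    `|0 - L * npow (3 * e - 2 * xi z) n| < X' * 2^-1 * k,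
    X' * 2^-1 * cabs (growing_part (2 * (z + 1) + 1) (fun n => shift_up alpha beta z f n.+1) n)
       <= cabs (shift_up alpha beta z f n.+1),
    2^-1 <= cabs (vratio alpha beta n) <= 2, (M < n)%N & (N < n)%N].
  by apply: (@filter_ex _ (nbhs \oo)); near=> n; split; near: n.
have n0 : (0 < n)%N by apply: leq_ltn_trans Mn.
have n1 : (1 : R) <= n%:R by rewrite ler1n.
have [hu hv] := hK n Nn.
set T := K * npow s n in hu hv.
have T0 : 0 <= T by apply: le_trans hu; exact: cabs_ge0.
have hy : cabs (f n.+1) <= X * 2 * T.
  rewrite (cabs_parts_y e_lt (fun n => f n.+1)) -mulrA ler_wpM2l ?(ltW X0) //.
  by apply: le_trans (cabsB _ _) _; lra.
have hh : cabs (euler_diff (fun n => f n.+1) n) <=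
    X * (cabs (2 * z + 1 - 1) + cabs (1 + (2 * z + 1))) * T.
  rewrite (cabs_parts_h e_lt (fun n => f n.+1)) -mulrA ler_wpM2l ?(ltW X0) //.
  apply: le_trans (cabsD _ _) _; rewrite !cabsM [leRHS]mulrDl.
  by apply: lerD; rewrite ler_wpM2l ?cabs_ge0.
have up : cabs (shift_up alpha beta z f n.+1) <= n%:R ^+ 2 * (L * npow s n).
  rewrite shiftE //; apply: le_trans (cabsD _ _) _.
  rewrite (cabsM (Q n)) (cabsM (_ * _)) (cabsM (_ ^+ 2)) cabsX cabs_nat.
  have e1 : n%:R ^+ 2 * cabs (vratio alpha beta n) * cabs (euler_diff (fun n => f n.+1) n) <=
      n%:R ^+ 2 * 2 * (X * (cabs (2 * z + 1 - 1) + cabs (1 + (2 * z + 1))) * T).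
    apply: ler_pM; rewrite ?cabs_ge0 //.
      by rewrite mulr_ge0 ?cabs_ge0 // exprn_ge0.
    by rewrite ler_wpM2l ?exprn_ge0 //; case/andP: v2.
  have e2 : cabs (Q n) * cabs (f n.+1) <= q * n%:R ^+ 2 * (X * 2 * T).
    by rewrite ler_pM ?cabs_ge0 ?Qle.
  apply: le_trans (lerD e1 e2) _.
  by rewrite le_eqVlt /L /T; apply/orP; left; apply/eqP; ring.
have c0 : 0 <= X' * 2^-1 by rewrite mulr_ge0 // ltW.
have := le_trans (le_trans (ler_wpM2l c0 (hM n Mn)) ln) up.
have -> : n%:R ^+ 2 * (L * npow s n) =
    L * (npow (3 * e - 2 * xi z) n * npow (xi (z + 1) - 1 - 2 * e) n).
  have <- : npow 2%:R n * npow s n =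
      npow (3 * e - 2 * xi z) n * npow (xi (z + 1) - 1 - 2 * e) n.
    rewrite -!npowD; rewrite xiS /s; congr (npow _ n); ring.
  by rewrite npow_nat //; ring.
rewrite !mulrA ler_pM2r ?npow_gt0 // => hL.
move: h1n; rewrite sub0r normrN => h1n.
have := le_lt_trans (le_trans hL (ler_norm _)) h1n; by rewrite ltxx.
Unshelve. all: by end_near. Qed.

End MinimalSolutions.

(** * Continuants and approximants *)

Section Continuants.
Local Open Scope classical_set_scope.
Variable R : realType.
Local Notation C := R[i].
Implicit Types (p q : C).

Lemma pt_fin p : pt p 1 = Some p :> sphere R.
Proof. by rewrite /pt oner_eq0 divr1. Qed.

Lemma addh_pt (s : C) p q : addh s (pt p q) = pt (s * q + p) q.
Proof.
rewrite /pt; case: eqP => //= /eqP q0; congr Some.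
by rewrite mulrDl mulfK.
Qed.

Lemma divh_pt (s : C) p q : s != 0 -> (p, q) != 0 ->
  divh (Some s) (pt p q) = pt (s * q) p.
Proof.
rewrite xpair_eqE negb_and /pt => s0; case: (eqVneq q 0) => [-> | q0] pq /=.
  by move: pq; rewrite orbF => p0; rewrite (negbTE p0) mulr0 mul0r.
rewrite (negbTE s0) mulf_eq0 invr_eq0 (negbTE q0) orbF; case: eqP => // /eqP p0.
by congr Some; rewrite invfM invrK mulrA mulrAC.
Qed.

Lemma divh0 (w : sphere R) : divh (Some 0) w = Some 0.
Proof. by case: w => [v|] //=; rewrite eqxx. Qed.

Variables a b : nat -> C.

(** The continuant of the [n] partial denominators that start with [b k]. *)
Fixpoint continuant (k n : nat) : C :=
  if n is n1.+1 then
    if n1 is n2.+1 then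
      b k * continuant k.+1 n1 + a k.+1 * continuant k.+2 n2
    else b k
  else 1.

Lemma continuantSS k n : continuant k n.+2 =
  b k * continuant k.+1 n.+1 + a k.+1 * continuant k.+2 n.
Proof. by []. Qed.

(** Euler's symmetry of continuants trades the recursion from the front, which is
    that of the fraction, for a recurrence in n. *)
Lemma continuant_fwd k n : continuant k n.+2 =
  b (k + n.+1)%N * continuant k n.+1 + a (k + n.+1)%N * continuant k n.
Proof.
move: k; suff: (forall k, continuant k n.+2 =
    b (k + n.+1)%N * continuant k n.+1 + a (k + n.+1)%N * continuant k n) /\
  (forall k, continuant k n.+3 =
    b (k + n.+2)%N * continuant k n.+2 + a (k + n.+2)%N * continuant k n.+1).
  by case.
elim: n => [|n [IH IHS]].
  by split=> k /=; rewrite ?addn1 ?addn2; ring.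
split=> // k; rewrite continuantSS (IHS k.+1) (IH k.+2) (continuantSS k n.+1).
rewrite (continuantSS k n) !addnS !addSn; ring.
Qed.

(** With nonzero partial numerators the two coordinates never vanish together, so
    that the formula holds on the sphere without exception. *)
Lemma cfrac_tailE k n : (forall i, (i <= n)%N -> a (k + i)%N != 0) ->
  cfrac_tail a b k n.+1 = pt (a k * continuant k.+1 n) (continuant k n.+1) /\
  (continuant k.+1 n, continuant k n.+1) != 0.
Proof.
elim: n k => [|n IH] k ha.
  have ak : a k != 0 by have := ha 0%N isT; rewrite addn0.
  have p1 : (b k + 0, 1 : C) != 0 by rewrite xpair_eqE oner_eq0 andbF.
  split; last by rewrite xpair_eqE oner_eq0.
  by rewrite -[LHS]/(divh _ (Some (b k + 0))) -(pt_fin (b k + 0)) divh_pt // addr0.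
have ak : a k != 0 by have := ha 0%N isT; rewrite addn0.
have ak1 : a k.+1 != 0 by have := ha 1%N isT; rewrite addn1.
have [e ne] : cfrac_tail a b k.+1 n.+1 =
    pt (a k.+1 * continuant k.+2 n) (continuant k.+1 n.+1) /\
    (continuant k.+2 n, continuant k.+1 n.+1) != 0.
  by apply: IH => i ni; rewrite addSnnS ha.
have ne' : (continuant k n.+2, continuant k.+1 n.+1) != 0.
  rewrite continuantSS; apply: contra ne; rewrite !xpair_eqE => /andP[e1 /eqP e2].
  by move: e1; rewrite e2 mulr0 add0r mulf_eq0 (negbTE ak1) /= eqxx andbT.
split; last by move: ne'; rewrite !xpair_eqE andbC.
by rewrite -[LHS]/(divh _ (addh _ (cfrac_tail a b k.+1 n.+1))) e addh_pt divh_pt -?continuantSS.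
Qed.

(** Numerators and denominators of the approximants, those of order -1 coming
    first. *)
Definition cnum n := continuant 0 n.
Definition cdenom n := if n is n'.+1 then continuant 1 n' else 0.

Definition recurs (s : nat -> C) := forall n, s n.+2 = b n.+1 * s n.+1 + a n.+1 * s n.

Lemma cnum_recurs : recurs cnum.
Proof. by move=> n; rewrite /cnum continuant_fwd. Qed.

Lemma cdenom_recurs : recurs cdenom.
Proof.
by move=> [|n]; rewrite /cdenom; [rewrite /= mulr1 mulr0 addr0|rewrite continuant_fwd].
Qed.

Lemma approximantE n : (forall i, (0 < i <= n)%N -> a i != 0) ->
  approximant a b n = pt (cnum n.+1) (cdenom n.+1) /\ (cnum n.+1, cdenom n.+1) != 0.
Proof.
case: n => [_|n ha].
  by split; rewrite ?xpair_eqE ?oner_eq0 ?andbF //= /approximant /= pt_fin addr0.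
have [e ne] : cfrac_tail a b 1 n.+1 = pt (a 1%N * continuant 2 n) (continuant 1 n.+1) /\
    (continuant 2 n, continuant 1 n.+1) != 0.
  by apply: cfrac_tailE => i ni; apply: ha; rewrite add1n.
split; first by rewrite /approximant e addh_pt.
apply: contra ne; rewrite /cnum /cdenom continuantSS !xpair_eqE => /andP[e1 /eqP e2].
by move: e1; rewrite e2 mulr0 add0r mulf_eq0 (negbTE (ha 1%N isT)) /= eqxx andbT.
Qed.

Lemma cfrac_tail_stop k m n : a (k + m)%N = 0 -> (m <= n)%N ->
  cfrac_tail a b k n = cfrac_tail a b k m.
Proof.
elim: m k n => [|m IH] k [|n] //.
  by rewrite addn0 => a0 _; rewrite -[LHS]/(divh (Some (a k)) _) a0 divh0.
rewrite addnS -addSn => ha mn.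
by rewrite -[LHS]/(divh _ (addh _ (cfrac_tail a b k.+1 n))) (IH k.+1 n).
Qed.

Lemma approximant_stop n m : a m.+1 = 0 -> (m <= n)%N ->
  approximant a b n = approximant a b m.
Proof. by move=> ha mn; rewrite /approximant (cfrac_tail_stop (m := m)). Qed.

Lemma approximant_stop_cvg m : a m.+1 = 0 ->
  approximant a b n @[n --> \oo] --> approximant a b m.
Proof.
move=> ha; apply: cvg_near_cst; exists m => // n /= mn.
exact: approximant_stop.
Qed.

End Continuants.

(** * Limits of quotients on the sphere *)

Section SphereLimits.
Local Open Scope classical_set_scope.
Variable R : realType.
Local Notation C := R[i].

(** Pincherle's mechanism: when a combination of A and B is negligible, A / B tends
    to the value that cancels it. *)
Lemma cvg_pt_negligible (A B M : nat -> C) (m0 m1 : C) : (m0, m1) != 0 ->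
  (forall n, M n = m0 * A n + m1 * B n) ->
  (m0 != 0 -> negligible_seq M B) -> (m0 = 0 -> negligible_seq M A) ->
  pt (A n) (B n) @[n --> \oo] --> pt (- m1) m0.
Proof.
move=> m01 hM hB hA; case: (eqVneq m0 0) => [m00|m00].
  have m10 : m1 != 0 by move: m01; rewrite m00 xpair_eqE eqxx.
  have [A0 MA] := hA m00.
  have -> : pt (- m1) m0 = pt 1 0.
    apply: pt_eq; rewrite ?xpair_eqE ?oner_eq0 //.
      by rewrite oppr_eq0 (negbTE m10).
    by rewrite m00 mulr0 mul0r.
  have h : pt (1 : C) (M n / A n / m1) @[n --> \oo] --> pt (1 : C) 0.
    apply: cvg_pt; first by rewrite xpair_eqE oner_eq0.
      exact: cvg_cst.
    by rewrite -(mul0r m1^-1); apply: (cvgM MA (cvg_cst _)).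
  move=> W nW; apply: filterS2 A0 (h W nW) => n An /=.
  rewrite -(ptZ 1 _ An) mulr1 (_ : A n * _ = B n) //.
  by rewrite hM m00; field; rewrite ?An ?m10.
have [B0 MB] := hB m00.
have -> : pt (- m1) m0 = pt (- m1 / m0) 1.
  apply: pt_eq; rewrite ?xpair_eqE ?oner_eq0 ?andbF //.
    by rewrite (negbTE m00) andbF.
  by field.
have h : pt (M n / B n / m0 - m1 / m0) 1 @[n --> \oo] --> pt (- m1 / m0) (1 : C).
  apply: cvg_pt; [by rewrite xpair_eqE oner_eq0 andbF| |exact: cvg_cst].
  have -> : - m1 / m0 = 0 * m0^-1 - m1 / m0 by rewrite mul0r sub0r mulNr.
  by apply: cvgB; [apply: (cvgM MB (cvg_cst _))|exact: cvg_cst].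
move=> W nW; apply: filterS2 B0 (h W nW) => n Bn /=.
rewrite -(ptZ _ 1 Bn) mulr1 (_ : B n * _ = A n) //.
by rewrite hM; field; rewrite ?Bn ?m00.
Qed.

Lemma cvg_even_odd (T : topologicalType) (s : nat -> T) (l : T) :
  s n.*2 @[n --> \oo] --> l -> s n.*2.+1 @[n --> \oo] --> l ->
  s n @[n --> \oo] --> l.
Proof.
move=> h0 h1 A nA; have [N0 _ hN0] := h0 A nA; have [N1 _ hN1] := h1 A nA.
exists (maxn N0 N1).*2.+1 => // n /= hn; rewrite -(odd_double_half n).
have hh : (maxn N0 N1 <= n./2)%N.
  by rewrite -(doubleK (maxn N0 N1)) half_leq // ltnW.
move: hh; rewrite geq_max => /andP[n0 n1].
by case: (odd n); [exact: hN1|exact: hN0].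
Qed.

End SphereLimits.

(** * The two continued fractions *)

Section Fractions.
Local Open Scope classical_set_scope.
Local Open Scope complex_scope.
Variable R : realType.
Local Notation C := R[i].
Variables alpha beta x : C.
Local Notation U := (upoly alpha beta).
Local Notation V := (vpoly alpha beta).
Local Notation z := ((x - 1) / 2).
Local Notation a1 := (acoef alpha beta).
Local Notation b1 := (bcoef alpha beta x).
Local Notation a2 := (kappa alpha beta).
Local Notation b2 := (fun m => x ^+ 2 + lambda alpha beta m).

Lemma double_add1_neq0 n : (2 * n%:R + 1 : C) != 0.
Proof. by rewrite -natrM natr1 pnatr_eq0. Qed.

Lemma double_add3_neq0 n : (2 * n%:R + 3 : C) != 0.
Proof. by rewrite -natrM -natrD pnatr_eq0 addn3. Qed.

Lemma kappaS n : a2 n.+1 =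
  - (4 * U n.+1%:R * V n.+1%:R) / ((2 * n%:R + 1) * (2 * n%:R + 3)).
Proof.
rewrite /kappa /upoly /vpoly -natr1; have h := double_add1_neq0 n; have h' := double_add3_neq0 n.
by field; rewrite ?h ?h'.
Qed.

Lemma acoef_even n : a1 n.*2 = 2 * U n%:R.
Proof. by rewrite /acoef odd_double uphalf_double /upoly; field. Qed.

Lemma acoef_odd n : a1 n.*2.+1 = 2 * V n.+1%:R.
Proof.
rewrite /acoef /= odd_double /= doubleK /vpoly; by field.
Qed.

Lemma bcoef_odd n : b1 n.*2.+1 = 1.
Proof. by rewrite /bcoef /= odd_double. Qed.

Lemma bcoef_even n : b1 n.+1.*2 = (x ^+ 2 - 1) * (2 * n%:R + 3).
Proof. by rewrite /bcoef odd_double doubleK /= -natr1; congr (_ * _); ring. Qed.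

Lemma midcoef_lambda n : midcoef alpha beta z n = (n%:R + 2^-1) * b2 n.
Proof. by rewrite midcoefE; congr (_ * (_ + _)); field. Qed.

(** Eliminating the terms of odd index from the first fraction leaves the
    recurrence of the second one, up to a product of odd numbers. *)
Lemma first_even (s t : nat -> C) : recurs a1 b1 s -> recurs a2 b2 t ->
  s 0%N = t 0%N -> s 2 = t 1%N ->
  forall n, s n.*2 = (\prod_(k < n) (2 * k%:R + 1)) * t n.
Proof.
move=> hs ht e0 e1.
have ev n : s n.+2.*2 = s n.+1.*2.+1 + a1 n.+1.*2.+1 * s n.+1.*2.
  by rewrite !doubleS hs -!doubleS bcoef_odd mul1r.
have od n : s n.+1.*2.+1 = b1 n.+1.*2 * s n.+1.*2 + a1 n.+1.*2 * s n.*2.+1.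
  by rewrite !doubleS hs -!doubleS.
have pr n : s n.*2.+1 = s n.+1.*2 - a1 n.*2.+1 * s n.*2.
  by rewrite !doubleS hs bcoef_odd mul1r addrK.
move=> n; suff [] : s n.*2 = (\prod_(k < n) (2 * k%:R + 1)) * t n /\
  s n.+1.*2 = (\prod_(k < n.+1) (2 * k%:R + 1)) * t n.+1 by [].
elim: n => [|n [IH IHS]].
  by rewrite big_ord0 big_ord1 mulr0 add0r !mul1r e0 e1.
split=> //; rewrite ev od pr IHS IH ht !big_ord_recr /= bcoef_even.
rewrite acoef_even !acoef_odd kappaS /lambda /upoly /vpoly -!natr1.
have h := double_add1_neq0 n; have h' := double_add3_neq0 n.
move: (\prod_(_ < n) _) (n%:R : C) (t n) (t n.+1) h h' => P m t0 t1 h h'.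
by field; rewrite ?h ?h'.
Qed.

Lemma first_odd (s : nat -> C) : recurs a1 b1 s ->
  forall n, s n.*2.+1 = s n.+1.*2 - a1 n.*2.+1 * s n.*2.
Proof. by move=> hs n; rewrite !doubleS hs bcoef_odd mul1r addrK. Qed.

Lemma cnum_even n : cnum a1 b1 n.*2 = (\prod_(k < n) (2 * k%:R + 1)) * cnum a2 b2 n.
Proof.
apply: first_even n; [exact: cnum_recurs|exact: cnum_recurs|by []|].
rewrite /cnum /= !mulr1 (acoef_odd 0) /bcoef /numerator0 /lambda /vpoly /=; by field.
Qed.

Lemma cdenom_even n : cdenom a1 b1 n.*2 = (\prod_(k < n) (2 * k%:R + 1)) * cdenom a2 b2 n.
Proof.
apply: first_even n; [exact: cdenom_recurs|exact: cdenom_recurs|by []|by []].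
Qed.

Lemma prod_odd_neq0 n : (\prod_(k < n) (2 * k%:R + 1) : C) != 0.
Proof. by apply/prodf_neq0 => k _; exact: double_add1_neq0. Qed.

Lemma pt_even n : pt (cnum a1 b1 n.*2) (cdenom a1 b1 n.*2) =
  pt (cnum a2 b2 n) (cdenom a2 b2 n).
Proof. by rewrite cnum_even cdenom_even ptZ ?prod_odd_neq0. Qed.

(** The second fraction stops at its numerator of index m + 1, the first one at that
    of index 2 m + 1 or 2 m + 2, according to which of [vpoly] and [upoly] vanishes
    at m + 1.  In the first case the terms of index 2 m + 1 and 2 m + 2 of [cnum]
    and [cdenom] coincide, so that the even part is what counts in both. *)
Lemma stopped_fractions m : U m.+1%:R * V m.+1%:R = 0 ->
  (forall i, (0 < i <= m)%N -> U i%:R * V i%:R != 0) ->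
  let w := pt (cnum a2 b2 m.+1) (cdenom a2 b2 m.+1) in
  [/\ (cnum a2 b2 m.+1, cdenom a2 b2 m.+1) != 0,
      approximant a1 b1 n @[n --> \oo] --> w &
      approximant a2 b2 n @[n --> \oo] --> w].
Proof.
move=> UV0 UV w.
have k0 i : (0 < i <= m)%N -> a2 i != 0.
  case: i => // i /UV; rewrite kappaS => uv; apply: mulf_neq0.
    by rewrite oppr_eq0 -mulrA; apply: mulf_neq0 uv; rewrite pnatr_eq0.
  by rewrite invr_eq0; apply: mulf_neq0; [exact: double_add1_neq0|exact: double_add3_neq0].
have U0 i : (0 < i <= m)%N -> a1 i.*2 != 0.
  by move=> /UV; rewrite mulf_eq0 negb_or acoef_even => /andP[u _]; rewrite mulf_neq0 ?pnatr_eq0.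
have V0 i : (i < m)%N -> a1 i.*2.+1 != 0.
  move=> im; have := UV i.+1 im; rewrite mulf_eq0 negb_or acoef_odd => /andP[_ v].
  by rewrite mulf_neq0 ?pnatr_eq0.
have a0 i : (0 < i <= m.*2)%N -> a1 i != 0.
  rewrite -(odd_double_half i); case: (odd i) => /=; rewrite ?add1n ?add0n.
    by rewrite ltn_double => /V0.
  by rewrite double_gt0 leq_double => /U0.
have [e2 ne2] := approximantE b2 k0.
split=> //; last first.
  rewrite /w -e2; apply: approximant_stop_cvg.
  by rewrite kappaS -mulrA UV0 mulr0 oppr0 mul0r.
rewrite /w -pt_even.
case: (eqVneq (V m.+1%:R) 0) => v0.
  have [e _] := approximantE b1 a0.
  have vz : a1 m.*2.+1 = 0 by rewrite acoef_odd v0 mulr0.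
  have same s : recurs a1 b1 s -> s m.+1.*2 = s m.*2.+1.
    by move=> /first_odd ->; rewrite vz mul0r subr0.
  rewrite (same _ (cnum_recurs a1 b1)) (same _ (cdenom_recurs a1 b1)) -e.
  exact: approximant_stop_cvg.
have u0 : U m.+1%:R = 0 by apply/eqP; move/eqP: UV0; rewrite mulf_eq0 (negbTE v0) orbF.
have a0' i : (0 < i <= m.*2.+1)%N -> a1 i != 0.
  rewrite [(i <= _)%N]leq_eqVlt => /andP[i0 /predU1P[->|im]].
    by rewrite acoef_odd mulf_neq0 ?pnatr_eq0.
  by apply: a0; rewrite i0.
have [e _] := approximantE b1 a0'.
rewrite doubleS -e; apply: approximant_stop_cvg.
by rewrite -doubleS acoef_even u0 mulr0.
Qed.

(** Dividing by these factors turns the recurrence of the second fraction into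
    that of [solves]. *)
Definition fraction_scale (n : nat) : C := \prod_(k < n) (2 * U k.+1%:R / (2 * k%:R + 1)).

Lemma fraction_scaleS n : fraction_scale n.+1 = fraction_scale n * (2 * U n.+1%:R / (2 * n%:R + 1)).
Proof. by rewrite /fraction_scale big_ord_recr. Qed.

(** Stated at one index, because the factors vanish beyond a zero of [upoly]. *)
Lemma recurs_solves_at (s : nat -> C) n : recurs a2 b2 s ->
  fraction_scale n.+1 != 0 -> U n.+2%:R != 0 \/ s n.+2 = 0 ->
  U n.+2%:R * (s n.+2 / fraction_scale n.+2) =
  midcoef alpha beta z n.+1 * (s n.+1 / fraction_scale n.+1) - V n.+1%:R * (s n / fraction_scale n).
Proof.
move=> hs f1 hu.
have : fraction_scale n != 0 /\ U n.+1%:R != 0.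
  move: f1; rewrite fraction_scaleS mulf_eq0 negb_or => /andP[f0].
  by rewrite !mulf_eq0 !negb_or => /andP[/andP[_ u0] _].
move=> [f0 u0].
have -> : U n.+2%:R * (s n.+2 / fraction_scale n.+2) =
    (2 * n%:R + 3) / 2 * (s n.+2 / fraction_scale n.+1).
  case: hu => [u1|->]; last by rewrite !mul0r !mulr0.
  rewrite (fraction_scaleS n.+1).
  have -> : 2 * n.+1%:R + 1 = 2 * n%:R + 3 :> C by rewrite -(natr1 n); ring.
  have := double_add3_neq0 n; move: (U _) (fraction_scale _) u1 f1 (2 * n%:R + 3) => u f u1 f1 h h0.
  by field; rewrite ?u1 ?f1 ?h0.
rewrite hs kappaS midcoef_lambda fraction_scaleS.
have -> : n.+1%:R + 2^-1 = (2 * n%:R + 3) / 2 :> C by rewrite -(natr1 n); field.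
have := double_add1_neq0 n; have := double_add3_neq0 n.
move: (U n.+1%:R) (V _) (fraction_scale n) u0 f0 (n%:R : C) => u v f u0 f0 m h h'.
by field; rewrite ?u0 ?f0 ?h ?h'.
Qed.

Section Regular.
Hypothesis U_neq0 : forall n, (0 < n)%N -> U n%:R != 0.
Hypothesis V_neq0 : forall n, (0 < n)%N -> V n%:R != 0.

Lemma fraction_scale_neq0 n : fraction_scale n != 0.
Proof.
apply/prodf_neq0 => k _; rewrite mulf_neq0 ?invr_eq0 ?double_add1_neq0 //.
by rewrite mulf_neq0 ?pnatr_eq0 ?U_neq0.
Qed.

Lemma recurs_tail_solves (s : nat -> C) : recurs a2 b2 s ->
  tail_solves alpha beta z (fun n => s n / fraction_scale n).
Proof.
move=> hs n; apply: recurs_solves_at => //; first exact: fraction_scale_neq0.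
by left; apply: U_neq0.
Qed.

(** Pincherle's theorem: the values of both fractions are read on the minimal
    solution M, where m1 plays the part of the term that precedes [M 0]. *)
Lemma regular_fractions : 0 < complex.Re x -> exists M : nat -> C, exists m1 : C,
  [/\ tail_solves alpha beta z M, decaying (complex.Re x / 2) z M,
     M 1%N * (2 * U 1) = (x ^+ 2 + lambda alpha beta 0) * M 0%N + m1,
     (M 0%N, m1) != 0 &
     approximant a2 b2 n @[n --> \oo] --> pt (- m1) (M 0%N) /\
     (x != 1 -> approximant a1 b1 n @[n --> \oo] --> pt (- m1) (M 0%N))].
Proof.
move=> x0; have zx : 2 * z + 1 = x by field.
have e0 : 0 < complex.Re x / 2 by rewrite divr_gt0.
have e1 : 3 * (complex.Re x / 2) < 2 * complex.Re (2 * z + 1) by rewrite zx; lra.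
have [M [hM dM M0]] := minimal_exists U_neq0 V_neq0 e0 e1.
pose m1 := M 1%N * (2 * U 1) - (x ^+ 2 + lambda alpha beta 0) * M 0%N.
have u1 : 2 * U 1 != 0 by rewrite mulf_neq0 ?pnatr_eq0 // (U_neq0 (ltn0Sn 0)).
have m01 : (M 0%N, m1) != 0.
  apply: contra M0; rewrite !xpair_eqE => /andP[/eqP h0 /eqP h1]; rewrite h0 eqxx /=.
  by move: h1; rewrite /m1 h0 mulr0 subr0 => /eqP; rewrite mulf_eq0 (negbTE u1) orbF.
pose yA n := cnum a2 b2 n / fraction_scale n; pose yB n := cdenom a2 b2 n / fraction_scale n.
have hA : tail_solves alpha beta z yA by exact/recurs_tail_solves/cnum_recurs.
have hB : tail_solves alpha beta z yB by exact/recurs_tail_solves/cdenom_recurs.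
have s0 : fraction_scale 0 = 1 by rewrite /fraction_scale big_ord0.
have s1 : fraction_scale 1 = 2 * U 1 by rewrite fraction_scaleS s0 mul1r mulr0 add0r divr1.
have A0 : yA 0%N = 1 by rewrite /yA s0 divr1.
have A1 : yA 1%N = (x ^+ 2 + lambda alpha beta 0) / (2 * U 1) by rewrite /yA s1.
have B0 : yB 0%N = 0 by rewrite /yB mul0r.
have B1 : yB 1%N = (2 * U 1)^-1 by rewrite /yB s1 mul1r.
have ME n : M n = M 0%N * yA n + m1 * yB n.
  apply: (tail_solves_ext U_neq0 hM (tail_solvesZD (M 0%N) m1 hA hB)) => //.
    by rewrite A0 B0 mulr1 mulr0 addr0.
  by rewrite A1 B1 /m1 mulrBl mulfK // mulrCA mulrA addrC subrK.
have ndB : M 0%N != 0 -> ~ decaying (complex.Re x / 2) z yB.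
  move=> M00 dB; have := minimal_unique U_neq0 V_neq0 e0 e1 hM hB dM dB.
  by rewrite B0 B1 mulr0 => /eqP; rewrite mulf_eq0 (negbTE M00) invr_eq0 (negbTE u1).
have ndA : M 0%N = 0 -> ~ decaying (complex.Re x / 2) z yA.
  move=> M00 dA; have := minimal_unique U_neq0 V_neq0 e0 e1 hM hA dM dA.
  rewrite A0 M00 mul0r mulr1 => /esym M10; move: M0; rewrite M00 M10.
  by rewrite xpair_eqE eqxx.
have lim_even : pt (cnum a2 b2 n) (cdenom a2 b2 n) @[n --> \oo] --> pt (- m1) (M 0%N).
  have -> : (fun n => pt (cnum a2 b2 n) (cdenom a2 b2 n)) = (fun n => pt (yA n) (yB n)).
    apply/funext => n; rewrite -(ptZ (yA n) (yB n) (fraction_scale_neq0 n)) /yA /yB.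
    by rewrite !(mulrCA (fraction_scale n)) !divff ?fraction_scale_neq0 ?mulr1.
  apply: cvg_pt_negligible m01 ME _ _ => h.
    exact: (minimal_negligible U_neq0 e0 e1 hB dM (ndB h)).
  exact: (minimal_negligible U_neq0 e0 e1 hA dM (ndA h)).
have a20 n i : (0 < i <= n)%N -> a2 i != 0.
  case: i => // i _; rewrite kappaS; apply: mulf_neq0.
    rewrite oppr_eq0; apply: mulf_neq0 (V_neq0 (ltn0Sn i)).
    by apply: mulf_neq0 (U_neq0 (ltn0Sn i)); rewrite pnatr_eq0.
  by rewrite invr_eq0; apply: mulf_neq0; [exact: double_add1_neq0|exact: double_add3_neq0].
have a10 n i : (0 < i <= n)%N -> a1 i != 0.
  case/andP; rewrite -(odd_double_half i).
  case: (odd i) => /=; rewrite ?add1n ?add0n => i0 _.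
    by rewrite acoef_odd mulf_neq0 ?pnatr_eq0 ?V_neq0.
  rewrite acoef_even; apply: mulf_neq0; first by rewrite pnatr_eq0.
  by apply: U_neq0; rewrite -double_gt0.
have app1 n : approximant a1 b1 n = pt (cnum a1 b1 n.+1) (cdenom a1 b1 n.+1).
  by have [] := approximantE b1 (a10 n).
have app2 n : approximant a2 b2 n = pt (cnum a2 b2 n.+1) (cdenom a2 b2 n.+1).
  by have [] := approximantE b2 (a20 n).
have lim_evenS : pt (cnum a2 b2 n.+1) (cdenom a2 b2 n.+1) @[n --> \oo] -->
    pt (- m1) (M 0%N).
  by move: lim_even; rewrite -(cvg_shiftS (fun n => pt (cnum a2 b2 n) (cdenom a2 b2 n))).
exists M, m1; split=> //; first by rewrite /m1 addrC subrK.
split; first by under eq_fun do rewrite app2.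
move=> x1.
have z0 : z != 0 by rewrite mulf_neq0 ?subr_eq0 // invr_eq0 pnatr_eq0.
have lim_odd : pt (odd_part alpha beta yA n) (odd_part alpha beta yB n) @[n --> \oo]
    --> pt (- m1) (M 0%N).
  apply: (cvg_pt_negligible m01 (M := odd_part alpha beta M)) => [n|h|h].
  - by rewrite /odd_part (ME n) (ME n.-1); ring.
  - exact: (minimal_negligible_odd U_neq0 e0 e1 z0 hB dM (ndB h)).
  - exact: (minimal_negligible_odd U_neq0 e0 e1 z0 hA dM (ndA h)).
have odd_pt n : pt (cnum a1 b1 n.*2.+1) (cdenom a1 b1 n.*2.+1) =
    pt (odd_part alpha beta yA n.+1) (odd_part alpha beta yB n.+1).
  pose G := (\prod_(k < n) (2 * k%:R + 1)) * fraction_scale n * 2.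
  have G0 : G != 0 by rewrite !mulf_neq0 ?prod_odd_neq0 ?fraction_scale_neq0 ?pnatr_eq0.
  have key s : s n.*2.+1 = s n.+1.*2 - a1 n.*2.+1 * s n.*2 -> forall t : nat -> C,
      (forall k, s k.*2 = (\prod_(k < k) (2 * k%:R + 1)) * t k) ->
      s n.*2.+1 = G * odd_part alpha beta (fun n => t n / fraction_scale n) n.+1.
    move=> -> t ht; rewrite !ht big_ord_recr /= acoef_odd /odd_part /= fraction_scaleS /G.
    have := fraction_scale_neq0 n; have := U_neq0 (ltn0Sn n); have := double_add1_neq0 n.
    move: (U _) (V _) (fraction_scale n) (\prod_(_ < n) _) (2 * n%:R + 1) => u v f p h h0 u0 f0.
    field; by rewrite ?h0 ?u0 ?f0.
  rewrite (key _ (first_odd (cnum_recurs a1 b1) n) _ cnum_even).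
  by rewrite (key _ (first_odd (cdenom_recurs a1 b1) n) _ cdenom_even) ptZ.
have -> : (fun n => approximant a1 b1 n) =
    (fun n => pt (cnum a1 b1 n.+1) (cdenom a1 b1 n.+1)) by apply/funext.
apply: cvg_even_odd.
  under eq_fun do rewrite odd_pt.
  by move: lim_odd;
    rewrite -(cvg_shiftS (fun n => pt (odd_part alpha beta yA n) (odd_part alpha beta yB n))).
have -> : (fun n => pt (cnum a1 b1 n.*2.+2) (cdenom a1 b1 n.*2.+2)) =
   (fun n => pt (cnum a2 b2 n.+1) (cdenom a2 b2 n.+1)).
  by apply/funext => n; rewrite -doubleS pt_even.
exact: lim_evenS.
Qed.

End Regular.
End Fractions.

(** * The Gamma quotient *)

Section GammaSide.
Local Open Scope classical_set_scope.
Local Open Scope complex_scope.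
Variable R : realType.
Local Notation C := R[i].

Lemma mulh_pt (a b c d : C) : mulh (pt a b) (pt c d) = pt (a * c) (b * d).
Proof.
rewrite /pt mulf_eq0; case: eqP => //= _; case: eqP => //= _.
by congr Some; rewrite mulf_div.
Qed.

Lemma Gamma_pt (w : C) : Gamma w = pt 1 (rGamma w).
Proof. by rewrite /Gamma /divh /pt oner_eq0. Qed.

Lemma one_sub_pt (a b : C) : (a, b) != 0 ->
  one_sub_div_one_add (pt a b) = pt (b - a) (b + a).
Proof.
rewrite xpair_eqE negb_and {1}/pt; case: (eqVneq b 0) => [->|b0] ab /=.
  by rewrite orbF in ab; rewrite sub0r add0r /pt (negbTE ab) mulNr divff.
have -> : 1 - a / b = (b - a) / b by field.
have -> : 1 + a / b = (b + a) / b by field.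
rewrite /pt !mulf_eq0 invr_eq0 (negbTE b0) !orbF.
case: (eqVneq (b - a) 0) => [h1|h1].
  have -> : b + a == 0 = false.
    apply/negbTE; have -> : b + a = 2 * b - (b - a) by ring.
    by rewrite h1 subr0 mulf_neq0 ?pnatr_eq0.
  by rewrite h1 mul0r.
case: eqP => // /eqP h2; congr Some; field; by rewrite h2 b0.
Qed.

Variables alpha beta : C.
Local Notation U := (upoly alpha beta).
Local Notation V := (vpoly alpha beta).
Implicit Types x y : C.

(** The reciprocals of the denominator and of the numerator of P, which are
    entire functions of x. *)
Definition rgamma_u x : C := rGamma ((x + alpha + 1) / 2) *
  rGamma ((x - alpha - beta + 1) / 2) * rGamma ((x + beta + 1) / 2).
Definition rgamma_v x : C := rGamma ((x - alpha + 1) / 2) *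
  rGamma ((x + alpha + beta + 1) / 2) * rGamma ((x - beta + 1) / 2).

Lemma Pnum_pt x : Pnum alpha beta x = pt 1 (rgamma_v x).
Proof. by rewrite /Pnum !Gamma_pt !mulh_pt !mul1r. Qed.

Lemma Pden_pt x : Pden alpha beta x = pt 1 (rgamma_u x).
Proof. by rewrite /Pden !Gamma_pt !mulh_pt !mul1r. Qed.

Lemma divh_pt1 (a b : C) : (a, b) != 0 -> divh (pt 1 b) (pt 1 a) = pt a b.
Proof.
rewrite xpair_eqE negb_and /pt; case: (eqVneq b 0) => [//|b0] ab /=.
case: (eqVneq a 0) => [->|a0] /=; first by rewrite mul0r.
by rewrite !mul1r !invr_eq0 (negbTE b0) (negbTE a0) invrK mulrC.
Qed.

Lemma gammaP_pt x : (rgamma_u x, rgamma_v x) != 0 ->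
  gammaP alpha beta x = pt (rgamma_u x) (rgamma_v x).
Proof.
move=> h; rewrite -(divh_pt1 h) /gammaP Pnum_pt Pden_pt.
move: h; rewrite xpair_eqE negb_and.
case e1 : (pt 1 (rgamma_v x)) => [?|//]; case e2 : (pt 1 (rgamma_u x)) => [?|//] //.
move: e1 e2; rewrite /pt; case: eqP => // _ _; case: eqP => // _ _.
Qed.

(** The arguments of the three Gamma functions have the same sum (3 x + 3) / 2 in
    both products, so that one normalisation N serves for both. *)
Lemma rgamma_cvg x : exists2 N : nat -> C, (forall n, N n != 0) &
  ((\prod_(k < n.+1) U ((x - 1) / 2 + 1 + k%:R)) / N n @[n --> \oo] --> rgamma_u x) /\
  ((\prod_(k < n.+1) V ((x - 1) / 2 + 1 + k%:R)) / N n @[n --> \oo] --> rgamma_v x).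
Proof.
pose N n : C := (n`!%:R ^+ 3 * cexp ((3 * x + 3) / 2 * (ln n%:R)%:C)).
have N0 n : N n != 0.
  by rewrite mulf_neq0 ?cexp_neq0 // expf_neq0 // pnatr_eq0 -lt0n fact_gt0.
have main (w1 w2 w3 : C) (T : C -> C) : w1 + w2 + w3 = (3 * x + 3) / 2 ->
    (forall k : nat, T ((x - 1) / 2 + 1 + k%:R) = (w1 + k%:R) * (w2 + k%:R) * (w3 + k%:R)) ->
    (\prod_(k < n.+1) T ((x - 1) / 2 + 1 + k%:R)) / N n @[n --> \oo] -->
    rGamma w1 * rGamma w2 * rGamma w3.
  move=> ws hT.
  have -> : (fun n => (\prod_(k < n.+1) T ((x - 1) / 2 + 1 + k%:R)) / N n) =
    (fun n => rGamma_seq w1 n * rGamma_seq w2 n * rGamma_seq w3 n).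
    apply/funext => n; rewrite /N -ws.
    rewrite (eq_bigr (fun k : 'I_n.+1 => (w1 + k%:R) * (w2 + k%:R) * (w3 + k%:R)))
      => [|k _]; last exact: hT.
    rewrite !mulrDl !cexpD !big_split /= /rGamma_seq.
    have h1 : (n`!%:R : C) != 0 by rewrite pnatr_eq0 -lt0n fact_gt0.
    move: (cexp_neq0 (w1 * (ln n%:R)%:C)) (cexp_neq0 (w2 * (ln n%:R)%:C)).
    move: (cexp_neq0 (w3 * (ln n%:R)%:C)) h1.
    move: (n`!%:R : C) (cexp _) (cexp _) (cexp _) => f c3 c1 c2 h3 f0 h1 h2.
    by field; rewrite ?f0 ?h1 ?h2 ?h3.
  by apply: cvgM; [apply: cvgM|]; exact: cvg_rGamma.
exists N => //; split.
  by apply: main => [|k]; rewrite ?/upoly; field.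
by apply: main => [|k]; rewrite ?/vpoly; field.
Qed.

Lemma near_cabs x (e : R) : 0 < e -> \forall y \near x, cabs (y - x) < e.
Proof.
move=> e0; have e0' : 0 < (e%:C : C) by rewrite ltcR.
have := nbhs_ball_norm x (PosNum e0'); apply: filterS => y.
by rewrite /ball_ /= normE ltcR cabs_distC.
Qed.

(** The zeros in y lie in a row at distances multiple of 2, so at most one of them
    other than x is at distance less than 1 from x. *)
Lemma rGamma_near x (a : C) : \forall y \near x^', rGamma ((y + a) / 2) != 0.
Proof.
suff [e e0 he] : exists2 e : R, 0 < e & forall y, cabs (y - x) < e -> y != x ->
    rGamma ((y + a) / 2) != 0.
  by move: (near_cabs x e0); apply: (@filterS _ (nbhs x)) => y; exact: he.
have pole y : rGamma ((y + a) / 2) = 0 -> exists k : nat, y = - a - 2 * k%:R.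
  move=> /rGamma_eq0 [k hk]; exists k.
  have -> : y = 2 * ((y + a) / 2) - a by field.
  by rewrite hk; ring.
have [[p [k pk px] p1]|no] := pselect (exists2 p,
    exists2 k : nat, p = - a - 2 * k%:R & p != x & cabs (p - x) < 1).
  exists (cabs (p - x)); first by rewrite cabs_gt0 subr_eq0.
  move=> y yp yx; apply/eqP => /pole [l yl].
  have ypE : y - p = 2 * (k%:R - l%:R) by rewrite yl pk; ring.
  have : cabs (y - p) < 2.
    have -> : y - p = (y - x) - (p - x) by ring.
    apply: le_lt_trans (cabsB _ _) _; lra.
  rewrite ypE cabsM cabs_nat -[ltRHS]mulr1 ltr_pM2l // => kl.
  have : k = l.
    apply/eqP/negPn/negP => nkl.
    suff : 1 <= cabs (k%:R - l%:R : C) by rewrite leNgt kl.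
    rewrite !natC -rmorphB cabs_real.
    wlog lk : k l nkl {pk yl ypE kl} / (l < k)%N.
      move=> hw; case: (ltngtP l k) => [|kl'|e]; first exact: hw.
        by rewrite distrC; apply: hw => //; rewrite eq_sym.
      by rewrite e eqxx in nkl.
    by rewrite -natrB ?(ltnW lk) // normr_nat ler1n subn_gt0.
  by move=> kle; move: yp; rewrite yl pk kle ltxx.
exists 1 => // y y1 yx; apply/eqP => /pole [k yk]; apply: no.
by exists y => //; exists k.
Qed.

Lemma rgamma_near x : \forall y \near x^', rgamma_u y != 0 /\ rgamma_v y != 0.
Proof.
have ne3 a b c : a != 0 -> b != 0 -> c != 0 -> a * b * c != 0 :> C.
  by move=> a0 b0 c0; rewrite mulf_neq0 ?c0 // mulf_neq0.
have hu : \forall y \near x^', rgamma_u y != 0.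
  have u1 := rGamma_near x (alpha + 1); have u3 := rGamma_near x (beta + 1).
  apply: filterS3 u1 (rGamma_near x (- alpha - beta + 1)) u3 => y.
  by rewrite /rgamma_u !addrA; exact: ne3.
have hv : \forall y \near x^', rgamma_v y != 0.
  have v1 := rGamma_near x (- alpha + 1); have v3 := rGamma_near x (- beta + 1).
  apply: filterS3 v1 (rGamma_near x (alpha + beta + 1)) v3 => y.
  by rewrite /rgamma_v !addrA; exact: ne3.
by apply: filterS2 hu hv => y; split.
Qed.

(** At a common zero, P is read off any continuous expression of the quotient. *)
Lemma gammaP_lim x (A B : C -> C) : (rgamma_u x, rgamma_v x) = 0 ->
  (A x, B x) != 0 -> {for x, continuous A} -> {for x, continuous B} ->
  (\forall y \near x^', A y * rgamma_v y = B y * rgamma_u y) ->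
  (\forall y \near x^', (A y, B y) != 0) ->
  gammaP alpha beta x = pt (A x) (B x).
Proof.
move=> [u0 v0] AB cA cB hAB nAB.
rewrite /gammaP Pnum_pt Pden_pt u0 v0 /pt !eqxx.
apply: (cvg_lim (@sphere_hausdorff R)).
have punct (F : C -> C) : {for x, continuous F} -> F y @[y --> x^'] --> F x.
  move=> cF W nW; move: (cF W nW); apply: (@filterS _ (nbhs x)) => y Wy _; exact: Wy.
have h : pt (A y) (B y) @[y --> x^'] --> pt (A x) (B x).
  exact: (cvg_pt AB (punct A cA) (punct B cB)).
move=> W nW; have hW := h W nW; have gn := rgamma_near x.
rewrite /= /nbhs /=; near=> y.
have [uy vy] : rgamma_u y != 0 /\ rgamma_v y != 0 by near: y.
rewrite /= Pnum_pt Pden_pt divh_pt1; last by rewrite xpair_eqE negb_and uy.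
have -> : pt (rgamma_u y) (rgamma_v y) = pt (A y) (B y).
  apply: pt_eq.
  - by near: y.
  - by rewrite xpair_eqE negb_and uy.
  - by rewrite mulrC [RHS]mulrC; apply/esym; near: y.
by near: y.
Unshelve. all: by end_near. Qed.

End GammaSide.

(** * The minimal solution and the Gamma quotient *)

Section GammaIdentity.
Local Open Scope classical_set_scope.
Local Open Scope complex_scope.
Variable R : realType.
Local Notation C := R[i].

Section FixedPair.
Variables alpha beta : C.
Local Notation U := (upoly alpha beta).
Local Notation V := (vpoly alpha beta).
Local Notation level := (large_level alpha beta).
Implicit Types (x z : C) (f : nat -> C).

Definition far_right (D : R) z := 2 * D + cabs (alpha ^+ 2 + alpha * beta + beta ^+ 2) <=
  complex.Re ((2 * z + 1) ^+ 2).

Lemma far_right_near D z : exists J0 : nat, forall J, (J0 < J)%N -> far_right D (z + J%:R).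
Proof.
rewrite /far_right; set c := cabs _; set w := 2 * z + 1.
pose B := 2 * D + c + complex.Im w ^+ 2.
have [J0 hJ] := nat_large (`|complex.Re w| + `|B| + 1).
exists J0 => J /hJ big.
have -> : (2 * (z + J%:R) + 1) = w + 2%:R * J%:R by rewrite /w; ring.
have eR : complex.Re (w + 2%:R * J%:R) = complex.Re w + 2 * J%:R.
  by rewrite -natrM ReCD ReC_nat natrM.
have eI : complex.Im (w + 2%:R * J%:R) = complex.Im w.
  by rewrite -natrM ImCD ImC_nat addr0.
rewrite expr2 ReCM eR eI.
have n1 := ler_norm (- complex.Re w); rewrite normrN in n1.
have := ler_norm B; rewrite {1}/B => n2.
have B0 := normr_ge0 B; have w0 := normr_ge0 (complex.Re w).
have J1 : `|B| + 1 <= complex.Re w + 2 * J%:R by lra.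
have : (`|B| + 1) * (`|B| + 1) <= (complex.Re w + 2 * J%:R) * (complex.Re w + 2 * J%:R).
  by rewrite ler_pM //; lra.
have : 0 <= `|B| * `|B| by rewrite mulr_ge0.
rewrite -(expr2 (complex.Im w)); move: B0 n2; move: `|B| => b; lra.
Qed.

Definition base_dominated (D : R) f := 2^-1 * D * cabs (f 1%N) <= cabs (V 0) * cabs (f 0%N).

Lemma base_dominated_zero D z f K : solves alpha beta z f -> level <= D -> far_right D z ->
  f K.+1 = 0 -> base_dominated D f.
Proof.
move=> hf hD hz fK; have := dominated_below_zero hf hD hz fK (leq0n K).
by rewrite add0r expr0n /= add0r.
Qed.

(** The sum and the difference of [f 1] and [f 0] are multiplied by Gamma factors
    when x moves to the right.  If [f 1] becomes negligible before [f 0], the two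
    limits are opposite. *)
Lemma shift_limit x f : solves alpha beta ((x - 1) / 2) f ->
  (forall D, level <= D -> exists J0 : nat, forall J, (J0 < J)%N ->
     base_dominated D (shift_iter alpha beta ((x - 1) / 2) f J)) ->
  (f 1%N + f 0%N) * rgamma_u alpha beta x + (f 1%N - f 0%N) * rgamma_v alpha beta x = 0.
Proof.
set z := (x - 1) / 2 => hf hdom; have [N N0 [hU hV]] := rgamma_cvg alpha beta x.
set s := f 1%N + f 0%N; set t := f 1%N - f 0%N.
set Gu := rgamma_u _ _ _ in hU *; set Gv := rgamma_v _ _ _ in hV *.
pose F J := shift_iter alpha beta z f J.
have F1 : F n.+1 1%N / N n @[n --> \oo] --> (Gu * s + Gv * t) / 2.
  have -> : (fun n => F n.+1 1%N / N n) = fun n =>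
      ((\prod_(k < n.+1) U (z + 1 + k%:R)) / N n * s +
       (\prod_(k < n.+1) V (z + 1 + k%:R)) / N n * t) / 2.
    apply/funext => n; have := shift_iter_sum n.+1 hf; have := shift_iter_diff n.+1 hf.
    rewrite -/(F n.+1) -/s -/t => e1 e2.
    have -> : F n.+1 1%N = ((F n.+1 1%N + F n.+1 0%N) + (F n.+1 1%N - F n.+1 0%N)) / 2 by field.
    by rewrite e1 e2; field.
  by apply: (cvgM (cvgD (cvgM hU (cvg_cst s)) (cvgM hV (cvg_cst t))) (cvg_cst _)).
have F0 : F n.+1 0%N / N n @[n --> \oo] --> (Gu * s - Gv * t) / 2.
  have -> : (fun n => F n.+1 0%N / N n) = fun n =>
      ((\prod_(k < n.+1) U (z + 1 + k%:R)) / N n * s -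
       (\prod_(k < n.+1) V (z + 1 + k%:R)) / N n * t) / 2.
    apply/funext => n; have := shift_iter_sum n.+1 hf; have := shift_iter_diff n.+1 hf.
    rewrite -/(F n.+1) -/s -/t => e1 e2.
    have -> : F n.+1 0%N = ((F n.+1 1%N + F n.+1 0%N) - (F n.+1 1%N - F n.+1 0%N)) / 2 by field.
    by rewrite e1 e2; field.
  by apply: (cvgM (cvgB (cvgM hU (cvg_cst s)) (cvgM hV (cvg_cst t))) (cvg_cst _)).
set L1 := _ / 2 in F1; set L0 := _ / 2 in F0.
have bound D : level <= D -> 2^-1 * D * cabs L1 <= cabs (V 0) * cabs L0.
  move=> hD; have [J0 hJ0] := hdom D hD.
  have c1 : 2^-1 * D * cabs (F n.+1 1%N / N n) @[n --> \oo] --> 2^-1 * D * cabs L1.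
    exact: (cvgM (cvg_cst (2^-1 * D)) (cvg_cabs F1)).
  have c0 : cabs (V 0) * cabs (F n.+1 0%N / N n) @[n --> \oo] --> cabs (V 0) * cabs L0.
    exact: (cvgM (cvg_cst (cabs (V 0))) (cvg_cabs F0)).
  apply: (ler_cvg_to c1 c0); exists J0 => // n /= Jn.
  rewrite (cabsM (F n.+1 1%N)) (cabsM (F n.+1 0%N)) !mulrA.
  by rewrite ler_wpM2r ?cabs_ge0 //; exact: (hJ0 n.+1).
suff L10 : L1 = 0.
  have -> : s * Gu + t * Gv = 2 * L1 by rewrite /L1; field.
  by rewrite L10 mulr0.
apply/eqP/negPn/negP; rewrite -cabs_gt0 => L1p.
(* large enough to contradict the bound *)
pose D := `|level| + 2 * (cabs (V 0) * cabs L0 + 1) / cabs L1.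
have hD : level <= D.
  apply: le_trans (ler_norm _) _; rewrite lerDl divr_ge0 ?cabs_ge0 // mulr_ge0 //.
  by rewrite addr_ge0 // mulr_ge0 ?cabs_ge0.
have := bound D hD; rewrite /D mulrDr mulrDl.
have -> : 2^-1 * (2 * (cabs (V 0) * cabs L0 + 1) / cabs L1) * cabs L1 =
  cabs (V 0) * cabs L0 + 1 by field; rewrite gt_eqF.
have : 0 <= 2^-1 * `|level| * cabs L1 by rewrite !mulr_ge0 ?cabs_ge0.
lra.
Qed.

Section Regular.
Hypothesis U_neq0 : forall n, (0 < n)%N -> U n%:R != 0.
Hypothesis V_neq0 : forall n, (0 < n)%N -> V n%:R != 0.
Hypothesis V00 : V 0 != 0.
Variable e : R.
Hypothesis e_gt0 : 0 < e.

(** A multiple of another solution makes f vanish at K + 1.  As f is negligible,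
    the multiple tends to 0 with K, and the bound passes to the limit. *)
Lemma minimal_dominated (D : R) z f : 3 * e < 2 * complex.Re (2 * z + 1) ->
  solves alpha beta z f -> decaying e z (fun n => f n.+1) ->
  level <= D -> far_right D z -> base_dominated D f.
Proof.
move=> he hf df hD hz.
have [s [hs ds]] := nondecaying_exists U_neq0 V_neq0 e_gt0 he.
(* the term of index -1 that the first step imposes *)
pose fs n := if n is n'.+1 then s n' else
  (midcoef alpha beta z 0 * s 0%N - U 1 * s 1%N) / V 0.
have hfs : solves alpha beta z fs.
  move=> [|n]; last exact: hs.
  by rewrite /= mulrC [V 0 * _]mulrC divfK //; ring.
have [s0 fs0] := minimal_negligible U_neq0 e_gt0 he hs df ds.
have bound : \forall K \near \oo,
    2^-1 * D * cabs (f 1%N - f K.+1 / s K * s 0%N) <=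
    cabs (V 0) * cabs (f 0%N - f K.+1 / s K * fs 0%N).
  apply: filterS s0 => K sK.
  apply: (@base_dominated_zero D z (fun n => f n - f K.+1 / s K * fs n) K) => //.
    move=> n; rewrite mulrBr mulrCA hf hfs; ring.
  by rewrite /= divfK // subrr.
have c1 : 2^-1 * D * cabs (f 1%N - f K.+1 / s K * s 0%N) @[K --> \oo] -->
    2^-1 * D * cabs (f 1%N - 0 * s 0%N).
  apply: (cvgM (cvg_cst (2^-1 * D))).
  exact: (cvg_cabs (cvgB (cvg_cst (f 1%N)) (cvgM fs0 (cvg_cst (s 0%N))))).
have c0 : cabs (V 0) * cabs (f 0%N - f K.+1 / s K * fs 0%N) @[K --> \oo] -->
    cabs (V 0) * cabs (f 0%N - 0 * fs 0%N).
  apply: (cvgM (cvg_cst (cabs (V 0)))).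
  exact: (cvg_cabs (cvgB (cvg_cst (f 0%N)) (cvgM fs0 (cvg_cst (fs 0%N))))).
have : 2^-1 * D * cabs (f 1%N - 0 * s 0%N) <= cabs (V 0) * cabs (f 0%N - 0 * fs 0%N).
  by apply: (ler_cvg_to c1 c0).
by rewrite !mul0r !subr0.
Qed.

(** The shift preserves minimality, which gives the bound far to the right. *)
Lemma minimal_identity x f : 3 * e < 2 * complex.Re x ->
  solves alpha beta ((x - 1) / 2) f ->
  decaying e ((x - 1) / 2) (fun n => f n.+1) ->
  (f 1%N + f 0%N) * rgamma_u alpha beta x + (f 1%N - f 0%N) * rgamma_v alpha beta x = 0.
Proof.
move=> he hf df; apply: shift_limit => // D hD; set z := (x - 1) / 2.
have zx : 2 * z + 1 = x by rewrite /z; field.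
have hJ J : 3 * e < 2 * complex.Re (2 * (z + J%:R) + 1).
  have -> : 2 * (z + J%:R) + 1 = x + (2 * J)%:R :> C by rewrite -zx natrM; ring.
  rewrite ReCD ReC_nat; apply: lt_le_trans he _.
  by rewrite ler_wpM2l // lerDl.
have dJ J : decaying e (z + J%:R) (fun n => shift_iter alpha beta z f J n.+1).
  elim: J => [|J IH]; first by rewrite addr0.
  rewrite -natr1 addrA /=.
  apply: (shift_up_decaying U_neq0 e_gt0 (hJ J) _ IH); exact: shift_iter_solves.
have [J0 hJ0] := far_right_near D z.
exists J0 => J /hJ0 far; apply: minimal_dominated far => //.
exact: shift_iter_solves.
Qed.

End Regular.

(** When V vanishes at m + 1, a solution supported on the indices up to m plays the
    part of the minimal solution, for every x. *)
Lemma stopped_identity_v x m : V 0 != 0 -> V m.+1%:R = 0 ->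
  (forall i, (0 < i <= m)%N -> U i%:R * V i%:R != 0) ->
  let a2 := kappa alpha beta in let b2 := fun n => x ^+ 2 + lambda alpha beta n in
  let c := alpha * beta * (alpha + beta) / 4 in
  let A := cnum a2 b2 m.+1 in let B := cdenom a2 b2 m.+1 in
  c * B * (rgamma_u alpha beta x + rgamma_v alpha beta x) +
  A * (rgamma_u alpha beta x - rgamma_v alpha beta x) = 0.
Proof.
move=> V0 Vm UV a2 b2 c A B; set z := (x - 1) / 2.
have cE : c = 2 * V 0 by rewrite /c /vpoly; field.
have c0 : c != 0 by rewrite cE mulf_neq0 ?pnatr_eq0.
(* the combination that vanishes at m + 1, hence from then on as kappa (m + 1) = 0 *)
pose s n := A * cdenom a2 b2 n - B * cnum a2 b2 n.
have hs : recurs a2 b2 s.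
  by move=> n; rewrite /s cdenom_recurs cnum_recurs; ring.
have sm : s m.+1 = 0 by rewrite /s -/A -/B; ring.
have s_after n : (m < n)%N -> s n = 0.
  move=> /subnK <-; elim/ltn_ind: (n - m.+1)%N => -[_|[_|k IH]].
  - by rewrite add0n.
  - have am : a2 m.+1 = 0 by rewrite /a2 kappaS Vm mulr0 oppr0 mul0r.
    by rewrite add1n hs sm am mulr0 mul0r addr0.
  - by rewrite !addSn hs -addSn !IH ?mulr0 ?addr0.
have scale0 n : (n <= m)%N -> fraction_scale alpha beta n != 0.
  move=> nm; apply/prodf_neq0 => k _; rewrite mulf_neq0 ?invr_eq0 ?double_add1_neq0 //.
  rewrite mulf_neq0 ?pnatr_eq0 //.
  have := UV k.+1 (leq_trans (ltn_ord k) nm); by rewrite mulf_eq0 negb_or => /andP[].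
pose f n := if n is n'.+1 then s n' / fraction_scale alpha beta n' else - A / c.
have sc0 : fraction_scale alpha beta 0 = 1 by rewrite /fraction_scale big_ord0.
have hf : solves alpha beta z f.
  move=> [|n].
    rewrite /f sc0 divr1 midcoef_lambda -/z add0r.
    have -> : U 1 * (s 1%N / fraction_scale alpha beta 1) = s 1%N / 2.
      case: (posnP m) => [m0|m0].
        by rewrite (_ : s 1%N = 0) ?mul0r ?mulr0 //; apply: s_after; rewrite m0.
      have u1 : U 1 != 0.
        by have := UV 1%N m0; rewrite mulf_eq0 negb_or => /andP[].
      by rewrite fraction_scaleS sc0 mul1r mulr0 add0r divr1; field.
    have -> : V 0 = c / 2 by rewrite cE; field.
    have -> : s 1%N = A - B * (x ^+ 2 + lambda alpha beta 0) by rewrite /s mulr1.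
    have -> : s 0%N = - B by rewrite /s mulr0 mulr1 sub0r.
    by field.
  rewrite /f; case: (ltnP n m) => nm.
    apply: recurs_solves_at => //; first exact: scale0.
    case: (ltnP n.+1 m) => nm'; last by right; apply: s_after.
    by left; have := UV n.+2 nm'; rewrite mulf_eq0 negb_or => /andP[].
  have s1 : s n.+1 = 0 by apply: s_after; rewrite ltnS.
  have s2 : s n.+2 = 0 by apply: s_after; rewrite ltnS ltnW.
  have -> : V n.+1%:R * (s n / fraction_scale alpha beta n) = 0.
    case: (ltngtP m n) nm => // [mn|<-] _; last by rewrite Vm mul0r.
    by rewrite (s_after n mn) mul0r mulr0.
  by rewrite s1 s2 !mul0r !mulr0 subr0.
have F0 J n : (m.+1 < n)%N -> shift_iter alpha beta z f J n = 0.
  elim: J n => [|J IH] [|n] //= mn; first by rewrite s_after // mul0r.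
  by rewrite /shift_up !IH ?mulr0 ?addr0 // ltnW.
have main := shift_limit hf.
have {main}: (f 1%N + f 0%N) * rgamma_u alpha beta x +
    (f 1%N - f 0%N) * rgamma_v alpha beta x = 0.
  apply: main => D hD; have [J0 hJ0] := far_right_near D z.
  exists J0 => J /hJ0 far.
  apply: (base_dominated_zero (shift_iter_solves J hf) hD far (F0 J m.+2 _)).
  by [].
have -> : f 1%N = - B by rewrite /f sc0 divr1 /s /cnum /cdenom /=; ring.
have -> : f 0%N = - A / c by [].
move=> h; have -> : forall g g', c * B * (g + g') + A * (g - g') =
    - c * ((- B + - A / c) * g + (- B - - A / c) * g') by move=> g g'; field.
by rewrite h mulr0.
Qed.

End FixedPair.

Lemma upolyN (alpha beta t : C) : upoly (- alpha) (- beta) t = vpoly alpha beta t.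
Proof. by rewrite /upoly /vpoly; field. Qed.

Lemma vpolyN (alpha beta t : C) : vpoly (- alpha) (- beta) t = upoly alpha beta t.
Proof. by rewrite /upoly /vpoly; field. Qed.

Lemma kappaN (alpha beta : C) : kappa (- alpha) (- beta) = kappa alpha beta.
Proof.
apply/funext => m; rewrite /kappa; congr (- (_ * _ * _) / _); ring.
Qed.

Lemma lambdaN (alpha beta : C) m : lambda (- alpha) (- beta) m = lambda alpha beta m.
Proof. by rewrite /lambda; congr (_ / 2); ring. Qed.

Lemma rgamma_uN (alpha beta x : C) : rgamma_u (- alpha) (- beta) x = rgamma_v alpha beta x.
Proof. by rewrite /rgamma_u /rgamma_v !opprK. Qed.

Lemma rgamma_vN (alpha beta x : C) : rgamma_v (- alpha) (- beta) x = rgamma_u alpha beta x.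
Proof. by rewrite /rgamma_u /rgamma_v !opprK. Qed.

(** Changing the signs of alpha and beta exchanges U and V, and the two products of
    Gamma functions with them. *)
Lemma stopped_identity (alpha beta x : C) m : vpoly alpha beta 0 != 0 ->
  upoly alpha beta m.+1%:R * vpoly alpha beta m.+1%:R = 0 ->
  (forall i, (0 < i <= m)%N -> upoly alpha beta i%:R * vpoly alpha beta i%:R != 0) ->
  let a2 := kappa alpha beta in let b2 := fun n => x ^+ 2 + lambda alpha beta n in
  let c := alpha * beta * (alpha + beta) / 4 in
  let A := cnum a2 b2 m.+1 in let B := cdenom a2 b2 m.+1 in
  c * B * (rgamma_u alpha beta x + rgamma_v alpha beta x) +
  A * (rgamma_u alpha beta x - rgamma_v alpha beta x) = 0.
Proof.
move=> V0 UVm UV a2 b2 c A B.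
case: (eqVneq (vpoly alpha beta m.+1%:R) 0) => vm; first exact: stopped_identity_v.
have um : upoly alpha beta m.+1%:R = 0.
  by apply/eqP; move/eqP: UVm; rewrite mulf_eq0 (negbTE vm) orbF.
have V0' : vpoly (- alpha) (- beta) 0 != 0.
  rewrite vpolyN; have -> : upoly alpha beta 0 = - vpoly alpha beta 0 by rewrite /upoly /vpoly; field.
  by rewrite oppr_eq0.
have UV' i : (0 < i <= m)%N -> upoly (- alpha) (- beta) i%:R * vpoly (- alpha) (- beta) i%:R != 0.
  by move=> /UV; rewrite upolyN vpolyN mulrC.
have := stopped_identity_v x V0' (etrans (vpolyN _ _ _) um) UV'.
have -> : (fun n => x ^+ 2 + lambda (- alpha) (- beta) n) = b2.
  by apply/funext => n; rewrite lambdaN.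
rewrite kappaN rgamma_uN rgamma_vN -/a2 -/A -/B => h.
have {}h : - alpha * - beta * (- alpha - beta) / 4 * B *
    (rgamma_v alpha beta x + rgamma_u alpha beta x) +
  A * (rgamma_v alpha beta x - rgamma_u alpha beta x) = 0 := h.
rewrite -[RHS]oppr0 -h /c; clearbody A B; ring.
Qed.

End GammaIdentity.

(** * Evaluation of the fractions *)

Section Evaluation.
Local Open Scope classical_set_scope.
Local Open Scope complex_scope.
Variable R : realType.
Local Notation C := R[i].

Lemma continuant_continuous (a : nat -> C) (b : C -> nat -> C)
  (cb : forall n, continuous (fun y => b y n)) n k :
  continuous (fun y => continuant a (b y) k n).
Proof.
move: k; suff [] : (forall k, continuous (fun y => continuant a (b y) k n)) /\
    (forall k, continuous (fun y => continuant a (b y) k n.+1)) by [].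
elim: n => [|n [IH IHS]].
  split=> k y; last exact: (cb k y).
  exact: (@cst_continuous C C 1 y).
split; first exact: IHS.
move=> k y.
have h1 : b t k @[t --> y] --> b y k by exact: (cb k y).
have h2 : continuant a (b t) k.+1 n.+1 @[t --> y] --> continuant a (b y) k.+1 n.+1.
  exact: (IHS k.+1 y).
have h3 : continuant a (b t) k.+2 n @[t --> y] --> continuant a (b y) k.+2 n.
  exact: (IH k.+2 y).
have h := cvgD (cvgM h1 h2) (cvgM (cvg_cst (a k.+1)) h3).
exact: h.
Qed.

Lemma pair_sum_neq0 (a b : C) : (a, b) != 0 -> (b - a, b + a) != 0.
Proof.
apply: contra; rewrite !xpair_eqE => /andP[/eqP h1 /eqP h2].
have two : (2 : C) != 0 by rewrite pnatr_eq0.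
apply/andP; split; apply/eqP; apply: (mulfI two); rewrite mulr0.
  by rewrite -[RHS](subrr 0) -{1}h2 -h1; ring.
by rewrite -[RHS](addr0 0) -{1}h2 -h1; ring.
Qed.

Section FixedPair.
Variables alpha beta : C.
Local Notation U := (upoly alpha beta).
Local Notation V := (vpoly alpha beta).
Local Notation c := (alpha * beta * (alpha + beta) / 4).
Local Notation lhs x := (one_sub_div_one_add (gammaP alpha beta x)).
Local Notation a2 := (kappa alpha beta).
Local Notation b2 x := (fun m => x ^+ 2 + lambda alpha beta m).

Lemma vpoly0 : V 0 = c / 2.
Proof. by rewrite /vpoly; field. Qed.

Lemma vpoly0_neq0 : c != 0 -> V 0 != 0.
Proof. by move=> c0; rewrite vpoly0 mulf_neq0 // invr_eq0 pnatr_eq0. Qed.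

(** The identity holds for every x; at a common zero of the two products, P is
    therefore given by the continuous functions A and B. *)
Lemma quotient_stopped x m : c != 0 -> U m.+1%:R * V m.+1%:R = 0 ->
  (forall i, (0 < i <= m)%N -> U i%:R * V i%:R != 0) ->
  lhs x = divh (Some c) (pt (cnum a2 (b2 x) m.+1) (cdenom a2 (b2 x) m.+1)).
Proof.
move=> c0 UV0 UV.
pose A (y : C) : C := cnum a2 (b2 y) m.+1.
pose B (y : C) : C := cdenom a2 (b2 y) m.+1.
have AB y : (A y, B y) != 0 by have [] := stopped_fractions y UV0 UV.
have cAB y : (c * B y, A y) != 0.
  by move: (AB y); rewrite !xpair_eqE mulf_eq0 (negbTE c0) /= andbC.
have idt y : c * B y * (rgamma_u alpha beta y + rgamma_v alpha beta y) +
    A y * (rgamma_u alpha beta y - rgamma_v alpha beta y) = 0.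
  exact: (stopped_identity y (vpoly0_neq0 c0) UV0 UV).
have cross y : (A y - c * B y) * rgamma_v alpha beta y =
    (A y + c * B y) * rgamma_u alpha beta y.
  apply/eqP; rewrite -subr_eq0 -oppr_eq0 -(idt y); apply/eqP; ring.
have ne y := pair_sum_neq0 (cAB y).
have cb n : continuous (fun y : C => y ^+ 2 + lambda alpha beta n).
  by move=> y; exact: (cvgD (cvgM (@cvg_id _ (nbhs y)) (@cvg_id _ (nbhs y))) (cvg_cst _)).
have contA : continuous A := 
  @continuant_continuous a2 (fun y => b2 y) cb m.+1 0.
have contB : continuous B := 
  @continuant_continuous a2 (fun y => b2 y) cb m 1.
have gE : gammaP alpha beta x = pt (A x - c * B x) (A x + c * B x).
  case: (eqVneq (rgamma_u alpha beta x, rgamma_v alpha beta x) 0) => g0.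
    apply: (gammaP_lim g0 (A := fun y => A y - c * B y) (B := fun y => A y + c * B y)).
    - exact: ne.
    - exact: (cvgB (contA x) (cvgM (cvg_cst c) (contB x))).
    - exact: (cvgD (contA x) (cvgM (cvg_cst c) (contB x))).
    - by apply: nearW => y; exact: cross.
    - by apply: nearW => y; exact: ne.
  rewrite gammaP_pt //; apply: pt_eq => //.
  by rewrite mulrC -cross mulrC.
rewrite gE one_sub_pt // (divh_pt c0 (AB x)).
have two : (2 : C) != 0 by rewrite pnatr_eq0.
by rewrite -(ptZ (c * B x) (A x) two); congr pt; ring.
Qed.

(** The two products of Gamma functions coincide, so that P is identically 1. *)
Lemma quotient_zero x : c = 0 -> lhs x = Some 0.
Proof.
move=> c0.
have uv y : rgamma_u alpha beta y = rgamma_v alpha beta y.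
  have /or3P[/eqP h|/eqP h|/eqP h] : [|| alpha == 0, beta == 0 | alpha + beta == 0].
  - move/eqP: c0; rewrite !mulf_eq0 invr_eq0 pnatr_eq0 orbF -orbA; exact.
  - by rewrite /rgamma_u /rgamma_v h !subr0 !addr0 mulrAC.
  - by rewrite /rgamma_u /rgamma_v h !subr0 !addr0 mulrAC; ring.
  - have -> : beta = - alpha by apply/eqP; rewrite -addr_eq0 addrC h.
    by rewrite /rgamma_u /rgamma_v opprK subrK addrK; ring.
suff -> : gammaP alpha beta x = pt 1 1.
  rewrite one_sub_pt ?xpair_eqE ?oner_eq0 // subrr /pt mul0r.
  by case: eqP => // /eqP; rewrite (_ : 1 + 1 = 2) // pnatr_eq0.
case: (eqVneq (rgamma_u alpha beta x) 0) => g0.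
  apply: (gammaP_lim (A := fun=> 1) (B := fun=> 1)).
  - by rewrite -uv g0.
  - by rewrite xpair_eqE oner_eq0.
  - exact: (@cst_continuous C C 1 x).
  - exact: (@cst_continuous C C 1 x).
  - by apply: nearW => y; rewrite !mul1r uv.
  - by apply: nearW => y; rewrite xpair_eqE oner_eq0.
have gn : (rgamma_u alpha beta x, rgamma_v alpha beta x) != 0 by rewrite xpair_eqE negb_and g0.
rewrite gammaP_pt //; apply: pt_eq => //; first by rewrite xpair_eqE oner_eq0.
by rewrite !mulr1 uv.
Qed.

Lemma even_stop : c != 0 ->
  even_integer alpha \/ even_integer beta \/ even_integer (alpha + beta) ->
  exists2 n, (0 < n)%N & U n%:R * V n%:R = 0.
Proof.
move=> c0; have [al0 be0 ab0] : [/\ alpha != 0, beta != 0 & alpha + beta != 0].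
  by move: c0; rewrite !mulf_eq0 !negb_or => /andP[/andP[/andP[-> ->] ->] _].
have half (g : C) (k : int) : g != 0 -> g = (2 * k)%:~R -> exists2 n, (0 < n)%N &
    (n%:R - g / 2 = 0 \/ n%:R + g / 2 = 0).
  move=> g0 gk; have k0 : k != 0 by apply: contraNneq g0 => k0; rewrite gk k0 mulr0.
  have hg : g / 2 = k%:~R by rewrite gk intrM mulrC mulKf // pnatr_eq0.
  exists `|k|%N; first by rewrite absz_gt0.
  rewrite hg; case: (lerP 0 k) => hk.
    by left; rewrite -{2}(gez0_abs hk) -pmulrn subrr.
  have -> : k%:~R = - (`|k|%N%:R) :> C by rewrite pmulrn ltz0_abs // mulrNz opprK.
  by right; rewrite subrr.
case=> [[k hk]|[[k hk]|[k hk]]].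
- have [n n0 [h|h]] := half alpha k al0 hk; exists n => //.
    by rewrite /vpoly h !mul0r mulr0.
  by rewrite /upoly h !mul0r.
- have [n n0 [h|h]] := half beta k be0 hk; exists n => //.
    by rewrite /vpoly h mulr0 mul0r mulr0.
  by rewrite /upoly h mulr0 !mul0r.
- have [n n0 [h|h]] := half (alpha + beta) k ab0 hk; exists n => //.
    by rewrite /upoly h mulr0 mul0r.
  by rewrite /vpoly h !mulr0.
Qed.

Lemma first_stop : (exists2 n, (0 < n)%N & U n%:R * V n%:R = 0) ->
  exists m, U m.+1%:R * V m.+1%:R = 0 /\
    forall i, (0 < i <= m)%N -> U i%:R * V i%:R != 0.
Proof.
case=> n n0 hn.
have ex : exists n, (0 < n)%N && (U n%:R * V n%:R == 0) by exists n; rewrite n0 hn eqxx.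
case: (ex_minnP ex) => -[//|m] /andP[_ /eqP hm] min_m; exists m; split=> // i /andP[i0 im].
apply/negP => hi; have := min_m i; rewrite i0 hi => /(_ isT).
by rewrite ltnNge im.
Qed.

(** A common zero gives two poles of Gamma, at an argument of each product.  Their
    sum is x + 1, of positive real part, or their difference is half of alpha, beta
    or alpha + beta up to sign, which would make that number an even integer. *)
Lemma rgamma_neq0 x : c != 0 -> 0 < complex.Re x ->
  (forall n, (0 < n)%N -> U n%:R * V n%:R != 0) ->
  (rgamma_u alpha beta x, rgamma_v alpha beta x) != 0.
Proof.
move=> c0 x0 reg; apply/negP; rewrite xpair_eqE /rgamma_u /rgamma_v.
have noteven (g : C) : g = alpha \/ g = beta \/ g = alpha + beta -> even_integer g -> False.
  move=> hg ev; have [] := even_stop c0.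
    by case: hg => [<-|[<-|<-]]; [left|right; left|right; right].
  by move=> n n0 /eqP; rewrite (negbTE (reg n n0)).
have pole (w : C) : rGamma w = 0 -> exists k : nat, 2 * w = - (2 * k%:R).
  by move=> /rGamma_eq0 [k ->]; exists k; rewrite mulrN.
have opp (g w w' : C) : 2 * w = x + g + 1 -> 2 * w' = x - g + 1 ->
    rGamma w = 0 -> rGamma w' = 0 -> False.
  move=> e1 e2 /pole [k hk] /pole [l hl].
  have : 2%:R * x = - (2%:R * (k + l + 1)%:R) :> C.
    have -> : 2%:R * x = (2 * w + 2 * w') - 2 by rewrite e1 e2; ring.
    by rewrite hk hl !natrD; ring.
  move=> /(congr1 (@complex.Re R)).
  rewrite ReCN !ReCM !(ReC_nat, ImC_nat) !mul0r !subr0 => h.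
  have : (0 : R) <= (k + l + 1)%:R by [].
  by move: x0 h; lra.
have dif (g w w' : C) : 2 * w - 2 * w' = g -> rGamma w = 0 -> rGamma w' = 0 -> even_integer g.
  move=> <- /pole [k ->] /pole [l ->]; exists (l%:Z - k%:Z)%R.
  by rewrite intrM intrB -!pmulrn; ring.
have evN (g : C) : even_integer (- g) -> even_integer g.
  by case=> k hk; exists (- k); rewrite mulrN mulrNz -hk opprK.
rewrite !mulf_eq0 => /andP[/orP[/orP[]|] /eqP hu /orP[/orP[]|] /eqP hv].
- by apply: (opp alpha _ _ _ _ hu hv); field.
- by apply: (noteven beta); [right; left|apply: evN; apply: (dif _ _ _ _ hu hv); field].
- by apply: (noteven (alpha + beta)); [right; right|apply: (dif _ _ _ _ hu hv); field].
- by apply: (noteven beta); [right; left|apply: evN; apply: (dif _ _ _ _ hu hv); field].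
- by apply: (opp (- alpha - beta) _ _ _ _ hu hv); field.
- by apply: (noteven alpha); [left|apply: evN; apply: (dif _ _ _ _ hu hv); field].
- by apply: (noteven (alpha + beta)); [right; right|apply: (dif _ _ _ _ hu hv); field].
- by apply: (noteven alpha); [left|apply: evN; apply: (dif _ _ _ _ hu hv); field].
- by apply: (opp beta _ _ _ _ hu hv); field.
Qed.

(** Both sides are read on the terms of index 0 and -1 of the minimal solution. *)
Lemma quotient_regular x : c != 0 -> 0 < complex.Re x ->
  (forall n, (0 < n)%N -> U n%:R != 0) -> (forall n, (0 < n)%N -> V n%:R != 0) ->
  exists w : sphere R, [/\ lhs x = divh (Some c) w,
    approximant a2 (b2 x) n @[n --> \oo] --> w &
    x != 1 -> approximant (acoef alpha beta) (bcoef alpha beta x) n @[n --> \oo] --> w].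
Proof.
move=> c0 x0 U0 V0.
have [M [m1 [hM dM M1 M0 [lim2 lim1]]]] := regular_fractions U0 V0 x0.
have e0 : 0 < complex.Re x / 2 by rewrite divr_gt0.
have e1 : 3 * (complex.Re x / 2) < 2 * complex.Re x by lra.
(* the term of index -1 is imposed by the first step, [vpoly 0] being c / 2 *)
pose f n := if n is n'.+1 then M n' else - m1 / c.
have hf : solves alpha beta ((x - 1) / 2) f.
  move=> [|n]; last exact: hM.
  rewrite /f /= midcoef_lambda vpoly0 add0r.
  have -> : U 1 * M 1%N = ((x ^+ 2 + lambda alpha beta 0) * M 0%N + m1) / 2.
    by rewrite -M1; field.
  move: c0; move: (alpha * beta * (alpha + beta) / 4) => q q0.
  by field.
have idt := minimal_identity U0 V0 (vpoly0_neq0 c0) e0 e1 hf dM.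
have gn : (rgamma_u alpha beta x, rgamma_v alpha beta x) != 0.
  by apply: rgamma_neq0 => // n n0; rewrite mulf_neq0 ?U0 ?V0.
have M0' : (- m1, M 0%N) != 0.
  by move: M0; rewrite !xpair_eqE oppr_eq0 andbC.
exists (pt (- m1) (M 0%N)); split=> //.
rewrite gammaP_pt // one_sub_pt // divh_pt //; apply: pt_eq.
- by move: M0; rewrite !xpair_eqE oppr_eq0 mulf_eq0 (negbTE c0).
- exact: pair_sum_neq0.
- move: idt; rewrite /f; move: (rgamma_u _ _ _) (rgamma_v _ _ _) c0 => u v.
  move: (alpha * beta * (alpha + beta) / 4) => q q0 h.
  have : q * ((M 0%N + - m1 / q) * u + (M 0%N - - m1 / q) * v) = 0 by rewrite h mulr0.
  have -> : q * ((M 0%N + - m1 / q) * u + (M 0%N - - m1 / q) * v) =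
    (v + u) * (q * M 0%N) - (v - u) * (- m1) by field.
  by move=> /eqP; rewrite subr_eq0 => /eqP.
Qed.

End FixedPair.
End Evaluation.

Theorem theorem1p5 (R : realType) (x alpha beta : R[i]) :
  let lhs := one_sub_div_one_add (gammaP alpha beta x) in
  let c := alpha * beta * (alpha + beta) / 4 in
  (0 < complex.Re x ->
     (x <> 1 -> is_cfrac_quot c (acoef alpha beta) (bcoef alpha beta x) lhs)
     /\ is_cfrac_quot c (kappa alpha beta)
          (fun m => x ^+ 2 + lambda alpha beta m) lhs)
  /\
  (even_integer alpha \/ even_integer beta \/ even_integer (alpha + beta) ->
     is_cfrac_quot_term c (acoef alpha beta) (bcoef alpha beta x) lhs
     /\ is_cfrac_quot_term c (kappa alpha beta)
          (fun m => x ^+ 2 + lambda alpha beta m) lhs).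
Proof.
move=> lhs c; have [c0|c0] := eqVneq c 0.
  have l0 : lhs = Some 0 by exact: quotient_zero.
  split=> [x0|_]; last by split; left.
  have [/first_stop [m [UV0 UV]]|reg] := pselect (exists2 n, (0 < n)%N &
    upoly alpha beta n%:R * vpoly alpha beta n%:R = 0).
    have [_ h1 h2] := stopped_fractions x UV0 UV.
    by split=> [_|]; eexists; [exact: h1|rewrite l0 c0 divh0|exact: h2|rewrite l0 c0 divh0].
  have U0 n : (0 < n)%N -> upoly alpha beta n%:R != 0.
    by move=> n0; apply/eqP => h; apply: reg; exists n => //; rewrite h mul0r.
  have V0 n : (0 < n)%N -> vpoly alpha beta n%:R != 0.
    by move=> n0; apply/eqP => h; apply: reg; exists n => //; rewrite h mulr0.
  have [M [m1 [_ _ _ _ [h2 h1]]]] := regular_fractions U0 V0 x0.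
  split=> [/eqP x1|]; eexists; [exact: h1|by rewrite l0 c0 divh0|exact: h2|by rewrite l0 c0 divh0].
have stopped : (exists2 n, (0 < n)%N &
    upoly alpha beta n%:R * vpoly alpha beta n%:R = 0) ->
    is_cfrac_quot c (acoef alpha beta) (bcoef alpha beta x) lhs /\
    is_cfrac_quot c (kappa alpha beta) (fun m => x ^+ 2 + lambda alpha beta m) lhs.
  move=> /first_stop [m [UV0 UV]]; have [_ h1 h2] := stopped_fractions x UV0 UV.
  have e := quotient_stopped x c0 UV0 UV.
  by split; eexists; [exact: h1|exact: e|exact: h2|exact: e].
split=> [x0|ev]; last by have [h1 h2] := stopped (even_stop c0 ev); split; right.
have [/stopped [h1 h2] //|reg] := pselect (exists2 n, (0 < n)%N &
  upoly alpha beta n%:R * vpoly alpha beta n%:R = 0).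
have U0 n : (0 < n)%N -> upoly alpha beta n%:R != 0.
  by move=> n0; apply/eqP => h; apply: reg; exists n => //; rewrite h mul0r.
have V0 n : (0 < n)%N -> vpoly alpha beta n%:R != 0.
  by move=> n0; apply/eqP => h; apply: reg; exists n => //; rewrite h mulr0.
have [w [e h2 h1]] := quotient_regular c0 x0 U0 V0.
by split=> [/eqP x1|]; exists w => //; exact: h1.
Qed.
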